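(* Let $X$ be an irreducible monoid scheme which has an open affine cover $\mathcal{U}=\{U_\alpha\}$ such that any finite intersection of the sets $U_\alpha$ is isomorphic to the prime spectrum of a cancellative monoid. Let $K$ be an (additively) idempotent semifield. Then there exists a natural bijection between $Vect_n(X)$ and $Vect_n(X_K)$.
   Context: A monoid means a commutative multiplicative monoid $M$ with identity $1$ and an absorbing element $0_M$ ($0_M\cdot a=0_M$ for all $a$). It is cancellative if $ab=ac$ with $a\neq 0_M$ implies $b=c$. An ideal of $M$ is a nonempty subset $I$ with $MI\subseteq I$; it is prime if $M\setminus I$ is a nonempty multiplicative subset. $\operatorname{Spec} M$ is the set of prime ideals with the Zariski topology (basis $D(f)=\{\mathfrak p: f\notin\mathfrak p\}$) and structure sheaf of monoids defined by localization as for rings. A monoid scheme is a topological space with a sheaf of monoids locally isomorphic to such affine monoid schemes. An $M$-set is a nonempty pointed set with an action of $M$; an $\mathcal{O}_X$-module on a monoid scheme $X$ is a sheaf $\mathcal{F}$ of pointed sets such that each $\mathcal{F}(U)$ is an $\mathcal{O}_X(U)$-set, compatibly with restrictions. A semiring is a set with $+,\cdot$ satisfying the commutative ring axioms except existence of additive inverses; it is a semifield if its nonzero elements form a group under multiplication, and additively idempotent if $a+a=a$ for all $a$. A semiring scheme is a locally semiringed space locally isomorphic to prime spectra of semirings (defined as for rings). For a monoid $M$, $K[M]$ is the monoid semiring, with $0_M$ identified with $0_K$. For a monoid scheme $X$, $X_K$ is the semiring scheme obtained by base change: it is obtained by replacing each affine piece $\operatorname{Spec} M$ by $\operatorname{Spec}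 K[M]$ and gluing. A vector bundle of rank $n$ on a monoid scheme or a semiring scheme $Y$ is an $\mathcal{O}_Y$-module which is locally isomorphic to $\bigoplus_{i\in I}\mathcal{O}_Y|_U$ with $|I|=n$ (the coproduct of $\mathcal{O}_Y$-modules; in the monoid case this is the wedge sum of pointed sets, locally). $Vect_n(Y)$ denotes the set of isomorphism classes of vector bundles of rank $n$ on $Y$. *)

(* Defs.v *)
From HB Require Import structures.
From mathcomp Require Import all_boot all_order all_algebra finmap.
From mathcomp Require Import generic_quotient all_classical topology_structure.
Set Implicit Arguments.
Unset Strict Implicit.
Unset Printing Implicit Defensive.
Import GRing.Theory.
Local Open Scope classical_set_scope.
Local Open Scope quotient_scope.

Record opens (X : topologicalType) := Opens {
  oset :> set X;
  opensP : open oset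
}.

Definition openT (X : topologicalType) : opens X := Opens (@openT X).

Definition preopens (X Y : topologicalType) (f : X -> Y) (cf : continuous f)
  (V : opens Y) : opens X :=
  Opens (open_comp (fun x _ => cf x) (@opensP Y V)).

Record is_sheaf (X : topologicalType) (F : opens X -> Type)
    (res : forall U V : opens X, V `<=` U -> F U -> F V) : Prop := IsSheaf {
  sheaf_id : forall (U : opens X) (UU : U `<=` U) (s : F U), res U U UU s = s;
  sheaf_comp : forall (U V W : opens X) (VU : V `<=` U) (WV : W `<=` V) (WU : W `<=` U)
    (s : F U), res V W WV (res U V VU s) = res U W WU s;
  sheaf_glue : forall (U : opens X) (I : Type) (V : I -> opens X)
    (VU : forall i, V i `<=` U), U `<=` \bigcup_i V i ->
    forall s : forall i, F (V i),
    (forall i j (W : opens X) (Wi : W `<=` V i) (Wj : W `<=` V j),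
      res (V i) W Wi (s i) = res (V j) W Wj (s j)) ->
    exists! t : F U, forall i, res U (V i) (VU i) t = s i
}.

HB.mixin Record isCMonoid0 M of Monoid M := {
  mulgC : forall a b : M, (a * b = b * a)%g;
  gzero : M;
  mul0g : forall a : M, (gzero * a = gzero)%g
}.

#[short(type="cmonoid0Type")]
HB.structure Definition CMonoid0 := {M of Monoid M & isCMonoid0 M}.

HB.instance Definition _ (M : cmonoid0Type) :=
  Monoid.isComLaw.Build M 1%g *%g mulgA mulgC mul1g.

Record cmhom (M N : cmonoid0Type) := CMHom {
  cmfun :> M -> N;
  cmhom1 : cmfun 1%g = 1%g;
  cmhomM : forall a b, cmfun (a * b)%g = (cmfun a * cmfun b)%g;
  cmhom0 : cmfun gzero = gzero
}.

Definition cancellative (M : cmonoid0Type) :=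
  forall a b c : M, a <> gzero -> (a * b = a * c)%g -> b = c.

Section MulMonoid.
Variable R : comPzSemiRingType.

Definition mulm : Type := R.
HB.instance Definition _ := Choice.on mulm.
HB.instance Definition _ := isSemigroup.Build mulm (@mulrA R).
HB.instance Definition _ := Semigroup_isMonoid.Build mulm (@mul1r R) (@mulr1 R).
HB.instance Definition _ := isCMonoid0.Build mulm (@mulrC R) (@mul0r R).
End MulMonoid.

Definition mulm_hom (R S : comPzSemiRingType) (f : {rmorphism R -> S}) :
  cmhom (mulm R) (mulm S) :=
  @CMHom (mulm R) (mulm S) f (rmorph1 f) (rmorphM f) (rmorph0 f).

Definition idempotent_semiring (K : comPzSemiRingType) :=
  forall a : K, (a + a = a)%R.

(* The nonzero elements form a group under multiplication: 1 is nonzero and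
   each nonzero element is invertible (whence nonzero elements are closed under
   products). *)
Definition semifield (K : comPzSemiRingType) :=
  (1 : K)%R <> 0%R /\ forall a : K, a <> 0%R -> exists b, (a * b = 1)%R.

Record monoidSpace := MonoidSpace {
  ms_top :> topologicalType;
  mO : opens ms_top -> cmonoid0Type;
  mres : forall U V : opens ms_top, V `<=` U -> cmhom (mO U) (mO V);
  mO_sheaf : is_sheaf (fun U V VU => mres VU : mO U -> mO V)
}.
Arguments mO {m} U.
Arguments mres {m U V} VU.

Record semiringSpace := SemiringSpace {
  ss_top :> topologicalType;
  sO : opens ss_top -> comPzSemiRingType;
  sres : forall U V : opens ss_top, V `<=` U -> {rmorphism sO U -> sO V};
  sO_sheaf : is_sheaf (fun U V VU => sres VU : sO U -> sO V)
}.
Arguments sO {s} U.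
Arguments sres {s U V} VU.

Definition mulspace (Y : semiringSpace) : monoidSpace :=
  @MonoidSpace Y (fun U => mulm (sO U)) (fun U V VU => mulm_hom (sres VU))
    (sO_sheaf Y).

Record mmor (X Y : monoidSpace) := MMor {
  mmor_fun :> X -> Y;
  mmor_cont : continuous mmor_fun;
  mmor_sh : forall V : opens Y, cmhom (mO V) (mO (preopens mmor_cont V));
  mmor_nat : forall (V W : opens Y) (WV : W `<=` V)
    (WV' : preopens mmor_cont W `<=` preopens mmor_cont V) (s : mO V),
    mres WV' (mmor_sh V s) = mmor_sh W (mres WV s)
}.

Record smor (X Y : semiringSpace) := SMor {
  smor_fun :> X -> Y;
  smor_cont : continuous smor_fun;
  smor_sh : forall V : opens Y, {rmorphism sO V -> sO (preopens smor_cont V)};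
  smor_nat : forall (V W : opens Y) (WV : W `<=` V)
    (WV' : preopens smor_cont W `<=` preopens smor_cont V) (s : sO V),
    sres WV' (smor_sh V s) = smor_sh W (sres WV s)
}.

Arguments mmor_cont {X Y} m x _ _ : rename.
Arguments smor_cont {X Y} s x _ _ : rename.

Definition open_embedding (X Y : topologicalType) (f : X -> Y) :=
  [/\ continuous f, injective f & forall U : set X, open U -> open (f @` U)].

(* f identifies X with the open subspace [range f] of Y. *)
Definition m_open_immersion (X Y : monoidSpace) (f : mmor X Y) :=
  open_embedding f /\
  forall V : opens Y, V `<=` range f -> bijective (mmor_sh f V).

Definition s_open_immersion (X Y : semiringSpace) (f : smor X Y) :=
  open_embedding f /\
  forall V : opens Y, V `<=` range f -> bijective (smor_sh f V).

Definition mult_set (M : cmonoid0Type) (S : set M) :=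
  S 1%g /\ forall a b, S a -> S b -> S (a * b)%g.

Definition mideal (M : cmonoid0Type) (I : set M) :=
  I !=set0 /\ forall a b, I b -> I (a * b)%g.

Definition mprime (M : cmonoid0Type) (I : set M) :=
  [/\ mideal I, ~` I !=set0 & mult_set (~` I)].

(* Prime ideals of M satisfying P. With P := setT this is Spec M; the prime
   ideals of a semiring R are those of [mulm R] that are closed under addition,
   so both kinds of spectra, with their topology and the multiplicative part of
   the structure sheaf, are treated at once. *)
Record pspec (M : cmonoid0Type) (P : set (set M)) := PSpec {
  pset :> set M;
  pprime : mprime pset;
  psetP : P pset
}.

Lemma pspec_eq (M : cmonoid0Type) (P : set (set M)) (p q : pspec P) :
  (pset p = pset q) -> p = q.
Proof.
case: p q => [p p1 p2] [q q1 q2] /= E; case: q / E q1 q2 => q1 q2.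
by rewrite (Prop_irrelevance p1 q1) (Prop_irrelevance p2 q2).
Qed.

Section PSpecTopology.
Variables (M : cmonoid0Type) (P : set (set M)).

HB.instance Definition _ := gen_eqMixin (pspec P).
HB.instance Definition _ := gen_choiceMixin (pspec P).

Definition basic (f : M) : set (pspec P) := [set p : pspec P | ~ pset p f].

Definition pspec_open : set_system (pspec P) :=
  [set U | forall p, U p -> exists2 f, basic f p & basic f `<=` U].

Lemma prime1 (p : pspec P) : ~ pset p 1%g.
Proof. by case: (pprime p) => _ _ []. Qed.

Lemma primeM (p : pspec P) a b : ~ pset p a -> ~ pset p b -> ~ pset p (a * b)%g.
Proof. by case: (pprime p) => _ _ [_ h]; exact: h. Qed.

Lemma prime_ideal (p : pspec P) a b : pset p b -> pset p (a * b)%g.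
Proof. by case: (pprime p) => -[_ h] _ _; exact: h. Qed.

Lemma prime_ideall (p : pspec P) a b : pset p a -> pset p (a * b)%g.
Proof. by rewrite mulgC; exact: prime_ideal. Qed.

Lemma pspec_openT : pspec_open setT.
Proof. by move=> p _; exists 1%g => //; exact: prime1. Qed.

Lemma pspec_openI : setI_closed pspec_open.
Proof.
move=> A B hA hB p [/hA[f pf fA] /hB[g pg gB]].
exists (f * g)%g; first exact: primeM.
by move=> q qfg; split; [apply: fA|apply: gB] => h; apply: qfg;
  [exact: prime_ideall|exact: prime_ideal].
Qed.

Lemma pspec_open_bigU (I : Type) (f : I -> set (pspec P)) :
  (forall i, pspec_open (f i)) -> pspec_open (\bigcup_i f i).
Proof.
move=> hf p [i _ /(hf i)[g gp gf]]; exists g => // q /gf fq.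
by exists i.
Qed.

HB.instance Definition _ := isOpenTopological.Build (pspec P)
  pspec_openT pspec_openI pspec_open_bigU.

Lemma pspec_openE : @open (pspec P) = pspec_open.
Proof. by []. Qed.
End PSpecTopology.

Section Localization.
Variables (M : cmonoid0Type) (P : set (set M)) (p : pspec P).

Definition ldenom : Type := {s : M | `[< ~ pset p s >]}.
HB.instance Definition _ := Choice.on ldenom.
HB.instance Definition _ := SubType.on ldenom.

Lemma ldenomP (s : ldenom) : ~ pset p (val s).
Proof. exact/asboolP/(valP s). Qed.

Definition lrel (x y : M * ldenom) : bool :=
  `[< exists2 u, ~ pset p u &
      (u * (val y.2 * x.1) = u * (val x.2 * y.1))%g >].

Lemma lrel_equiv : equiv_class_of lrel.
Proof.
split=> [x|x y|y x z].
- by apply/asboolP; exists 1%g => //; exact: prime1.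
- by apply/asboolP/asboolP => -[u pu e]; exists u.
move=> /asboolP[u pu e] /asboolP[v pv f]; apply/asboolP.
exists (u * v * val y.2)%g.
  by apply: primeM; [exact: primeM|exact: ldenomP].
case: x y z e f => [a s] [b t] [c r] /= e f.
transitivity (v * val r * (u * (val t * a)))%g.
  by rewrite !mulgA (ACl (2*4*1*3*5)).
rewrite e; transitivity (u * val s * (v * (val r * b)))%g.
  by rewrite !mulgA (ACl (3*4*1*2*5)).
by rewrite f !mulgA (ACl (1*3*4*2*5)).
Qed.

Canonical lrel_equiv_rel := EquivRelPack lrel_equiv.

Definition loc : Type := {eq_quot lrel_equiv_rel}.
HB.instance Definition _ := Choice.on loc.
HB.instance Definition _ := EqQuotient.on loc.

Definition lfrac (a s : M) (ps : ~ pset p s) : loc :=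
  \pi_loc (a, exist _ s (asboolT ps) : ldenom).

Lemma lfrac_eq a b s t (ps : ~ pset p s) (pt : ~ pset p t) :
  lfrac a ps = lfrac b pt <->
  exists2 u, ~ pset p u & (u * (t * a) = u * (s * b))%g.
Proof.
split=> [/eqquotP/asboolP //|h]; by apply/eqquotP/asboolP.
Qed.

Lemma lfrac_eq1 a b s t (ps : ~ pset p s) (pt : ~ pset p t) :
  (t * a = s * b)%g -> lfrac a ps = lfrac b pt.
Proof.
by move=> e; apply/lfrac_eq; exists 1%g; [exact: prime1|rewrite e].
Qed.

Definition lnum (x : loc) : M := (repr x).1.
Definition lden (x : loc) : M := val (repr x).2.

Lemma ldenP x : ~ pset p (lden x).
Proof. exact: ldenomP. Qed.

Lemma lfracE x : x = lfrac (lnum x) (@ldenP x).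
Proof.
rewrite -[LHS]reprK /lnum /lfrac; congr (\pi _).
by rewrite [LHS]surjective_pairing; congr pair; exact: val_inj.
Qed.

Lemma lfrac_irr a a' s s' (ps : ~ pset p s) (ps' : ~ pset p s') :
  a = a' -> s = s' -> lfrac a ps = lfrac a' ps'.
Proof. by move=> -> e; apply: lfrac_eq1; rewrite e. Qed.

Lemma loc_ind (Q : loc -> Prop) :
  (forall a s (ps : ~ pset p s), Q (lfrac a ps)) -> forall x, Q x.
Proof. by move=> h x; rewrite (lfracE x). Qed.

Definition lmul (x y : loc) : loc :=
  lfrac (lnum x * lnum y)%g (primeM (@ldenP x) (@ldenP y)).
Definition lone : loc := lfrac 1%g (@prime1 _ _ p).
Definition lzero : loc := lfrac gzero (@prime1 _ _ p).

Lemma lmulE a b s t (ps : ~ pset p s) (pt : ~ pset p t) :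
  lmul (lfrac a ps) (lfrac b pt) = lfrac (a * b)%g (primeM ps pt).
Proof.
have /lfrac_eq[u pu e] := lfracE (lfrac a ps).
have /lfrac_eq[v pv f] := lfracE (lfrac b pt).
apply/lfrac_eq; exists (u * v)%g; first exact: primeM.
set x := lfrac a ps in e *; set y := lfrac b pt in f *.
transitivity (u * (s * lnum x) * (v * (t * lnum y)))%g.
  by rewrite !mulgA (ACl (1*3*5*2*4*6)).
by rewrite -e -f !mulgA (ACl (1*4*2*5*3*6)).
Qed.

Lemma lmulA : associative lmul.
Proof.
elim/loc_ind=> a s ps; elim/loc_ind=> b t pt; elim/loc_ind=> c r pr.
by rewrite !lmulE; apply: lfrac_irr; rewrite mulgA.
Qed.

Lemma lmulC : commutative lmul.
Proof.
elim/loc_ind=> a s ps; elim/loc_ind=> b t pt.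
by rewrite !lmulE; apply: lfrac_irr; rewrite mulgC.
Qed.

Lemma lmul1l : left_id lone lmul.
Proof.
elim/loc_ind=> a s ps.
by rewrite !lmulE; apply: lfrac_irr; rewrite mul1g.
Qed.

Lemma lmul0l : left_zero lzero lmul.
Proof.
elim/loc_ind=> a s ps.
by rewrite !lmulE; apply: lfrac_eq1; rewrite !mul0g mulgC mul0g mulgC mul0g.
Qed.

Lemma lmul1r : right_id lone lmul.
Proof. by move=> x; rewrite lmulC lmul1l. Qed.

HB.instance Definition _ := isSemigroup.Build loc lmulA.
HB.instance Definition _ := Semigroup_isMonoid.Build loc lmul1l lmul1r.
HB.instance Definition _ := isCMonoid0.Build loc lmulC lmul0l.
End Localization.

Section Sections.
Variables (M : cmonoid0Type) (P : set (set M)).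
Implicit Type U V W : opens (pspec P).

Definition locally_frac U (s : forall p : pspec P, oset U p -> loc p) :=
  forall p, oset U p -> exists V : set (pspec P), exists a b : M,
    [/\ open V, V p & forall q (Uq : oset U q), V q ->
      exists qb : ~ pset q b, s q Uq = lfrac a qb].

(* Sections over U of the structure sheaf, as for rings: families of germs in
   the localizations at the primes of U that are locally given by a fraction. *)
Record psec U := PSec {
  psec_fun :> forall p : pspec P, oset U p -> loc p;
  psecP : locally_frac psec_fun
}.

Lemma psec_eq U (s t : psec U) : (forall p Up, s p Up = t p Up) -> s = t.
Proof.
case: s t => [s sP] [t tP] /= e.
have {}e : s = t by apply: functional_extensionality_dep => p;
  apply: functional_extensionality_dep.
by case: t / e tP => tP; rewrite (Prop_irrelevance sP tP).
Qed.

HB.instance Definition _ U := gen_eqMixin (psec U).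
HB.instance Definition _ U := gen_choiceMixin (psec U).

Lemma psec_cst_frac U (a : M) :
  locally_frac (fun p (_ : oset U p) => lfrac a (@prime1 _ _ p)).
Proof.
move=> p Up; exists setT, a, 1%g; split=> //; first exact: topology_structure.openT.
by move=> q Uq _; exists (@prime1 _ _ q).
Qed.

Definition psec_cst U (a : M) : psec U := PSec (@psec_cst_frac U a).

Lemma psec_mul_frac U (s t : psec U) :
  locally_frac (fun p (Up : oset U p) => s p Up * t p Up)%g.
Proof.
move=> p Up; have [V [a [b [oV Vp sV]]]] := psecP s Up.
have [W [c [d [oW Wp tW]]]] := psecP t Up.
exists (V `&` W), (a * c)%g, (b * d)%g; split=> //; first exact: openI.
move=> q Uq [/(sV q Uq)[qb ->] /(tW q Uq)[qd ->]].
by exists (primeM qb qd); exact: lmulE.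
Qed.

Definition psec_mul U (s t : psec U) : psec U := PSec (psec_mul_frac s t).

Lemma psec_mulA U : associative (@psec_mul U).
Proof. by move=> s t u; apply: psec_eq => p Up; exact: mulgA. Qed.

Lemma psec_mulC U : commutative (@psec_mul U).
Proof. by move=> s t; apply: psec_eq => p Up; exact: mulgC. Qed.

Lemma psec_mul1l U : left_id (psec_cst U 1%g) (@psec_mul U).
Proof. by move=> s; apply: psec_eq => p Up; exact: mul1g. Qed.

Lemma psec_mul1r U : right_id (psec_cst U 1%g) (@psec_mul U).
Proof. by move=> s; rewrite psec_mulC psec_mul1l. Qed.

Lemma psec_mul0l U : left_zero (psec_cst U gzero) (@psec_mul U).
Proof. by move=> s; apply: psec_eq => p Up; exact: mul0g. Qed.

HB.instance Definition _ U := isSemigroup.Build (psec U) (@psec_mulA U).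
HB.instance Definition _ U :=
  Semigroup_isMonoid.Build (psec U) (@psec_mul1l U) (@psec_mul1r U).
HB.instance Definition _ U :=
  isCMonoid0.Build (psec U) (@psec_mulC U) (@psec_mul0l U).

Lemma psec_res_frac U V (VU : V `<=` U) (s : psec U) :
  locally_frac (fun p (Vp : oset V p) => s p (VU p Vp)).
Proof.
move=> p Vp; have [W [a [b [oW Wp sW]]]] := psecP s (VU p Vp).
by exists W, a, b; split=> // q Vq; exact: sW.
Qed.

Definition psec_res U V (VU : V `<=` U) (s : psec U) : psec V :=
  PSec (psec_res_frac VU s).

Lemma psec_sheaf : is_sheaf psec_res.
Proof.
split=> [U UU s|U V W VU WV WU s|U I V VU UV s sV].
- by apply: psec_eq => p Up /=; congr (s p _); exact: Prop_irrelevance.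
- by apply: psec_eq => p Up /=; congr (s p _); exact: Prop_irrelevance.
have ex p (Up : oset U p) : exists i, oset (V i) p.
  by have [i _ Vp] := UV p Up; exists i.
pose ix p (Up : oset U p) : I := sval (cid (ex p Up)).
have ixP p (Up : oset U p) : oset (V (ix p Up)) p := svalP (cid (ex p Up)).
pose t p Up := s (ix p Up) p (ixP p Up).
have tE i p (Up : oset U p) (Vp : oset (V i) p) : t p Up = s i p Vp.
  pose W := Opens (openI (opensP (V (ix p Up))) (opensP (V i))).
  have Wi : W `<=` V (ix p Up) by move=> q [].
  have Wj : W `<=` V i by move=> q [].
  have Wp : oset W p by split=> //; exact: ixP.
  have /(congr1 (fun r : psec W => r p Wp)) /= := sV _ _ W Wi Wj.
  by rewrite /t (Prop_irrelevance (Wi p Wp) (ixP p Up))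
    (Prop_irrelevance (Wj p Wp) Vp).
have tP : locally_frac t.
  move=> p Up; have [W [a [b [oW Wp sW]]]] := psecP (s (ix p Up)) (ixP p Up).
  exists (W `&` V (ix p Up)), a, b; split.
  - exact: openI oW (opensP _).
  - by split=> //; exact: ixP.
  by move=> q Uq [Wq Vq]; rewrite (tE _ _ _ Vq); exact: sW.
exists (PSec tP); split=> [i|u uV].
  by apply: psec_eq => p Vp /=; exact: tE.
apply: psec_eq => p Up /=; rewrite /t -(uV (ix p Up)) /=.
by congr (u p _); exact: Prop_irrelevance.
Qed.

Definition psec_res_hom U V (VU : V `<=` U) : cmhom (psec U) (psec V).
Proof.
by apply: (@CMHom _ _ (psec_res VU)) => [|s t|]; exact: psec_eq.
Defined.

Definition pspecM : monoidSpace :=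
  @MonoidSpace (pspec P) psec psec_res_hom psec_sheaf.
End Sections.

Definition specM (M : cmonoid0Type) : monoidSpace := @pspecM M setT.

Definition sspec (R : comPzSemiRingType) :=
  @pspec (mulm R) [set I | forall a b : R, I a -> I b -> I (a + b)%R].

Section SemiringLocalization.
Variables (R : comPzSemiRingType) (p : sspec R).
Implicit Types a b s t : R.

Definition sloc : Type := loc p.
HB.instance Definition _ := Choice.on sloc.

Definition sfrac a s (ps : ~ pset p s) : sloc := @lfrac _ _ p a s ps.

Definition sprimeM a b (pa : ~ pset p a) (pb : ~ pset p b) :
  ~ pset p (a * b)%R := @primeM _ _ p a b pa pb.

Lemma sfrac_eq a b s t (ps : ~ pset p s) (pt : ~ pset p t) :
  sfrac a ps = sfrac b pt <->
  exists2 u : R, ~ pset p u & (u * (t * a) = u * (s * b))%R.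
Proof. exact: lfrac_eq. Qed.

Lemma sfrac_eq1 a b s t (ps : ~ pset p s) (pt : ~ pset p t) :
  (t * a = s * b)%R -> sfrac a ps = sfrac b pt.
Proof. exact: (@lfrac_eq1 (mulm R) _ p). Qed.

Lemma sloc_ind (Q : sloc -> Prop) :
  (forall a s (ps : ~ pset p s), Q (sfrac a ps)) -> forall x, Q x.
Proof. exact: (@loc_ind _ _ p). Qed.

Definition sladd (x y : sloc) : sloc :=
  sfrac ((lden y : R) * (lnum x : R) + (lden x : R) * (lnum y : R))%R
    (sprimeM (@ldenP _ _ p x) (@ldenP _ _ p y)).
Definition slmul : sloc -> sloc -> sloc := @lmul _ _ p.

Lemma sladdE a b s t (ps : ~ pset p s) (pt : ~ pset p t) :
  sladd (sfrac a ps) (sfrac b pt) = sfrac (t * a + s * b)%R (sprimeM ps pt).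
Proof.
rewrite /sladd; set x := sfrac a ps; set y := sfrac b pt.
have /sfrac_eq[u pu e] : x = sfrac (lnum x : R) (@ldenP _ _ p x) :=
  lfracE x.
have /sfrac_eq[v pv f] : y = sfrac (lnum y : R) (@ldenP _ _ p y) :=
  lfracE y.
apply/sfrac_eq; exists (u * v)%R; first exact: sprimeM.
move: (lnum x : R) (lnum y : R) (lden x : R) (lden y : R) e f => c d q r e f.
rewrite !mulrDr; congr (_ + _)%R.
  transitivity (v * t * r * (u * (s * c)))%R.
    by rewrite !mulrA (ACl (2*4*5*1*3*6))%R.
  by rewrite -e !mulrA (ACl (4*1*5*3*2*6))%R.
transitivity (u * s * q * (v * (t * d)))%R.
  by rewrite !mulrA (ACl (1*3*5*2*4*6))%R.
by rewrite -f !mulrA (ACl (1*4*3*5*2*6))%R.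
Qed.

Lemma slmulE a b s t (ps : ~ pset p s) (pt : ~ pset p t) :
  slmul (sfrac a ps) (sfrac b pt) = sfrac (a * b)%R (sprimeM ps pt).
Proof. exact: lmulE. Qed.

Definition slzero : sloc := sfrac 0%R (@prime1 _ _ p).

Lemma sladdA : associative sladd.
Proof.
elim/sloc_ind=> a s ps; elim/sloc_ind=> b t pt; elim/sloc_ind=> c r pr.
rewrite !sladdE; apply: sfrac_eq1; rewrite !mulrDr !mulrA.
rewrite addrA; congr (_ + _ + _)%R.
- by rewrite (ACl (1*2*3*5*4*6))%R.
- by rewrite (ACl (1*2*3*5*4*6))%R.
Qed.

Lemma sladdC : commutative sladd.
Proof.
elim/sloc_ind=> a s ps; elim/sloc_ind=> b t pt; rewrite !sladdE.
by apply: sfrac_eq1; rewrite [(s * b + _)%R]addrC (mulrC t s).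
Qed.

Lemma sladd0l : left_id slzero sladd.
Proof.
elim/sloc_ind=> a s ps; rewrite sladdE; apply: sfrac_eq1.
by rewrite mulr0 add0r !mul1r.
Qed.

HB.instance Definition _ := GRing.isNmodule.Build sloc sladdA sladdC sladd0l.

Lemma slmulDl : left_distributive slmul sladd.
Proof.
elim/sloc_ind=> a s ps; elim/sloc_ind=> b t pt; elim/sloc_ind=> c r pr.
rewrite !(sladdE, slmulE); apply: sfrac_eq1.
rewrite mulrDl !mulrDr !mulrA.
by congr (_ + _)%R; rewrite (ACl (1*3*2*5*4*6*7))%R.
Qed.

HB.instance Definition _ := GRing.Nmodule_isComPzSemiRing.Build sloc
  (@lmulA _ _ p) (@lmulC _ _ p) (@lmul1l _ _ p) slmulDl (@lmul0l _ _ p).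
End SemiringLocalization.

Section SemiringSections.
Variable R : comPzSemiRingType.
Implicit Type U V : opens (sspec R).

Definition ssec U : Type := psec U.
HB.instance Definition _ U := Choice.on (ssec U).

Definition ssec_cst U (a : R) : ssec U := @psec_cst (mulm R) _ U a.

Lemma ssec_add_frac U (s t : ssec U) :
  locally_frac (fun p (Up : oset U p) => (s p Up : sloc p) + t p Up)%R.
Proof.
move=> p Up; have [V [a [b [oV Vp sV]]]] := psecP s Up.
have [W [c [d [oW Wp tW]]]] := psecP t Up.
exists (V `&` W), ((d : R) * (a : R) + (b : R) * (c : R))%R, (b * d)%g.
split=> //; first exact: openI.
move=> q Uq [/(sV q Uq)[qb ->] /(tW q Uq)[qd ->]].
by exists (primeM qb qd); exact: sladdE.
Qed.

Definition ssec_add U (s t : ssec U) : ssec U := PSec (ssec_add_frac s t).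

Lemma ssec_addA U : associative (@ssec_add U).
Proof. by move=> s t u; apply: psec_eq => p Up; exact: (@addrA (sloc p)). Qed.

Lemma ssec_addC U : commutative (@ssec_add U).
Proof. by move=> s t; apply: psec_eq => p Up; exact: (@addrC (sloc p)). Qed.

Lemma ssec_add0 U : left_id (psec_cst U gzero) (@ssec_add U).
Proof. by move=> s; apply: psec_eq => p Up; exact: (@add0r (sloc p)). Qed.

HB.instance Definition _ U :=
  GRing.isNmodule.Build (ssec U) (@ssec_addA U) (@ssec_addC U) (@ssec_add0 U).

Lemma ssec_mulDl U : left_distributive (@psec_mul _ _ U) (@ssec_add U).
Proof.
by move=> s t u; apply: psec_eq => p Up; exact: (@mulrDl (sloc p)).
Qed.

HB.instance Definition _ U := GRing.Nmodule_isComPzSemiRing.Build (ssec U)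
  (@psec_mulA _ _ U) (@psec_mulC _ _ U) (@psec_mul1l _ _ U) (@ssec_mulDl U)
  (@psec_mul0l _ _ U).

Section Restriction.
Variables (U V : opens (sspec R)) (VU : V `<=` U).

Definition ssec_res : ssec U -> ssec V := psec_res VU.

Lemma ssec_res_nmod : nmod_morphism ssec_res.
Proof. by split=> [|s t]; exact: psec_eq. Qed.

Lemma ssec_res_monoid : GRing.monoid_morphism ssec_res.
Proof. by split=> [|s t]; exact: psec_eq. Qed.

HB.instance Definition _ :=
  GRing.isNmodMorphism.Build (ssec U) (ssec V) ssec_res ssec_res_nmod.
HB.instance Definition _ :=
  GRing.isMonoidMorphism.Build (ssec U) (ssec V) ssec_res ssec_res_monoid.

Definition ssec_res_hom : {rmorphism ssec U -> ssec V} := ssec_res.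
End Restriction.

Definition specR : semiringSpace :=
  @SemiringSpace (sspec R) ssec ssec_res_hom (@psec_sheaf _ _).
End SemiringSections.

Section MonoidSemiring.
Variables (K : comPzSemiRingType) (M : cmonoid0Type).
Local Open Scope fset_scope.
Local Open Scope ring_scope.

(* K[M] with 0_M identified with 0_K: formal K-linear combinations of nonzero
   elements of M. *)
Record msr := Msr {
  msr_coef :> {fsfun M -> K with 0%R};
  msr_coef0 : msr_coef gzero == 0
}.
HB.instance Definition _ := [isSub for msr_coef].
HB.instance Definition _ := [Choice of msr by <:].
Implicit Types (f g h : msr) (phi : M -> K).

Lemma msrP f g : (forall m, m <> gzero -> f m = g m) -> f = g.
Proof.
move=> e; apply/val_inj/fsfunP => m.
have [->|/eqP/e //] := eqVneq m gzero.
by rewrite (eqP (msr_coef0 f)) (eqP (msr_coef0 g)).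
Qed.

Definition mkmsr (S : {fset M}) phi : {fsfun M -> K with 0%R} :=
  [fsfun m in S => if m == gzero then 0 else phi m | 0].

Lemma mkmsrE (S : {fset M}) phi m : (m \notin S -> phi m = 0) ->
  mkmsr S phi m = if m == gzero then 0 else phi m.
Proof. by move=> h; rewrite fsfunE; case: ifPn => // /h ->; case: eqP. Qed.

Lemma mkmsr0 (S : {fset M}) phi : mkmsr S phi gzero == 0.
Proof. by rewrite fsfunE eqxx; case: ifP. Qed.

(* The K-linear extension of phi, evaluated at f *)
Definition msr_eval f phi : K := \sum_(a <- finsupp f) f a * phi a.

Lemma msr_evalE f phi (S : {fset M}) :
  (forall m, m \notin S -> f m = 0) ->
  msr_eval f phi = \sum_(a <- S) f a * phi a.
Proof.
move=> fS; apply: big_fset_incl => [|a _ /fsfun_dflt ->]; last by rewrite mul0r.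
apply/fsubsetP => a; rewrite mem_finsupp; apply: contraNT => /fS ->; exact/eqP.
Qed.

Definition msr_zero : msr := Msr (mkmsr0 fset0 (fun=> 0)).

Definition msr_add f g : msr :=
  Msr (mkmsr0 (finsupp f `|` finsupp g) (fun m => f m + g m)).

Definition msr_mono (m : M) (c : K) : msr :=
  Msr (mkmsr0 [fset m] (fun a => (a == m)%:R * c)).

Definition msr_conv f g m : K :=
  msr_eval f (fun a => msr_eval g (fun b => ((a * b)%g == m)%:R)).

Definition msr_mul f g : msr :=
  Msr (mkmsr0 [fset (a * b)%g | a in finsupp f, b in finsupp g]
    (msr_conv f g)).

Lemma msr_addE f g m : msr_add f g m = f m + g m.
Proof.
rewrite mkmsrE; last first.
  by rewrite !inE negb_or => /andP[/fsfun_dflt-> /fsfun_dflt->]; rewrite addr0.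
case: eqP => // ->; rewrite (eqP (msr_coef0 f)) (eqP (msr_coef0 g)).
by rewrite addr0.
Qed.

Lemma msr_zeroE m : msr_zero m = 0.
Proof. by rewrite mkmsrE //; case: eqP. Qed.

Lemma msr_monoE m c a :
  msr_mono m c a = if a == gzero then 0 else (a == m)%:R * c.
Proof. by rewrite mkmsrE // !inE => /negbTE ->; rewrite mul0r. Qed.

Lemma msr_conv0 f g m :
  m \notin [fset (a * b)%g | a in finsupp f, b in finsupp g] ->
  msr_conv f g m = 0.
Proof.
move=> mS; rewrite /msr_conv /msr_eval big_seq big1 // => a af.
rewrite big_seq big1 ?mulr0 // => b bf; case: eqP => [e|]; last first.
  by rewrite mulr0.
by case/negP: mS; rewrite -e; apply/imfset2P; exists a => //; exists b.
Qed.

Lemma msr_mulE f g m : m <> gzero -> msr_mul f g m = msr_conv f g m.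
Proof. by move=> /eqP m0; rewrite mkmsrE ?(negbTE m0) //; exact: msr_conv0. Qed.

Lemma eq_msr_eval f phi psi : phi =1 psi -> msr_eval f phi = msr_eval f psi.
Proof. by move=> e; apply: eq_bigr => a _; rewrite e. Qed.

Lemma sum_delta (S : {fset M}) phi m : (m \notin S -> phi m = 0) ->
  \sum_(a <- S) (m == a)%:R * phi a = phi m.
Proof.
case: (boolP (m \in S)) => [mS _|mS ->] //.
  rewrite (bigD1_seq m) //= eqxx mul1r big1 ?addr0 // => a am.
  by rewrite eq_sym (negbTE am) mul0r.
rewrite big_seq big1 // => a aS; case: eqP => [e|]; last by rewrite mul0r.
by rewrite e aS in mS.
Qed.

Lemma msr_eval_delta f m : msr_eval f (fun a => (a == m)%:R) = f m.
Proof.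
rewrite -[RHS](@sum_delta (finsupp f)); last exact: fsfun_dflt.
by apply: eq_bigr => a _; rewrite mulrC eq_sym.
Qed.

Lemma msr_eval_mul f g phi : phi gzero = 0 ->
  msr_eval (msr_mul f g) phi =
  msr_eval f (fun a => msr_eval g (fun b => phi (a * b)%g)).
Proof.
move=> phi0.
pose S := [fset (a * b)%g | a in finsupp f, b in finsupp g].
rewrite (@msr_evalE _ _ S); last first.
  move=> m mS; rewrite mkmsrE; last by move=> _; exact: msr_conv0.
  by case: eqP => // _; exact: msr_conv0.
transitivity (\sum_(m <- S) msr_conv f g m * phi m).
  apply: eq_bigr => m _; have [->|/eqP m0] := eqVneq m gzero.
    by rewrite phi0 !mulr0.
  by rewrite msr_mulE.
transitivity (\sum_(m <- S) \sum_(a <- finsupp f) \sum_(b <- finsupp g)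
    f a * (g b * (((a * b)%g == m)%:R * phi m))).
  apply: eq_bigr => m _; rewrite /msr_conv /msr_eval big_distrl.
  apply: eq_bigr => a _ /=; rewrite -mulrA big_distrl big_distrr /=.
  by apply: eq_bigr => b _; rewrite !mulrA.
rewrite exchange_big /msr_eval big_seq [RHS]big_seq; apply: eq_bigr => a af.
rewrite exchange_big big_distrr big_seq [RHS]big_seq; apply: eq_bigr => b bg /=.
rewrite -!big_distrr /= sum_delta //.
by case/negP; apply/imfset2P; exists a => //; exists b.
Qed.

Lemma msr_eval_add f g phi :
  msr_eval (msr_add f g) phi = msr_eval f phi + msr_eval g phi.
Proof.
pose S := finsupp f `|` finsupp g.
have fS m : m \notin S -> f m = 0.
  by rewrite inE negb_or => /andP[/fsfun_dflt].
have gS m : m \notin S -> g m = 0.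
  by rewrite inE negb_or => /andP[_ /fsfun_dflt].
rewrite (msr_evalE phi fS) (msr_evalE phi gS) (@msr_evalE _ _ S); last first.
  by move=> m mS; rewrite msr_addE fS // gS // addr0.
by rewrite -big_split; apply: eq_bigr => a _; rewrite msr_addE mulrDl.
Qed.

Lemma msr_eval_mono m c phi : phi gzero = 0 ->
  msr_eval (msr_mono m c) phi = c * phi m.
Proof.
move=> phi0; rewrite (@msr_evalE _ _ [fset m]); last first.
  move=> a; rewrite inE msr_monoE => /negbTE ->; rewrite mul0r; exact: if_same.
rewrite big_seq_fset1 msr_monoE eqxx mul1r; case: eqP => // ->.
by rewrite phi0 !mulr0.
Qed.

Lemma msr_eval0 f : msr_eval f (fun=> 0) = 0.
Proof. by rewrite /msr_eval big1 // => a _; rewrite mulr0. Qed.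

Lemma msr_evalC f g (phi : M -> M -> K) :
  msr_eval f (fun a => msr_eval g (phi a)) =
  msr_eval g (fun b => msr_eval f (phi^~ b)).
Proof.
rewrite /msr_eval.
transitivity (\sum_(a <- finsupp f) \sum_(b <- finsupp g)
    f a * (g b * phi a b)).
  by apply: eq_bigr => a _; rewrite big_distrr.
rewrite exchange_big; apply: eq_bigr => b _; rewrite big_distrr.
by apply: eq_bigr => a _; rewrite mulrCA.
Qed.

Lemma mulg0 (a : M) : (a * gzero = gzero)%g.
Proof. by rewrite mulgC mul0g. Qed.

Lemma delta0 (m : M) : m <> gzero -> ((gzero == m)%:R : K) = 0.
Proof. by move=> m0; case: eqP => // e; case: m0. Qed.

Lemma msr_addA : associative msr_add.
Proof. by move=> f g h; apply: msrP => m _; rewrite !msr_addE addrA. Qed.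

Lemma msr_addC : commutative msr_add.
Proof. by move=> f g; apply: msrP => m _; rewrite !msr_addE addrC. Qed.

Lemma msr_add0l : left_id msr_zero msr_add.
Proof. by move=> f; apply: msrP => m _; rewrite msr_addE msr_zeroE add0r. Qed.

HB.instance Definition _ := GRing.isNmodule.Build msr msr_addA msr_addC msr_add0l.

Lemma msr_mulC : commutative msr_mul.
Proof.
move=> f g; apply: msrP => m m0; rewrite !msr_mulE // /msr_conv msr_evalC.
by apply: eq_msr_eval => b; apply: eq_msr_eval => a; rewrite mulgC.
Qed.

Lemma msr_mulA : associative msr_mul.
Proof.
move=> f g h; apply: msrP => m m0; rewrite !msr_mulE // {1}/msr_conv.
transitivity (msr_eval f (fun a => msr_eval g (fun b => msr_eval h
    (fun c => ((a * (b * c))%g == m)%:R)))).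
  apply: eq_msr_eval => a; rewrite msr_eval_mul //.
  by rewrite mulg0 delta0.
rewrite /msr_conv msr_eval_mul; last first.
  rewrite -[RHS](msr_eval0 h); apply: eq_msr_eval => c.
  by rewrite mul0g delta0.
apply: eq_msr_eval => a; apply: eq_msr_eval => b; apply: eq_msr_eval => c.
by rewrite mulgA.
Qed.

Lemma msr_mul_mono m c g n : n <> gzero ->
  msr_mul (msr_mono m c) g n = c * msr_eval g (fun b => ((m * b)%g == n)%:R).
Proof.
move=> n0; rewrite msr_mulE // /msr_conv msr_eval_mono //.
by rewrite -[RHS](msr_eval0 g); apply: eq_msr_eval => b; rewrite mul0g delta0.
Qed.

Lemma msr_mul1l : left_id (msr_mono 1%g 1) msr_mul.
Proof.
move=> f; apply: msrP => m m0; rewrite msr_mul_mono // mul1r.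
rewrite -[RHS]msr_eval_delta.
by apply: eq_msr_eval => b; rewrite mul1g.
Qed.

Lemma msr_mulDl : left_distributive msr_mul msr_add.
Proof.
move=> f g h; apply: msrP => m m0.
by rewrite msr_addE !msr_mulE // /msr_conv msr_eval_add.
Qed.

Lemma msr_mul0l : left_zero msr_zero msr_mul.
Proof.
move=> f; apply: msrP => m m0; rewrite msr_mulE // msr_zeroE /msr_conv.
by rewrite /msr_eval big1 // => a _; rewrite msr_zeroE mul0r.
Qed.

HB.instance Definition _ := GRing.Nmodule_isComPzSemiRing.Build msr
  msr_mulA msr_mulC msr_mul1l msr_mulDl msr_mul0l.

Definition msr_const (c : K) : msr := msr_mono 1%g c.

Lemma msr_const_nmod : nmod_morphism msr_const.
Proof.
split=> [|c d]; apply: msrP => m /eqP/negbTE m0.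
  by rewrite msr_monoE m0 mulr0 msr_zeroE.
by rewrite msr_addE !msr_monoE m0 mulrDr.
Qed.

Lemma msr_const_monoid : GRing.monoid_morphism msr_const.
Proof.
split=> // c d; apply: msrP => m m0.
rewrite [RHS]msr_mul_mono //; under eq_msr_eval do rewrite mul1g.
rewrite msr_eval_delta !msr_monoE; case: eqP => // _.
by rewrite mulrCA.
Qed.

HB.instance Definition _ :=
  GRing.isNmodMorphism.Build K msr msr_const msr_const_nmod.
HB.instance Definition _ :=
  GRing.isMonoidMorphism.Build K msr msr_const msr_const_monoid.

Lemma msr_monoM (m n : M) :
  msr_mono (m * n)%g 1 = msr_mul (msr_mono m 1) (msr_mono n 1).
Proof.
apply: msrP => a a0; rewrite msr_mul_mono // mul1r msr_eval_mono.
  rewrite msr_monoE; move/eqP/negbTE: (a0) => ->.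
  by rewrite mulr1 mul1r eq_sym.
by rewrite mulg0 delta0.
Qed.

Lemma msr_mono0 : msr_mono gzero 1 = msr_zero.
Proof.
apply: msrP => a a0; rewrite msr_monoE msr_zeroE.
by move/eqP/negbTE: a0 => ->; rewrite mul0r.
Qed.

Definition msr_var : cmhom M (mulm msr) :=
  @CMHom M (mulm msr) (msr_mono^~ 1) erefl msr_monoM msr_mono0.
End MonoidSemiring.

(* The morphism Spec R -> Spec M induced by a multiplicative map phi : M -> R *)
Section SpecMap.
Variables (M : cmonoid0Type) (R : comPzSemiRingType) (phi : cmhom M (mulm R)).

Lemma specmap_prime (q : sspec R) : mprime (phi @^-1` pset q).
Proof.
split.
- split; last by move=> a b /=; rewrite cmhomM; exact: prime_ideal.
  exists gzero => /=; rewrite cmhom0.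
  by have [[[x qx] _] _ _] := pprime q; rewrite -(mul0g x); exact: prime_ideal.
- by exists 1%g => /=; rewrite cmhom1; exact: prime1.
split=> [|a b] /=; first by rewrite cmhom1; exact: prime1.
by rewrite cmhomM; exact: primeM.
Qed.

Definition specmap_fun (q : sspec R) : pspec (setT : set (set M)) :=
  PSpec (specmap_prime q) I.

Lemma specmap_cont : continuous specmap_fun.
Proof.
apply/continuousP => A; rewrite !pspec_openE => oA q /oA[f qf fA].
by exists (phi f) => // r rf; apply: fA.
Qed.

Definition specmap_loc (q : sspec R) (x : loc (specmap_fun q)) : loc q :=
  @lfrac _ _ q (phi (lnum x)) (phi (lden x)) (@ldenP _ _ _ x).

Lemma specmap_locE (q : sspec R) a s (ps : ~ pset (specmap_fun q) s) :
  specmap_loc (lfrac a ps) = @lfrac _ _ q (phi a) (phi s) ps.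
Proof.
have /lfrac_eq[u pu e] := lfracE (lfrac a ps).
by apply/lfrac_eq; exists (phi u) => //; rewrite -!cmhomM e.
Qed.

Lemma specmap_locM (q : sspec R) (x y : loc (specmap_fun q)) :
  specmap_loc (lmul x y) = lmul (specmap_loc x) (specmap_loc y).
Proof.
elim/loc_ind: x => a s ps; elim/loc_ind: y => b t pt.
rewrite lmulE !specmap_locE lmulE; apply: lfrac_irr; exact: cmhomM.
Qed.

Section Sheaf.
Variable V : opens (specM M).

Lemma specmap_frac (s : psec V) :
  @locally_frac _ _ (preopens specmap_cont V)
    (fun q (Vq : oset V (specmap_fun q)) => specmap_loc (s _ Vq)).
Proof.
move=> q Vq; have [W [a [b [oW Wq sW]]]] := psecP s Vq.
exists (specmap_fun @^-1` W), (phi a), (phi b); split=> //.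
  by move/continuousP: specmap_cont; apply.
by move=> r Vr /(sW _ Vr)[rb ->]; exists rb; exact: specmap_locE.
Qed.

Definition specmap_sec (s : psec V) : ssec (preopens specmap_cont V) :=
  PSec (specmap_frac s).

Lemma specmap_sec1 : specmap_sec 1%g = 1%R.
Proof.
by apply: psec_eq => q Vq; rewrite /= specmap_locE; apply: lfrac_irr;
  rewrite cmhom1.
Qed.

Lemma specmap_secM (s t : psec V) :
  specmap_sec (s * t)%g = (specmap_sec s * specmap_sec t)%R.
Proof.
by apply: psec_eq => q Vq; exact: specmap_locM.
Qed.

Lemma specmap_sec0 : specmap_sec gzero = 0%R.
Proof.
apply: psec_eq => q Vq; rewrite /= specmap_locE.
by apply: lfrac_irr; rewrite ?cmhom0 ?cmhom1.
Qed.

Definition specmap_sh :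
    cmhom (psec V) (mulm (ssec (preopens specmap_cont V))) :=
  @CMHom (psec V) (mulm (ssec (preopens specmap_cont V))) specmap_sec
    specmap_sec1 specmap_secM specmap_sec0.
End Sheaf.

Definition specmap : mmor (mulspace (specR R)) (specM M).
Proof.
apply: (@MMor (mulspace (specR R)) (specM M) specmap_fun specmap_cont
  specmap_sh) => V W WV WV' s.
apply: psec_eq => q Wq /=; congr (specmap_loc (s _ _)).
exact: Prop_irrelevance.
Defined.
End SpecMap.

Record monoidScheme := MonoidScheme {
  msch :> monoidSpace;
  msch_affine : forall x : msch, exists (M : cmonoid0Type)
    (j : mmor (specM M) msch), m_open_immersion j /\ range j x
}.

(* The stalks of Spec R are local semirings and open immersions induce
   isomorphisms on stalks, so a semiring scheme is automatically a locally
   semiringed space. *)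
Record semiringScheme := SemiringScheme {
  ssch :> semiringSpace;
  ssch_affine : forall y : ssch, exists (R : comPzSemiRingType)
    (k : smor (specR R) ssch), s_open_immersion k /\ range k y
}.

Definition irreducible (X : topologicalType) :=
  [set: X] !=set0 /\
  forall A B : set X, closed A -> closed B -> A `|` B = setT ->
    A = setT \/ B = setT.

Definition is_spec_cancellative (X : monoidSpace) (U : set X) :=
  exists (M : cmonoid0Type) (j : mmor (specM M) X),
    [/\ cancellative M, m_open_immersion j & range j = U].

(* X_K, as a scheme over X and over K, is obtained by replacing every affine
   piece Spec M of X by Spec K[M] and gluing: the inverse image of the range of
   any open immersion j : Spec M -> X is isomorphic to Spec K[M], compatibly
   with the maps Spec K[M] -> Spec M and K -> K[M]. This determines X_K up to
   a unique isomorphism over X and K. *)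
Record base_change (K : comPzSemiRingType) (X : monoidScheme) := BaseChange {
  bc_sch :> semiringScheme;
  bc_proj : mmor (mulspace bc_sch) X;
  bc_scal : {rmorphism K -> sO (openT bc_sch)};
  bc_chart : forall (M : cmonoid0Type) (j : mmor (specM M) X),
    m_open_immersion j ->
    exists k : smor (specR (msr K M)) bc_sch,
    [/\ s_open_immersion k,
        range k = bc_proj @^-1` range j,
        forall q, bc_proj (k q) = j (specmap (msr_var K M) q),
        forall (V : opens X) (s : mO V) (W : opens (specR (msr K M)))
          (W1 : W `<=` preopens (smor_cont k) (preopens (mmor_cont bc_proj) V))
          (W2 : W `<=` preopens (mmor_cont (specmap (msr_var K M)))
            (preopens (mmor_cont j) V)),
          sres W1 (smor_sh k _ (mmor_sh bc_proj V s)) =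
          @mres (mulspace (specR (msr K M))) _ _ W2
            (mmor_sh (specmap (msr_var K M)) _ (mmor_sh j V s))
      & forall c : K, smor_sh k (openT bc_sch) (bc_scal c) =
          ssec_cst _ (msr_const M c)]
}.

Section MonoidModules.

Record mset (M : cmonoid0Type) := MSet {
  mcar :> Type;
  mpt : mcar;
  mact : M -> mcar -> mcar;
  mact1 : forall s, mact 1%g s = s;
  mactM : forall a b s, mact (a * b)%g s = mact a (mact b s);
  mact0 : forall s, mact gzero s = mpt;
  mactpt : forall a, mact a mpt = mpt
}.

Record mmod (X : monoidSpace) := MMod {
  mmsec :> forall U : opens X, mset (mO U);
  mmres : forall U V : opens X, V `<=` U -> mmsec U -> mmsec V;
  mmres_pt : forall (U V : opens X) (VU : V `<=` U),
    mmres VU (mpt (mmsec U)) = mpt (mmsec V);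
  mmres_act : forall (U V : opens X) (VU : V `<=` U) (a : mO U) (s : mmsec U),
    mmres VU (mact a s) = mact (mres VU a) (mmres VU s);
  mm_sheaf : is_sheaf mmres
}.

Variable X : monoidSpace.
Implicit Types (F G : mmod X) (U V W : opens X).

(* phi restricts to a morphism of O_X|_U-modules F|_U -> G|_U; the values of
   phi on open sets not contained in U are irrelevant. *)
Definition mmod_morph_on U F G (phi : forall W, F W -> G W) :=
  forall W, W `<=` U ->
    [/\ phi W (mpt (F W)) = mpt (G W),
        forall (a : mO W) (s : F W), phi W (mact a s) = mact a (phi W s)
      & forall V (VW : V `<=` W) (s : F W),
          mmres VW (phi W s) = phi V (mmres VW s)].

Definition mmod_iso_on U F G :=
  exists (phi : forall W, F W -> G W) (psi : forall W, G W -> F W),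
    [/\ mmod_morph_on U phi, mmod_morph_on U psi
      & forall W, W `<=` U ->
          cancel (phi W) (psi W) /\ cancel (psi W) (phi W)].

Definition mmod_iso F G := mmod_iso_on (openT X) F G.

Section Free.
Variable n : nat.

(* The coproduct of n copies of O_X is the sheafification of the presheaf
   sending U to the wedge of n copies of O_X(U). An element of the wedge is an
   n-tuple with at most one nonzero coordinate. *)
Definition locally_wedge U (s : 'I_n -> mO U) :=
  forall x, oset U x -> exists (V : opens X) (VU : V `<=` U), oset V x /\
    forall i k, i != k -> mres VU (s i) = gzero \/ mres VU (s k) = gzero.

Record mfsec U := MFSec {
  mfcoord :> 'I_n -> mO U;
  mfcoordP : locally_wedge mfcoord
}.

Lemma mfsec_eq U (s t : mfsec U) : s =1 t -> s = t.
Proof.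
case: s t => [s sP] [t tP] /= /funext e.
by case: t / e tP => tP; rewrite (Prop_irrelevance sP tP).
Qed.

Lemma mf_pt_subproof U : locally_wedge (fun=> gzero : mO U).
Proof.
move=> x Ux; exists U, (fun _ h => h); split=> // i k _.
by left; rewrite cmhom0.
Qed.

Lemma mf_act_subproof U (a : mO U) (s : mfsec U) :
  locally_wedge (fun i => a * s i)%g.
Proof.
move=> x /(mfcoordP s)[V [VU [Vx sV]]]; exists V, VU; split=> // i k /sV.
by case=> e; [left|right]; rewrite cmhomM e mulgC mul0g.
Qed.

Lemma mf_res_subproof U V (VU : V `<=` U) (s : mfsec U) :
  locally_wedge (fun i => mres VU (s i)).
Proof.
move=> x Vx; have [W [WU [Wx sW]]] := mfcoordP s (VU _ Vx).
pose W' := Opens (openI (opensP V) (opensP W)).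
have W'V : W' `<=` V by move=> ? [].
have W'W : W' `<=` W by move=> ? [].
exists W', W'V; split=> // i k /sW h.
rewrite !(sheaf_comp (mO_sheaf X) VU W'V (subset_trans W'V VU)).
rewrite -!(sheaf_comp (mO_sheaf X) WU W'W (subset_trans W'V VU)).
by case: h => ->; rewrite cmhom0; [left|right].
Qed.

Definition mf_pt U : mfsec U := MFSec (@mf_pt_subproof U).
Definition mf_act U (a : mO U) (s : mfsec U) : mfsec U :=
  MFSec (mf_act_subproof a s).
Definition mf_res U V (VU : V `<=` U) (s : mfsec U) : mfsec V :=
  MFSec (mf_res_subproof VU s).

Definition mf_set U : mset (mO U).
Proof.
apply: (@MSet _ (mfsec U) (mf_pt U) (@mf_act U)).
- by move=> s; apply: mfsec_eq => i /=; rewrite mul1g.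
- by move=> a b s; apply: mfsec_eq => i /=; rewrite mulgA.
- by move=> s; apply: mfsec_eq => i /=; rewrite mul0g.
- by move=> a; apply: mfsec_eq => i /=; rewrite mulgC mul0g.
Defined.

Lemma mf_sheaf : is_sheaf mf_res.
Proof.
split=> [U UU s|U V W VU WV WU s|U I V VU UV s sV].
- by apply: mfsec_eq => i /=; rewrite (sheaf_id (mO_sheaf X)).
- by apply: mfsec_eq => i /=; rewrite (sheaf_comp (mO_sheaf X)).
have glue i := sheaf_glue (mO_sheaf X) VU UV (s := fun k => s k i)
  (fun k l W Wk Wl => congr1 (fun r : mfsec W => r i) (sV k l W Wk Wl)).
pose t i := sval (cid (glue i)).
have tP i := svalP (cid (glue i)).
have tw : locally_wedge t.
  move=> x /UV[k _ Vx]; have [W [WV [Wx sW]]] := mfcoordP (s k) Vx.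
  exists W, (subset_trans WV (VU k)); split=> // i l /sW.
  rewrite -(sheaf_comp (mO_sheaf X) (VU k) WV).
  rewrite -(sheaf_comp (mO_sheaf X) (VU k) WV).
  by rewrite (tP i).1 (tP l).1.
exists (MFSec tw); split=> [k|u uP]; first by apply: mfsec_eq => i; exact: (tP i).1.
by apply: mfsec_eq => i /=; apply: (tP i).2 => k; rewrite -(uP k).
Qed.

Definition mfree : mmod X.
Proof.
apply: (@MMod X mf_set mf_res) => [U V VU|U V VU a s|].
- by apply: mfsec_eq => i /=; rewrite cmhom0.
- by apply: mfsec_eq => i /=; rewrite cmhomM.
exact: mf_sheaf.
Defined.
End Free.

Record mvb (n : nat) := MVB {
  mvb_mod :> mmod X;
  mvb_locfree : forall x : X, exists U : opens X,
    oset U x /\ mmod_iso_on U mvb_mod (mfree n)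
}.
End MonoidModules.

Section SemiringModules.

Record smod (Y : semiringSpace) := SMod {
  smsec :> forall U : opens Y, lSemiModType (sO U);
  smres : forall U V : opens Y, V `<=` U -> smsec U -> smsec V;
  smres_add : forall (U V : opens Y) (VU : V `<=` U),
    nmod_morphism (smres VU);
  smres_scale : forall (U V : opens Y) (VU : V `<=` U) (a : sO U) (s : smsec U),
    smres VU (a *: s)%R = (sres VU a *: smres VU s)%R;
  sm_sheaf : is_sheaf smres
}.

Variable Y : semiringSpace.
Implicit Types (E G : smod Y) (U V W : opens Y).

Definition smod_morph_on U E G (phi : forall W, E W -> G W) :=
  forall W, W `<=` U ->
    [/\ nmod_morphism (phi W),
        scalable (phi W)
      & forall V (VW : V `<=` W) (s : E W),
          smres VW (phi W s) = phi V (smres VW s)].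

Definition smod_iso_on U E G :=
  exists (phi : forall W, E W -> G W) (psi : forall W, G W -> E W),
    [/\ smod_morph_on U phi, smod_morph_on U psi
      & forall W, W `<=` U ->
          cancel (phi W) (psi W) /\ cancel (psi W) (phi W)].

Definition smod_iso E G := smod_iso_on (openT Y) E G.

Section Free.
Variable n : nat.

Definition sf_res U V (VU : V `<=` U) (s : 'rV[sO U]_n) : 'rV[sO V]_n :=
  map_mx (sres VU) s.

Lemma sf_sheaf : is_sheaf sf_res.
Proof.
split=> [U UU s|U V W VU WV WU s|U I V VU UV s sV].
- by apply/rowP => i; rewrite mxE (sheaf_id (sO_sheaf Y)).
- by apply/rowP => i; rewrite !mxE (sheaf_comp (sO_sheaf Y)).
have sVi i k l W (Wk : W `<=` V k) (Wl : W `<=` V l) :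
    sres Wk (s k ord0 i) = sres Wl (s l ord0 i).
  by have /rowP/(_ i) := sV k l W Wk Wl; rewrite !mxE.
have glue i := sheaf_glue (sO_sheaf Y) VU UV (sVi i).
pose t i := sval (cid (glue i)).
have tP i := svalP (cid (glue i)).
exists (\row_i t i)%R; split=> [k|u uP].
  by apply/rowP => i; rewrite !mxE; exact: (tP i).1.
by apply/rowP => i; rewrite mxE; apply: (tP i).2 => k; rewrite -(uP k) mxE.
Qed.

(* A finite coproduct of semimodules is a product. *)
Definition sfree : smod Y.
Proof.
apply: (@SMod Y (fun U => 'rV[sO U]_n : lSemiModType (sO U)) sf_res)
  => [U V VU|U V VU a s|].
- split=> [|s t]; first exact: map_mx0.
  exact: map_mxD.
- by apply/rowP => i; rewrite !mxE rmorphM.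
exact: sf_sheaf.
Defined.
End Free.

Record svb (n : nat) := SVB {
  svb_mod :> smod Y;
  svb_locfree : forall y : Y, exists U : opens Y,
    oset U y /\ smod_iso_on U svb_mod (sfree n)
}.
End SemiringModules.

Section IsoClasses.
Variables (T : Type) (R : T -> T -> Prop).

Definition iso_classes := {C : T -> Prop | exists x, C = R x}.

Definition iso_class (x : T) : iso_classes :=
  exist _ (R x) (ex_intro _ x erefl).
End IsoClasses.

Definition mVect (X : monoidSpace) (n : nat) :=
  iso_classes (fun F G : mvb X n => mmod_iso F G).
Definition sVect (Y : semiringSpace) (n : nat) :=
  iso_classes (fun E G : svb Y n => smod_iso E G).

Definition mvb_class (X : monoidSpace) (n : nat) (F : mvb X n) : mVect X n :=
  iso_class _ F.
Definition svb_class (Y : semiringSpace) (n : nat) (E : svb Y n) : sVect Y n :=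
  iso_class _ E.

Section Pullback.
Variables (X : monoidSpace) (Y : semiringSpace) (pi : mmor (mulspace Y) X).
Implicit Types (F : mmod X) (E G : smod Y).

(* u is a morphism of O_X-modules from F to the direct image of E *)
Definition is_pi_linear F E
    (u : forall V : opens X, F V -> E (preopens (mmor_cont pi) V)) :=
  [/\ forall V, u V (mpt (F V)) = 0%R,
      forall V (a : mO V) (s : F V),
        u V (mact a s) = ((mmor_sh pi V a : sO _) *: u V s)%R
    & forall (U V : opens X) (VU : V `<=` U)
        (VU' : preopens (mmor_cont pi) V `<=` preopens (mmor_cont pi) U)
        (s : F U), smres VU' (u U s) = u V (mmres VU s)].

(* E is the pullback of F along pi (extension of scalars): there is a universal
   morphism from F to the direct image of an O_Y-module, namely that of E. *)
Definition is_pullback F E :=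
  exists2 u : forall V : opens X, F V -> E (preopens (mmor_cont pi) V),
    is_pi_linear u &
    forall G (v : forall V : opens X, F V -> G (preopens (mmor_cont pi) V)),
    is_pi_linear v ->
    exists phi : forall W, E W -> G W,
      [/\ smod_morph_on (openT Y) phi,
          forall V (s : F V), phi _ (u V s) = v V s
        & forall psi : forall W, E W -> G W,
            smod_morph_on (openT Y) psi ->
            (forall V (s : F V), psi _ (u V s) = v V s) ->
            forall W (s : E W), psi W s = phi W s].
End Pullback.

(* Main.v *)
(* Over an affine piece Spec M with M cancellative, both Spec M and Spec K[M]
   have a unique closed point: K is idempotent, so K[M] has no zero sums and its
   nonunits form an ideal. Hence all bundles are trivial over the affine pieces.
   Without zero sums or zero divisors an invertible matrix is monomial, and the
   units of K[M] are uniquely products of a unit of K and a unit of M. So bundles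
   on X and on X_K are given by monomial cocycles, those on X_K with additional
   constants from K. By irreducibility all pieces meet a fixed piece U_0, and
   comparison of the bases with those over U_0 removes the permutations and the
   constants: on both sides a bundle of rank n is given by a diagonal cocycle
   with entries in the units of O_X, and two such cocycles giving isomorphic
   bundles on X_K already give isomorphic bundles on X. *)
Require Import Defs.
From HB Require Import structures.
From mathcomp Require Import all_boot all_order all_algebra finmap.
From mathcomp Require Import perm.
From mathcomp Require Import all_classical topology_structure.
Set Implicit Arguments.
Unset Strict Implicit.
Unset Printing Implicit Defensive.
Import GRing.Theory.
Local Open Scope classical_set_scope.

(** * Sheaves of sets *)

(** The two sides meet in a single relation: if [mcharts F g] and [scharts E (pullg XK g)] hold for
    the same cocycle [g], then [E] is the pullback of [F], and a pullback is unique up to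
    isomorphism. So no quotient of cocycles is ever formed, and the bijection carries its
    description by pullbacks from the start. What descent uses of K[M] is collected in [tame], which
    is required at three levels: on the pieces it trivializes bundles, on double overlaps it writes
    transitions as a constant times a monoid element, and on triple overlaps with the fixed piece it
    detects that a permutation is trivial and a constant is 1. An empty overlap would detect
    nothing, which is where irreducibility acts. An obstacle is that X_K has in general more open
    sets than the inverse images of those of X, and units decompose only over suitable inverse
    images. Identities are therefore proved over inverse images and then restricted. A bundle with
    given cocycle is obtained by twisting the free module rather than by a sheafified tensor
    product; its universal property is checked on bases. *)

Lemma inj_surj_bijective (A B : Type) (f : A -> B) :
  injective f -> (forall b, exists a, f a = b) -> bijective f.
Proof.
move=> finj fsurj; pose g b := sval (cid (fsurj b)).
have gK b : f (g b) = b := svalP (cid (fsurj b)).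
by exists g => [a|//]; apply: finj; rewrite gK.
Qed.

Section Sheaves.
Variable X : topologicalType.
Implicit Types U V W : opens X.

Definition meet U V : opens X := Opens (openI (opensP U) (opensP V)).

Lemma meetl U V : meet U V `<=` U. Proof. by move=> ? []. Qed.
Lemma meetr U V : meet U V `<=` V. Proof. by move=> ? []. Qed.
Lemma meet_sub U V W : W `<=` U -> W `<=` V -> W `<=` meet U V.
Proof. by move=> WU WV x Wx; split; [exact: WU|exact: WV]. Qed.

(** All algebra is forgotten here, so that separation, gluing and twisting are proved once for
    structure sheaves, for modules on either side, and for direct images along [bc_proj]. *)
Record sheaf := Sheaf {
  shsec :> opens X -> Type;
  shres : forall U V, V `<=` U -> shsec U -> shsec V;
  shP : is_sheaf shres
}.
Arguments shres {s U V} VU.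

Section Basics.
Variable A : sheaf.

Lemma shres_id U (UU : U `<=` U) (s : A U) : shres UU s = s.
Proof. exact: (sheaf_id (shP A)). Qed.

Lemma shres_comp U V W (VU : V `<=` U) (WV : W `<=` V) (WU : W `<=` U)
  (s : A U) : shres WV (shres VU s) = shres WU s.
Proof. exact: (sheaf_comp (shP A)). Qed.

(** Both sections glue the restrictions of [s] to the sets W ∩ V_i, so uniqueness of gluing
    identifies them. The [V i] need not lie in W, so a fixed cover of X serves every W. *)
Lemma sheaf_sep W I (V : I -> opens X) : W `<=` \bigcup_i V i ->
  forall s t : A W,
  (forall i W' (VW : W' `<=` W), W' `<=` V i -> shres VW s = shres VW t) ->
  s = t.
Proof.
move=> cov s t st.
have cov' : W `<=` \bigcup_i meet W (V i).
  by move=> x Wx; have [i _ Vx] := cov _ Wx; exists i.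
have [|r [_ ru]] := sheaf_glue (shP A) (fun i => @meetl W (V i)) cov'
    (s := fun i => shres (@meetl W (V i)) s).
  move=> i j W' Wi Wj.
  by rewrite !(shres_comp _ _ (subset_trans Wi (@meetl _ _))).
transitivity r; last by apply: ru => i; symmetry; apply: st; exact: meetr.
by symmetry; exact: ru.
Qed.

Lemma sheaf_sep_loc W (s t : A W) :
  (forall x, oset W x -> exists (V : opens X) (VW : V `<=` W),
     oset V x /\ shres VW s = shres VW t) -> s = t.
Proof.
move=> st; pose I := {V : opens X | exists VW : V `<=` W, shres VW s = shres VW t}.
apply: (@sheaf_sep _ I (fun i => sval i)) => [x /st[V [VW [Vx e]]]|].
  by exists (exist _ V (ex_intro _ VW e)).
move=> [V [VW e]] W' W'W /= W'V.
by rewrite -!(shres_comp VW W'V) e.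
Qed.
End Basics.

(** * Gluing morphisms of sheaves *)

Section Glue.
Variables (A B : sheaf) (I : Type) (U : I -> opens X).
Variable f : forall (i : I) W, A W -> B W.
Arguments f : clear implicits.
Hypothesis cov : \bigcup_i U i = [set: X].
Hypothesis f_nat : forall i W V (VW : V `<=` W) s, W `<=` U i ->
  shres VW (f i W s) = f i V (shres VW s).
Hypothesis f_eq : forall i j W s, W `<=` U i -> W `<=` U j ->
  f i W s = f j W s.

Lemma cov_sub W : W `<=` \bigcup_i U i.
Proof. by rewrite cov. Qed.

(** The components [f i W] are total functions but are constrained only for W inside [U i]. The
    value [F W s] is the unique section that restricts to the images of the pieces of [s]. *)
Lemma glue_morphism : exists F : forall W, A W -> B W,
  (forall W V (VW : V `<=` W) s, shres VW (F W s) = F V (shres VW s)) /\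
  (forall i W s, W `<=` U i -> F W s = f i W s).
Proof.
have glue W (s : A W) : exists t : B W, forall i V (VW : V `<=` W),
    V `<=` U i -> shres VW t = f i V (shres VW s).
  have cov' : W `<=` \bigcup_i meet W (U i).
    by move=> x Wx; have [i _ Vx] := @cov_sub W _ Wx; exists i.
  have [|t [tP _]] := sheaf_glue (shP B) (fun i => @meetl W (U i)) cov'
      (s := fun i => f i _ (shres (@meetl W (U i)) s)).
    move=> i j W' Wi Wj; rewrite !f_nat; try exact: meetr.
    rewrite !(shres_comp _ _ (subset_trans Wi (@meetl _ _))).
    by apply: f_eq; apply: subset_trans;
      [exact: Wi|exact: meetr|exact: Wj|exact: meetr].
  exists t => i V VW VU; have VWU : V `<=` meet W (U i) by exact: meet_sub.
  rewrite -(shres_comp (@meetl W (U i)) VWU) tP f_nat; last exact: meetr.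
  by rewrite (shres_comp _ _ VW).
pose F W s := sval (cid (glue W s)).
have FP W s i V (VW : V `<=` W) : V `<=` U i ->
    shres VW (F W s) = f i V (shres VW s) := svalP (cid (glue W s)) i V VW.
exists F; split=> [W V VW s|i W s WU].
  apply: (sheaf_sep (@cov_sub V)) => i W' W'V W'U.
  rewrite (shres_comp _ _ (subset_trans W'V VW)) !(FP _ _ i) //.
  by rewrite (shres_comp _ _ (subset_trans W'V VW)).
rewrite -[LHS](shres_id (@subset_refl _ W)) (FP _ _ i) //.
by rewrite shres_id.
Qed.

(** Injectivity is local. For surjectivity, local preimages of [t] are compatible on overlaps
    because [F] is already injective there, so they glue. *)
Lemma glue_bijective : (forall i W, W `<=` U i -> bijective (f i W)) ->
  exists F : forall W, A W -> B W,
  [/\ forall W V (VW : V `<=` W) s, shres VW (F W s) = F V (shres VW s),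
      forall i W s, W `<=` U i -> F W s = f i W s
    & forall W, bijective (F W)].
Proof.
move=> f_bij; have [F [FN FE]] := glue_morphism; exists F; split=> // W.
have cov' V : V `<=` \bigcup_i meet V (U i).
  by move=> x Vx; have [i _ Ux] := @cov_sub V _ Vx; exists i.
have F_inj V : injective (F V).
  move=> s t e; apply: (sheaf_sep (@cov_sub V)) => i W' W'V W'U.
  apply: (bij_inj (f_bij i _ W'U)).
  by rewrite -!FE // -!FN e.
apply: inj_surj_bijective => // t.
have pre i : exists s, f i _ s = shres (@meetl W (U i)) t.
  by have [h _ hK] := f_bij i _ (@meetr W (U i)); eexists; exact: hK.
pose s i := sval (cid (pre i)); have sP i : f i _ (s i) = _ := svalP (cid (pre i)).
have [|r [rP _]] := sheaf_glue (shP A) (fun i => @meetl W (U i)) (cov' W) (s := s).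
  move=> i j V Vi Vj; apply: (F_inj V).
  rewrite -!FN !(FE _ _ _ (@meetr _ _)) !sP.
  by rewrite !(shres_comp _ _ (subset_trans Vi (@meetl _ _))).
exists r; apply: (sheaf_sep (@cov_sub W)) => i V VW VU.
have Vm : V `<=` meet W (U i) by exact: meet_sub.
rewrite -(shres_comp (@meetl W (U i)) Vm) FN.
rewrite [shres _ r]rP (FE i) ?sP; last exact: meetr.
exact: shres_comp.
Qed.
End Glue.

(** * Twisting a sheaf by a cocycle *)

Section Twist.
Variables (A : sheaf) (I : Type) (U : I -> opens X).
Variable g : forall (i j : I) W, W `<=` meet (U i) (U j) -> A W -> A W.
Hypothesis g_nat : forall i j W V (Wij : W `<=` meet (U i) (U j))
  (Vij : V `<=` meet (U i) (U j)) (VW : V `<=` W) s,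
  shres VW (g Wij s) = g Vij (shres VW s).
Hypothesis g_id : forall i W (Wii : W `<=` meet (U i) (U i)) s, g Wii s = s.
Hypothesis g_comp : forall i j k W (Wij : W `<=` meet (U i) (U j))
  (Wjk : W `<=` meet (U j) (U k)) (Wik : W `<=` meet (U i) (U k)) s,
  g Wij (g Wjk s) = g Wik s.

(* Sections over W of the sheaf obtained by gluing the A|_(U i) along g. *)
Record twsec W := TwSec {
  twc :> forall i, A (meet W (U i));
  twP : forall i j V (Vij : V `<=` meet (U i) (U j))
    (Vi : V `<=` meet W (U i)) (Vj : V `<=` meet W (U j)),
    shres Vi (twc i) = g Vij (shres Vj (twc j))
}.

Lemma twsec_eq W (s t : twsec W) : (forall i, s i = t i) -> s = t.
Proof.
case: s t => [s sP] [t tP] /= e.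
have {}e : s = t by apply: functional_extensionality_dep.
by case: t / e tP => tP; rewrite (Prop_irrelevance sP tP).
Qed.

Lemma meetS V W i : V `<=` W -> meet V (U i) `<=` meet W (U i).
Proof. by move=> VW x [/VW ? ?]; split. Qed.

Lemma twres_subproof W V (VW : V `<=` W) (s : twsec W)
  i j V' (Vij : V' `<=` meet (U i) (U j))
  (Vi : V' `<=` meet V (U i)) (Vj : V' `<=` meet V (U j)) :
  shres Vi (shres (meetS VW) (s i)) = g Vij (shres Vj (shres (meetS VW) (s j))).
Proof.
rewrite (shres_comp _ _ (subset_trans Vi (meetS VW))).
by rewrite (shres_comp _ _ (subset_trans Vj (meetS VW))); exact: twP.
Qed.

Definition twres W V (VW : V `<=` W) (s : twsec W) : twsec V :=
  TwSec (twres_subproof VW s).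

(** Each component glues by itself over the sets V_k ∩ U_i; the twisted compatibility of the results
    is then checked on every V_k, where it holds by assumption. *)
Lemma twist_sheaf : is_sheaf twres.
Proof.
split=> [W WW s|W V V' VW V'V V'W s|W J V VW WV s sV].
- by apply: twsec_eq => i /=; exact: shres_id.
- by apply: twsec_eq => i /=; exact: shres_comp.
have cov i : meet W (U i) `<=` \bigcup_k meet (V k) (U i).
  by move=> x [/WV[k _ Vx] Ux]; exists k.
have glue i := sheaf_glue (shP A) (fun k => @meetS (V k) W i (VW k)) (cov i)
  (s := fun k => s k i).
have agree i k l V' (Vk : V' `<=` meet (V k) (U i))
    (Vl : V' `<=` meet (V l) (U i)) :
    shres Vk (s k i) = shres Vl (s l i).
  have V'k := subset_trans Vk (@meetl _ _).
  have V'l := subset_trans Vl (@meetl _ _).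
  have V'i := subset_trans Vk (@meetr _ _).
  have V'V' : V' `<=` meet V' (U i) by exact: meet_sub.
  have /(congr1 (fun r : twsec V' => shres V'V' (r i))) /= := sV k l V' V'k V'l.
  by rewrite (shres_comp _ _ Vk) (shres_comp _ _ Vl).
pose t i := sval (cid (glue i (agree i))).
have tP i := svalP (cid (glue i (agree i))).
have tw i j V' (Vij : V' `<=` meet (U i) (U j))
    (Vi : V' `<=` meet W (U i)) (Vj : V' `<=` meet W (U j)) :
    shres Vi (t i) = g Vij (shres Vj (t j)).
  apply: (@sheaf_sep A V' J V).
    by move=> x /Vi[Wx _]; exact: WV.
  move=> k V'' V''V' V''V.
  have V''ij := subset_trans V''V' Vij.
  have V''i : V'' `<=` meet (V k) (U i).
    by apply: meet_sub => // x /V''ij[].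
  have V''j : V'' `<=` meet (V k) (U j).
    by apply: meet_sub => // x /V''ij[].
  rewrite (g_nat _ V''ij) (shres_comp _ _ (subset_trans V''i (meetS (VW k)))).
  rewrite (shres_comp _ _ (subset_trans V''j (meetS (VW k)))).
  rewrite -(shres_comp (meetS (VW k)) V''i) -(shres_comp (meetS (VW k)) V''j).
  by rewrite (tP i).1 (tP j).1; exact: twP.
exists (TwSec tw); split=> [k|u uP]; first by apply: twsec_eq => i; exact: (tP i).1.
by apply: twsec_eq => i /=; apply: (tP i).2 => k; rewrite -(uP k).
Qed.

(** Over W inside [U k], a section [t] spreads to the family of its transforms from [k] to [i];
    compatibility of this family is exactly the cocycle rule [g_comp]. *)
Lemma twfrom_subproof k W (Wk : W `<=` U k) (t : A W)
  i j V (Vij : V `<=` meet (U i) (U j))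
  (Vi : V `<=` meet W (U i)) (Vj : V `<=` meet W (U j)) :
  shres Vi (g (meet_sub (@meetr W (U i)) (subset_trans (@meetl _ _) Wk))
      (shres (@meetl W (U i)) t)) =
  g Vij (shres Vj (g (meet_sub (@meetr W (U j)) (subset_trans (@meetl _ _) Wk))
      (shres (@meetl W (U j)) t))).
Proof.
have VW := subset_trans Vi (@meetl _ _).
have Vik : V `<=` meet (U i) (U k).
  exact: (meet_sub (subset_trans Vi (@meetr _ _)) (subset_trans VW Wk)).
have Vjk : V `<=` meet (U j) (U k).
  exact: (meet_sub (subset_trans Vj (@meetr _ _)) (subset_trans VW Wk)).
rewrite (g_nat _ Vik) (g_nat _ Vjk) !(shres_comp _ _ VW).
by rewrite (g_comp Vij Vjk Vik).
Qed.

Definition twfrom k W (Wk : W `<=` U k) (t : A W) : twsec W :=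
  TwSec (twfrom_subproof Wk t).

Definition twto k W (Wk : W `<=` U k) (s : twsec W) : A W :=
  shres (meet_sub (@subset_refl _ W) Wk) (s k).

Lemma twfromK k W (Wk : W `<=` U k) : cancel (twfrom Wk) (twto Wk).
Proof.
move=> t; rewrite /twto /= (g_nat _ (meet_sub Wk Wk)) g_id.
rewrite (shres_comp _ _ (@subset_refl _ W)); exact: shres_id.
Qed.

Lemma twtoK k W (Wk : W `<=` U k) : cancel (twto Wk) (twfrom Wk).
Proof.
move=> s; apply: twsec_eq => i /=; rewrite /twto.
have VV : meet W (U i) `<=` meet W (U i) by [].
have Vk : meet W (U i) `<=` meet W (U k).
  exact: (meet_sub (@meetl _ _) (subset_trans (@meetl _ _) Wk)).
rewrite (shres_comp _ _ Vk) -(twP s _ VV); exact: shres_id.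
Qed.

Lemma twto_nat k W V (VW : V `<=` W) (Wk : W `<=` U k) (Vk : V `<=` U k) s :
  shres VW (twto Wk s) = twto Vk (twres VW s).
Proof.
rewrite /twto /=.
have VWk : V `<=` meet W (U k) by exact: meet_sub.
by rewrite !(shres_comp _ _ VWk).
Qed.

Lemma twto_glue i j W (Wij : W `<=` meet (U i) (U j)) (Wi : W `<=` U i)
  (Wj : W `<=` U j) (s : twsec W) : twto Wi s = g Wij (twto Wj s).
Proof. exact: twP. Qed.
End Twist.
End Sheaves.
Arguments shres {X s U V} VU.

(** * Closed points, and the semiring K[M] *)

Definition munit (M : cmonoid0Type) (a : M) := exists b, (a * b = 1)%g.

Lemma munitM (M : cmonoid0Type) (a b : M) :
  munit a -> munit b -> munit (a * b)%g.
Proof.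
move=> [a' aa'] [b' bb']; exists (a' * b')%g.
by rewrite !mulgA (ACl ((1*3)*(2*4)))%g /= aa' bb' mulg1.
Qed.

Lemma munit_hom (M N : cmonoid0Type) (f : cmhom M N) a :
  munit a -> munit (f a).
Proof. by move=> [b ab]; exists (f b); rewrite -cmhomM ab cmhom1. Qed.

Lemma munit_neq0 (M : cmonoid0Type) (a : M) :
  (1%g : M) <> gzero -> munit a -> a <> gzero.
Proof. by move=> M1 [b ab] a0; apply: M1; rewrite -ab a0 mul0g. Qed.

Section ClosedPoint.
Variables (M : cmonoid0Type) (P : set (set M)) (p0 : pspec P).
Hypothesis p0P : forall a, pset p0 a <-> ~ munit a.

(** A basic open D(f) around the point of nonunits has [f] a unit, so it contains every prime. *)
Lemma closed_point_open (V : set (pspec P)) : open V -> V p0 -> V = setT.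
Proof.
rewrite pspec_openE => oV /oV[f /= p0f fV]; apply/seteqP; split=> // q _.
apply: fV => /= qf; have [g fg] : munit f by apply: contrapT => /p0P.
by apply: (@prime1 _ _ q); rewrite -fg; exact: prime_ideall.
Qed.

(** The fraction a/b that represents a section near the closed point represents it everywhere, and
    [b] is a unit, so the section is a constant. This identifies the sections over the spectrum with
    M. *)
Lemma psec_cst_bij (U : opens (pspec P)) : oset U p0 ->
  bijective (@psec_cst M P U : M -> psec U).
Proof.
move=> Up0; apply: inj_surj_bijective => [a b|s].
  move=> /(congr1 (fun s : psec U => s p0 Up0)) /= /lfrac_eq[u p0u].
  have [v uv] : munit u by apply: contrapT => /p0P.
  move=> /(congr1 (fun x => v * x)%g).
  by rewrite !mul1g !mulgA (mulgC v) uv !mul1g.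
have [V [a [b [oV Vp sV]]]] := psecP s Up0.
have [b0 _] := sV p0 Up0 Vp.
have [c bc] : munit b by apply: contrapT => /p0P.
exists (a * c)%g; apply: psec_eq => q Uq /=.
have Vq : V q by rewrite (closed_point_open oV Vp).
have [qb ->] := sV q Uq Vq; apply: lfrac_eq1.
by rewrite mul1g mulgC -mulgA (mulgC c) bc mulg1.
Qed.
End ClosedPoint.

Lemma nonunits_prime (M : cmonoid0Type) : (1%g : M) <> gzero ->
  mprime [set a : M | ~ munit a].
Proof.
move=> M1; split.
- split; first by exists gzero => /= -[b]; rewrite mul0g => /esym.
  move=> a b /= nb [c abc]; apply: nb; exists (a * c)%g.
  by rewrite mulgA (mulgC b).
- by exists 1%g => /=; apply; exists 1%g; rewrite mulg1.
split=> [|a b]; first by apply; exists 1%g; rewrite mulg1.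
move=> /contrapT ua /contrapT ub; apply; exact: munitM.
Qed.

(** * Sums, products and units in K[M] *)

Section Semifields.
Variable K : comPzSemiRingType.
Hypothesis Kf : semifield K.
Hypothesis Kid : idempotent_semiring K.
Local Open Scope ring_scope.

(** Idempotence gives a = a + 0 = a + (a + b) = a + b = 0. *)
Lemma zero_sum_free (a b : K) : a + b = 0 -> a = 0.
Proof. by move=> ab; rewrite -[LHS]addr0 -ab addrA Kid. Qed.

Lemma semifield_mul_eq0 (a b : K) : a * b = 0 -> a <> 0 -> b = 0.
Proof.
move=> ab /Kf.2[c ac]; rewrite -[LHS]mul1r -ac mulrAC ab; exact: mul0r.
Qed.

Section MonoidAlgebra.
Variable M : cmonoid0Type.
Hypothesis Mc : cancellative M.
Hypothesis M1 : (1%g : M) <> gzero.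
Implicit Types f g h : msr K M.

Lemma cancellative_mul_eq0 (a b : M) : (a * b)%g = gzero -> a <> gzero ->
  b = gzero.
Proof. by move=> ab a0; apply: (Mc a0); rewrite ab mulg0. Qed.

Lemma msr_eval_eq0 f (phi : M -> K) : msr_eval f phi = 0 ->
  forall a, f a * phi a = 0.
Proof.
move=> e a; have [af|] := boolP (a \in finsupp f); last first.
  by move=> /fsfun_dflt ->; rewrite mul0r.
by move: e; rewrite /msr_eval (big_fsetD1 a) //= => /zero_sum_free.
Qed.

(** The coefficient of the product at ab is a sum that contains f(a)g(b), and no other term can
    cancel it. Cancellativity keeps ab away from 0, where all coefficients vanish. *)
Lemma msr_mul_neq0 f g a b : f a <> 0 -> g b <> 0 -> (f * g) (a * b)%g <> 0.
Proof.
move=> fa gb; have a0 : a <> gzero.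
  by move=> e; apply: fa; rewrite e (eqP (msr_coef0 f)).
have b0 : b <> gzero.
  by move=> e; apply: gb; rewrite e (eqP (msr_coef0 g)).
have ab0 : (a * b)%g <> gzero by move=> /cancellative_mul_eq0 /(_ a0).
rewrite [(f * g) _]msr_mulE // => /msr_eval_eq0 /(_ a) /semifield_mul_eq0.
move=> /(_ fa) /msr_eval_eq0 /(_ b); rewrite eqxx mulr1; exact: gb.
Qed.

Lemma msr_neq0 f : f <> 0 -> exists a, f a <> 0.
Proof.
move=> f0; apply: contrapT => nf; apply: f0; apply: msrP => m _.
by rewrite [RHS]msr_zeroE; apply: contrapT => fm; apply: nf; exists m.
Qed.

Lemma msr_1E (m : M) : (1 : msr K M) m = (m == 1%g)%:R.
Proof.
rewrite [LHS]msr_monoE mulr1; have [->|//] := eqVneq m gzero.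
by case: eqP => // e; case: M1.
Qed.

Lemma msr_1_neq0 : (1 : msr K M) <> 0.
Proof.
move=> /(congr1 (fun f : msr K M => f 1%g)); rewrite /= [RHS]msr_zeroE.
by rewrite msr_1E eqxx; exact: Kf.1.
Qed.

Lemma msr_zero_sum_free f g : f + g = 0 -> f = 0.
Proof.
move=> fg; apply: msrP => m _; rewrite [RHS]msr_zeroE.
apply: (@zero_sum_free _ (g m)).
by rewrite -[LHS](msr_addE f g) [msr_add f g]fg msr_zeroE.
Qed.

Lemma msr_mul_eq0 f g : f * g = 0 -> f = 0 \/ g = 0.
Proof.
move=> fg; have [->|f0] := pselect (f = 0); first by left.
right; apply: contrapT => /msr_neq0[b gb]; have [a fa] := msr_neq0 f0.
by apply: (msr_mul_neq0 fa gb); rewrite fg [LHS]msr_zeroE.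
Qed.

Lemma msr_monoMr (m m' : M) (c c' : K) :
  msr_mono m c * msr_mono m' c' = msr_mono (m * m')%g (c * c').
Proof.
apply: msrP => a a0; rewrite [LHS]msr_mul_mono // msr_eval_mono; last first.
  by rewrite mulg0 delta0.
rewrite msr_monoE; move/eqP/negbTE: (a0) => ->.
by rewrite eq_sym mulrA mulrC.
Qed.

(** Fix b in the support of [g]. For each a' in the support of [f], a'b lies in the support of 1, so
    a'b = 1. Hence every such a' is the inverse of b, and the support of [f] is one point. *)
Lemma msr_unit f g : f * g = 1 ->
  exists (m : M) (c : K), [/\ munit m, c <> 0 & f = msr_mono m c].
Proof.
move=> fg; have f0 : f <> 0.
  by move=> e; apply: msr_1_neq0; rewrite -fg e mul0r.
have g0 : g <> 0.
  by move=> e; apply: msr_1_neq0; rewrite -fg e mulr0.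
have [a fa] := msr_neq0 f0; have [b gb] := msr_neq0 g0.
have fgE a' : f a' <> 0 -> (a' * b = 1)%g.
  move=> fa'; have := msr_mul_neq0 fa' gb; rewrite fg msr_1E.
  by case: eqP.
exists a, (f a); split=> //; first by exists b; exact: fgE.
apply: msrP => m /eqP/negbTE m0; rewrite msr_monoE m0.
have [->|/eqP ma] := eqVneq m a; first by rewrite mul1r.
rewrite mul0r; apply: contrapT => /fgE mb; apply: ma.
by rewrite -[m]mulg1 -(fgE a fa) (mulgC a) mulgA mb mul1g.
Qed.

Lemma msr_mono_inj (m m' : M) (c c' : K) : m' <> gzero -> c' <> 0 ->
  msr_mono m c = msr_mono m' c' -> m = m' /\ c = c'.
Proof.
move=> m0 c0 /(congr1 (fun f : msr K M => f m')) /=; rewrite !msr_monoE.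
rewrite eqxx mul1r; case: eqP => // _; case: eqP => [->|_].
  by rewrite mul1r => ->.
by rewrite mul0r => /esym.
Qed.

(** If fh + gh = 1, the absence of zero sums confines fh and gh to the support of 1, so both are
    constants. One of them is nonzero, hence invertible in K, and then [f] or [g] is a unit. This
    makes the nonunits of K[M] a prime ideal of the semiring. *)
Lemma msr_nonunit_add f g :
  ~ munit (f : mulm (msr K M)) -> ~ munit (g : mulm (msr K M)) ->
  ~ munit (f + g : mulm (msr K M)).
Proof.
move=> nf ng [h fgh].
have {fgh} e : f * h + g * h = 1 by rewrite -mulrDl; exact: fgh.
have supp f' g' m : f' + g' = 1 -> m <> 1%g -> f' m = 0.
  move=> e' /eqP/negbTE m1; apply: (@zero_sum_free _ (g' m)).
  by rewrite -[LHS](msr_addE f' g') [msr_add f' g']e' msr_1E m1.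
have mono f' g' : f' + g' = 1 -> f' = msr_mono 1%g (f' 1%g).
  move=> e'; apply: msrP => m /eqP/negbTE m0; rewrite msr_monoE m0.
  have [->|/eqP m1] := eqVneq m 1%g; first by rewrite mul1r.
  by rewrite mul0r; exact: (supp _ _ _ e' m1).
have e1 : (f * h) 1%g + (g * h) 1%g = 1.
  by rewrite -[LHS](msr_addE (f * h) (g * h)) [msr_add _ _]e msr_1E eqxx.
have unit f' g' : f' * h + g' * h = 1 -> (f' * h) 1%g <> 0 ->
    munit (f' : mulm (msr K M)).
  move=> e' /Kf.2[c fc]; exists (h * msr_mono 1%g c).
  suff : (f' * h) * msr_mono 1%g c = 1 by rewrite -mulrA.
  by rewrite (mono _ _ e') msr_monoMr fc mulg1.
apply: nf; apply: (unit f g e) => fh0; apply: ng; apply: (unit g f).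
  by rewrite addrC.
by move=> gh0; apply: Kf.1; rewrite -e1 fh0 gh0 addr0.
Qed.
End MonoidAlgebra.
End Semifields.

(** * Charts of the base change *)

Section Charts.
Variables (K : comPzSemiRingType) (X : monoidScheme) (XK : base_change K X).
Hypothesis Kf : semifield K.
Hypothesis Kid : idempotent_semiring K.
Local Open Scope ring_scope.

Definition pre (U : opens X) : opens XK := preopens (mmor_cont (bc_proj XK)) U.

Definition pull (U : opens X) (a : mO U) : sO (pre U) :=
  mmor_sh (bc_proj XK) U a.

Definition scal (W : opens XK) (c : K) : sO W :=
  @sres _ (Defs.openT XK) W (@subsetT _ W) (bc_scal XK c).

Lemma pullM U (a b : mO U) : pull (a * b)%g = pull a * pull b.
Proof. exact: (cmhomM (mmor_sh (bc_proj XK) U)). Qed.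

Lemma pull1 U : pull (1%g : mO U) = 1.
Proof. exact: (cmhom1 (mmor_sh (bc_proj XK) U)). Qed.

Lemma pull0 U : pull (gzero : mO U) = 0.
Proof. exact: (cmhom0 (mmor_sh (bc_proj XK) U)). Qed.

Lemma pull_res (U V : opens X) (VU : V `<=` U) (VU' : pre V `<=` pre U)
    (a : mO U) :
  sres VU' (pull a) = pull (mres VU a).
Proof. exact: (mmor_nat (m := bc_proj XK) VU). Qed.

Lemma scal_res (W W' : opens XK) (W'W : W' `<=` W) c :
  sres W'W (scal W c) = scal W' c.
Proof. exact: (sheaf_comp (sO_sheaf XK)). Qed.

Lemma scalM W c d : scal W (c * d) = scal W c * scal W d.
Proof. by rewrite /scal !rmorphM. Qed.

Lemma scal1 W : scal W 1 = 1.
Proof. by rewrite /scal !rmorph1. Qed.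

(* The properties of an open U = Spec M, with M cancellative and nonzero, and of
   its inverse image Spec K[M] that the descent argument needs. *)
Record tame (U : opens X) : Prop := Tame {
  tame_pt : exists2 x, oset U x & forall V : opens X, oset V x -> U `<=` V;
  tame_ptK : exists2 y, oset (pre U) y &
    forall V : opens XK, oset V y -> pre U `<=` V;
  tame1 : (1%g : mO U) <> gzero;
  tame1K : (1 : sO (pre U)) <> 0;
  tame_zsf : forall a b : sO (pre U), a + b = 0 -> a = 0;
  tame_mul_eq0 : forall a b : sO (pre U), a * b = 0 -> a = 0 \/ b = 0;
  tame_unit : forall a b : sO (pre U), a * b = 1 -> exists (c : K) (m : mO U),
    [/\ c <> 0, munit m & a = scal _ c * pull m];
  tame_inj : forall (c d : K) (m m' : mO U), d <> 0 -> munit m' ->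
    scal _ c * pull m = scal _ d * pull m' -> c = d /\ m = m'
}.

(** Evaluation at the closed points identifies O(U) with M through [al] and O(pre U) with K[M]
    through [be]. The compatibilities in [bc_chart] say that [be] sends a constant [c] times the
    pullback of [m] to the monomial with coefficient [c] at [al m], and every clause is then a fact
    about K[M]. *)
Lemma spec_cancellative_tame (U : opens X) : is_spec_cancellative (oset U) ->
  oset U !=set0 -> tame U.
Proof.
move=> [M [j [Mc jim rj]]] [x0 Ux0].
(* A point of U is a prime of M; it contains 0 but not 1. *)
have M1 : (1%g : M) <> gzero.
  move: Ux0; rewrite -rj => -[q _ _] e.
  apply: (@prime1 _ _ q); rewrite e; have [[[x qx] _] _ _] := pprime q.
  by rewrite -(mul0g x); exact: prime_ideal.
have [k [kim rk _ compat scalE]] := bc_chart XK jim.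
pose p0 : pspec setT := @PSpec M setT _ (nonunits_prime M1) Logic.I.
have p0P a : pset p0 a <-> ~ munit a by [].
have R1 : (1%g : mulm (msr K M)) <> gzero by exact: msr_1_neq0.
have nonunit_add : [set I : set (mulm (msr K M)) | forall a b : msr K M,
    I a -> I b -> I (a + b)] [set a : mulm (msr K M) | ~ munit a].
  by move=> a b /=; exact: msr_nonunit_add.
pose q0 : sspec (msr K M) := @PSpec _ _ _ (nonunits_prime R1) nonunit_add.
have q0P a : pset q0 a <-> ~ munit a by [].
have jU (V : opens X) : U `<=` V -> oset (preopens (mmor_cont j) V) p0.
  by move=> UV; apply: UV; rewrite -rj; exists p0.
have kU q : oset (pre U) (k q).
  have : range k (k q) by exists q.
  by rewrite rk rj.
have pc := psec_cst_bij p0P (jU U (@subset_refl _ _)).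
have qc := @psec_cst_bij (mulm (msr K M)) _ q0 q0P
  (preopens (smor_cont k) (pre U)) (kU q0).
have [pd pdK dpK] := pc; have [qd qdK dqK] := qc.
have rjU : U `<=` range j by rewrite rj.
have rkU : pre U `<=` range k by rewrite rk rj.
have jb := jim.2 U rjU; have kb := kim.2 (pre U) rkU.
pose al (a : mO U) : M := pd (mmor_sh j U a).
pose be (a : sO (pre U)) : msr K M := qd (smor_sh k (pre U) a).
have alE a : mmor_sh j U a = psec_cst _ (al a) by rewrite dpK.
have beE a : smor_sh k (pre U) a = ssec_cst _ (be a) by rewrite [RHS]dqK.
have al_inj : injective al.
  by move=> a b e; apply: (bij_inj jb); rewrite !alE e.
have be_inj : injective be.
  by move=> a b e; apply: (bij_inj kb); rewrite !beE e.
have al_surj m : exists a, al a = m.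
  have [f fK Kf'] := jb; exists (f (psec_cst _ m)).
  by rewrite /al Kf' pdK.
have csti (a b : msr K M) : ssec_cst (preopens (smor_cont k) (pre U)) a =
    ssec_cst _ b -> a = b by move=> /(bij_inj qc).
have csti' (a b : M) : psec_cst (preopens (mmor_cont j) U) a =
    psec_cst _ b -> a = b by move=> /(bij_inj pc).
have alM a b : al (a * b)%g = (al a * al b)%g.
  apply: csti'; rewrite -alE cmhomM !alE; apply: psec_eq => p Up.
  by rewrite [LHS]lmulE; apply: lfrac_irr => //; rewrite mulg1.
have al1 : al 1%g = 1%g.
  by apply: csti'; rewrite -alE cmhom1.
have al0 : al gzero = gzero.
  by apply: csti'; rewrite -alE cmhom0.
have beM a b : be (a * b) = be a * be b.
  apply: csti; rewrite -beE rmorphM !beE; apply: psec_eq => p Up.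
  rewrite [LHS]slmulE; apply: lfrac_irr => //; exact: mulr1.
have beD a b : be (a + b) = be a + be b.
  apply: csti; rewrite -beE rmorphD !beE; apply: psec_eq => p Up.
  by rewrite [LHS]sladdE; apply: lfrac_irr; rewrite /= ?mul1r.
have be1 : be 1 = 1.
  by apply: csti; rewrite -beE rmorph1.
have be0 : be 0 = 0.
  by apply: csti; rewrite -beE rmorph0.
(* The compatibility of [bc_chart] is stated after restriction to some W. With W all of Spec K[M]
   nothing is lost, since constants embed there ([oc]). *)
have bepull a : be (pull a) = msr_mono (al a) 1.
  have W1 : Defs.openT (specR (msr K M)) `<=`
      preopens (smor_cont k) (preopens (mmor_cont (bc_proj XK)) U).
    by move=> q _; exact: kU.
  have W2 : Defs.openT (specR (msr K M)) `<=`
      preopens (mmor_cont (specmap (msr_var K M))) (preopens (mmor_cont j) U).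
    move=> q _ /=; rewrite -rj; by exists (specmap (msr_var K M) q).
  have := compat U a _ W1 W2; rewrite beE alE => e.
  have oc := @psec_cst_bij (mulm (msr K M)) _ q0 q0P
    (Defs.openT (specR (msr K M))) Logic.I.
  apply: (bij_inj oc); apply: psec_eq => q Uq.
  have /(congr1 (fun s : psec (Defs.openT (specR (msr K M))) => s q Uq)) /= := e.
  move=> ->; rewrite specmap_locE; exact: lfrac_irr.
have bescal c : be (scal _ c) = msr_const M c.
  have sub : preopens (smor_cont k) (pre U) `<=`
    preopens (smor_cont k) (Defs.openT XK) by [].
  apply: csti; rewrite -beE -(smor_nat (X := specR (msr K M)) (Y := XK)
    (s0 := k) _ sub) scalE.
  exact: psec_eq.
have bemono c m : be (scal _ c * pull m) = msr_mono (al m) c.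
  by rewrite beM bescal bepull [LHS]msr_monoMr mul1g mulr1.
split.
- exists (j p0); first by rewrite -rj; exists p0.
  move=> V Vp x; rewrite -rj => -[p _ <-].
  have := closed_point_open p0P (opensP (preopens (mmor_cont j) V)) Vp.
  by move=> /seteqP[_ /(_ p Logic.I)].
- exists (k q0); first exact: kU.
  move=> V Vq x /rkU[q _ <-].
  have := @closed_point_open (mulm (msr K M)) _ q0 q0P _
    (opensP (preopens (smor_cont k) V)) Vq.
  by move=> /seteqP[_ /(_ q Logic.I)].
- by move=> /(congr1 al); rewrite al1 al0.
- by move=> /(congr1 be); rewrite be1 be0.
- move=> a b /(congr1 be); rewrite beD be0 => /(msr_zero_sum_free Kid) e.
  by apply: be_inj; rewrite be0.
- move=> a b /(congr1 be); rewrite beM be0 => /(msr_mul_eq0 Kf Kid Mc).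
  by move=> [] e; [left|right]; apply: be_inj; rewrite be0.
- move=> a b /(congr1 be); rewrite beM be1.
  move=> /(msr_unit Kf Kid Mc M1)[m [c [[m' mm'] c0 ac]]].
  have [n nm] := al_surj m; have [n' nm'] := al_surj m'.
  exists c, n; split=> //; last by apply: be_inj; rewrite bemono nm.
  by exists n'; apply: al_inj; rewrite alM nm nm' mm' al1.
move=> c d m m' d0 um' /(congr1 be); rewrite !bemono.
have am0 : al m' <> gzero.
  by rewrite -al0 => /al_inj; apply: munit_neq0 um' => /(congr1 al);
    rewrite al1 al0.
by move=> /(msr_mono_inj am0 d0)[/al_inj -> ->].
Qed.
End Charts.

(** * Modules on monoid spaces *)

Section MonoidModuleCharts.
Variable X : monoidSpace.
Implicit Types (F G H : mmod X) (U V W : opens X).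

Definition mO_shf : sheaf X := Sheaf (mO_sheaf X).
Definition mmod_shf F : sheaf X := Sheaf (mm_sheaf F).

Lemma mres_id U (UU : U `<=` U) (a : mO U) : mres UU a = a.
Proof. exact: (sheaf_id (mO_sheaf X)). Qed.

Lemma mres_comp U V W (VU : V `<=` U) (WV : W `<=` V) (WU : W `<=` U)
  (a : mO U) : mres WV (mres VU a) = mres WU a.
Proof. exact: (sheaf_comp (mO_sheaf X)). Qed.

Lemma mmres_id F U (UU : U `<=` U) (s : F U) : mmres UU s = s.
Proof. exact: (sheaf_id (mm_sheaf F)). Qed.

Lemma mmres_comp F U V W (VU : V `<=` U) (WV : W `<=` V) (WU : W `<=` U)
  (s : F U) : mmres WV (mmres VU s) = mmres WU s.
Proof. exact: (sheaf_comp (mm_sheaf F)). Qed.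

(** The part of [tame] that lives on X: the point is the closed point of an affine piece, and the
    piece is nonzero. *)
Definition mlocal U := (exists2 x, oset U x &
  forall V, oset V x -> U `<=` V) /\ (1%g : mO U) <> gzero.

(** In contrast to [mmod_iso_on] only one direction is recorded, so that trivializations are single
    maps that can be composed and compared. *)
Definition miso_on U F G (phi : forall W, F W -> G W) :=
  mmod_morph_on U phi /\ forall W, W `<=` U -> bijective (phi W).

Lemma miso_on_inv U F G phi : @miso_on U F G phi ->
  exists2 psi, @miso_on U G F psi &
    forall W, W `<=` U -> cancel (phi W) (psi W) /\ cancel (psi W) (phi W).
Proof.
move=> [m b].
have {}b W (WU : W `<=` U) : exists h, cancel (phi W) h /\ cancel h (phi W).
  by have [h h1 h2] := b W WU; exists h.
(* Inverses exist only over W inside U; elsewhere the constant base point is a dummy value. *)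
pose psi W : G W -> F W := if pselect (W `<=` U) is left WU
  then sval (cid (b W WU)) else fun=> mpt (F W).
have psiP W : W `<=` U -> cancel (phi W) (psi W) /\ cancel (psi W) (phi W).
  move=> WU; rewrite /psi; case: pselect => // WU'.
  by case: cid => h [].
exists psi => //; split=> [W WU|W /psiP[c1 c2]]; last by exists (phi W).
have [c1 c2] := psiP W WU; have [m1 m2 m3] := m W WU; split=> [|a s|V VW s].
- by rewrite -[LHS]c1 -m1 !c1.
- by apply: (can_inj c1); rewrite m2 !c2.
have VU := subset_trans VW WU; have [d1 d2] := psiP V VU.
by apply: (can_inj d1); rewrite -m3 c2 d2.
Qed.

Lemma mmod_iso_onP U F G :
  mmod_iso_on U F G <-> exists phi, @miso_on U F G phi.
Proof.
split=> [[phi [psi [m1 m2 c]]]|[phi phi_iso]].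
  by exists phi; split=> // W /c[c1 c2]; exists (psi W).
have [psi psi_iso c] := miso_on_inv phi_iso.
by exists phi, psi; split=> //; [exact: phi_iso.1|exact: psi_iso.1].
Qed.

Lemma miso_on_id U F : miso_on U (fun W (s : F W) => s).
Proof. by split=> // W WU; exists id. Qed.

Lemma miso_on_comp U F G H (phi : forall W, F W -> G W)
  (psi : forall W, G W -> H W) :
  miso_on U phi -> miso_on U psi -> miso_on U (fun W => psi W \o phi W).
Proof.
move=> [m1 b1] [m2 b2]; split=> W WU; last exact: bij_comp (b2 W WU) (b1 W WU).
have [p1 a1 r1] := m1 W WU; have [p2 a2 r2] := m2 W WU.
split=> [|a s|V VW s] /=; first by rewrite p1.
- by rewrite a1 a2.
by rewrite r2 r1.
Qed.

Lemma miso_onS U V F G (phi : forall W, F W -> G W) :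
  V `<=` U -> miso_on U phi -> miso_on V phi.
Proof.
by move=> VU [m b]; split=> W WV; [apply: m|apply: b]; exact: subset_trans WV VU.
Qed.

Lemma mmod_iso_refl F : mmod_iso F F.
Proof. by apply/mmod_iso_onP; eexists; exact: miso_on_id. Qed.

Lemma mmod_iso_sym F G : mmod_iso F G -> mmod_iso G F.
Proof.
move=> [phi [psi [m1 m2 c]]]; exists psi, phi; split=> // W WU.
by have [] := c W WU.
Qed.

Lemma mmod_iso_trans F G H : mmod_iso F G -> mmod_iso G H -> mmod_iso F H.
Proof.
move=> /mmod_iso_onP[phi h1] /mmod_iso_onP[psi h2]; apply/mmod_iso_onP.
by eexists; exact: miso_on_comp h1 h2.
Qed.

Lemma mmod_iso_glue F G (I : Type) (U : I -> opens X)
  (phi : I -> forall W, F W -> G W) : \bigcup_i U i = [set: X] ->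
  (forall i, miso_on (U i) (phi i)) ->
  (forall i j W s, W `<=` U i -> W `<=` U j -> phi i W s = phi j W s) ->
  mmod_iso F G.
Proof.
move=> cov iso agree.
have [|i W|Phi [PN PE Pb]] := @glue_bijective X (mmod_shf F) (mmod_shf G) I U
    phi cov _ agree.
- by move=> i W V VW s WU; have [_ _] := (iso i).1 W WU; exact.
- exact: (iso i).2.
apply/mmod_iso_onP; exists Phi; split=> W _; last exact: Pb.
split=> [|a s|V VW s].
- apply: (@sheaf_sep _ (mmod_shf G) W _ U (cov_sub cov (W:=W))) => i V VW VU.
  rewrite [LHS]PN (PE i) //= !mmres_pt; by have [] := (iso i).1 V VU.
- apply: (@sheaf_sep _ (mmod_shf G) W _ U (cov_sub cov (W:=W))) => i V VW VU.
  rewrite [LHS]PN (PE i) //= !mmres_act; have [_ -> _] := (iso i).1 V VU.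
  by congr mact; rewrite -PE //; symmetry; exact: PN.
exact: PN.
Qed.

Section Free.
Variable n : nat.
Local Notation free := (mfree X n).

Lemma unit_wedge U (k : 'I_n) :
  locally_wedge (fun i => if i == k then 1%g else gzero : mO U).
Proof.
move=> x Ux; exists U, (@subset_refl _ _); split=> // i j ij.
rewrite !mres_id; case: (eqVneq i k) => [ik|]; last by left.
by right; rewrite -ik eq_sym (negbTE ij).
Qed.

Definition mbasis U k : free U := MFSec (@unit_wedge U k).

Lemma mbasis_res U V (VU : V `<=` U) k :
  mmres VU (mbasis U k) = mbasis V k.
Proof.
by apply: mfsec_eq => i /=; case: eqP => _; rewrite ?cmhom1 ?cmhom0.
Qed.

(** On the neighbourhood given by the wedge condition, a nonzero coordinate forces all others to
    vanish. *)
Lemma mfree_local W (s : free W) x : oset W x ->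
  exists (V : opens X) (VW : V `<=` W), oset V x /\
  (mmres VW s = mpt _ \/ exists k (c : mO V), mmres VW s = mact c (mbasis V k)).
Proof.
move=> Wx; have [V [VW [Vx sV]]] := mfcoordP s Wx; exists V, VW; split=> //.
have [[k ks]|ns] := pselect (exists k, mres VW (s k) <> gzero).
  right; exists k, (mres VW (s k)); apply: mfsec_eq => i /=.
  case: (eqVneq i k) => [->|/sV[]]; rewrite ?mulg1 // mulgC mul0g //.
left; apply: mfsec_eq => i /=; apply: contrapT => h; apply: ns; by exists i.
Qed.

Section Transition.
Variables (U : opens X) (F : mmod X) (phi phi' : forall W, F W -> free W).
Arguments phi : clear implicits.
Arguments phi' : clear implicits.
Hypothesis Uloc : mlocal U.

(* At the closed point of U an element of the wedge has at most one nonzero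
   coordinate, so that two bases differ by a permutation and by units. *)
Lemma mfree_transition : miso_on U phi -> miso_on U phi' ->
  exists (sg : {perm 'I_n}) (a : 'I_n -> mO U),
  (forall k, munit (a k)) /\
  forall W (WU : W `<=` U) (s : F W) k,
    phi' W s (sg k) = (mres WU (a k) * phi W s k)%g.
Proof.
have [Upt U1] := Uloc; move: phi phi' => f f' fi f'i.
have UU := @subset_refl _ (oset U).
have basis (h : forall W, F W -> free W) : miso_on U h ->
    exists b : 'I_n -> F U, forall k, h U (b k) = mbasis U k.
  by move=> [_ /(_ U UU)[h' _ hK]]; exists (fun k => h' (mbasis U k)).
have [b bE] := basis _ fi; have [b' b'E] := basis _ f'i.
(* The neighbourhood from [mfree_local], taken at the closed point, contains U, so the local shape
   of [t] is valid on all of U. *)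
have basis_local (t : free U) :
    t = mpt _ \/ exists k (c : mO U), t = mact c (mbasis U k).
  have [x Ux Umin] := Upt; have [V [VU [Vx h]]] := mfree_local t Ux.
  have UV := Umin V Vx; case: h => [h|[k [c h]]].
    left; rewrite -[LHS](mmres_id UU) -(mmres_comp VU UV) h; exact: mmres_pt.
  right; exists k, (mres UV c).
  rewrite -[LHS](mmres_id UU) -(mmres_comp VU UV) h mmres_act.
  by rewrite mbasis_res.
have basis_nz k : mbasis U k <> mpt _.
  move=> /(congr1 (fun s : mfsec n U => s k)) /=; rewrite eqxx; exact: U1.
have act_basis (c d : mO U) k l : c <> gzero ->
    mact c (mbasis U k) = mact d (mbasis U l) -> k = l /\ c = d.
  move=> c0 /(congr1 (fun s : mfsec n U => s k)) /=; rewrite eqxx mulg1.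
  by case: eqVneq => [->|_]; rewrite ?mulg1 ?[(d * _)%g]mulgC ?mul0g.
have step (g g' : forall W, F W -> free W) (e e' : 'I_n -> F U) :
    miso_on U g -> miso_on U g' -> (forall k, g U (e k) = mbasis U k) ->
    (forall k, g' U (e' k) = mbasis U k) ->
    forall k, exists l (c : mO U), e k = mact c (e' l).
  move=> gi g'i gE g'E k.
  have [p1 a1 _] := gi.1 U UU; have [p2 a2 _] := g'i.1 U UU.
  have inj := bij_inj (g'i.2 U UU).
  have [h|[l [c h]]] := basis_local (g' U (e k)).
    case: (basis_nz k); rewrite -gE -p1; congr (g U _).
    by apply: inj; rewrite h p2.
  by exists l, c; apply: inj; rewrite a2 g'E.
have bb' := step _ _ _ _ fi f'i bE b'E.
have b'b := step _ _ _ _ f'i fi b'E bE.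
pose sg k := sval (cid (bb' k)); pose a k := sval (cid (svalP (cid (bb' k)))).
have sgP k : b k = mact (a k) (b' (sg k)) := svalP (cid (svalP (cid (bb' k)))).
have [p1 a1 _] := fi.1 U UU.
(* Substituting gives b_k = (a_k c) b_l, whence l = k and a_k c = 1. This yields both the
   injectivity of [sg] and the invertibility of the factors. *)
have inv k l (c : mO U) : b' (sg k) = mact c (b l) -> k = l /\ munit (a k).
  move=> e; have := sgP k; rewrite e -mactM => /(congr1 (f U)).
  rewrite a1 !bE -{1}(mact1 (mbasis U k)) => /(act_basis _ _ _ _ U1)[-> e1].
  by split=> //; exists c.
have sg_inj : injective sg.
  move=> k l kl; have [m [c e]] := b'b (sg k).
  have [-> _] := inv _ _ _ e; rewrite kl in e; by have [-> _] := inv _ _ _ e.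
exists (perm sg_inj), a; split=> [k|W WU s k].
  by have [l [c e]] := b'b (sg k); have [] := inv _ _ _ e.
(* A section over a smaller W may involve different basis elements at different points, so the
   formula is verified locally. *)
rewrite permE; apply: (@sheaf_sep_loc _ mO_shf W) => x Wx.
have [V [VW [Vx h]]] := mfree_local (f W s) Wx.
exists V, VW; split=> //.
have VU := subset_trans VW WU.
have [q1 c1 _] := fi.1 V VU; have [q2 c2 _] := f'i.1 V VU.
have [_ _ r1] := fi.1 W WU; have [_ _ r2] := f'i.1 W WU.
have [_ _ r3] := fi.1 U UU; have [_ _ r4] := f'i.1 U UU.
have inj := bij_inj (fi.2 V VU).
change (mmres VW (f' W s) (sg k) = mres VW (mres WU (a k) * f W s k)%g).
rewrite cmhomM (mres_comp _ _ VU) r2.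
change (mres VW (f W s k)) with (mmres VW (f W s) k); rewrite r1 in h *.
case: h => [h|[l [c h]]].
  have -> : mmres VW s = mpt _ by apply: inj; rewrite h q1.
  by rewrite q1 q2 /= mulg0.
have fb m : f V (mmres VU (b m)) = mbasis V m by rewrite -r3 bE mbasis_res.
have f'b m : f' V (mmres VU (b m)) = mact (mres VU (a m)) (mbasis V (sg m)).
  by rewrite sgP mmres_act c2 -r4 b'E mbasis_res.
have -> : mmres VW s = mact c (mmres VU (b l)) by apply: inj; rewrite h c1 fb.
rewrite c1 c2 fb f'b /=.
rewrite (inj_eq sg_inj); case: eqVneq => [->|_]; rewrite ?mulg1; first exact: mulgC.
by rewrite !mulg0.
Qed.
End Transition.

Section Monomial.
Variables (U : opens X) (sg : {perm 'I_n}) (a : 'I_n -> mO U).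
Hypothesis a_unit : forall k, munit (a k).

Lemma monomial_wedge (h : {perm 'I_n}) W (c : 'I_n -> mO W) (s : free W) :
  locally_wedge (fun k => c k * s (h k))%g.
Proof.
move=> x /(mfcoordP s)[V [VU [Vx sV]]]; exists V, VU; split=> // i k ik.
have /sV : h i != h k by rewrite (inj_eq perm_inj).
by case=> e; [left|right]; rewrite cmhomM e mulgC mul0g.
Qed.

Lemma miso_on_monomial F (phi : forall W, F W -> free W) : miso_on U phi ->
  exists2 phi' : forall W, F W -> free W, miso_on U phi' &
    forall W (WU : W `<=` U) (s : F W) k,
      phi' W s k = (mres WU (a k) * phi W s (sg k))%g.
Proof.
move=> phi_iso.
pose mono W (s : free W) : free W := if pselect (W `<=` U) is left WU
  then MFSec (monomial_wedge sg (fun k => mres WU (a k)) s) else s.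
have monoE W (WU : W `<=` U) (s : free W) k :
    mono W s k = (mres WU (a k) * s (sg k))%g.
  by rewrite /mono; case: pselect => //= WU'; rewrite (Prop_irrelevance WU' WU).
exists (fun W => mono W \o phi W) => [|W WU s k]; last exact: monoE.
apply: miso_on_comp => //; split=> W WU.
  split=> [|c s|V VW s].
  - by apply: mfsec_eq => k; rewrite monoE /= mulg0.
  - by apply: mfsec_eq => k; rewrite /= !monoE /= mulgA (mulgC (mres _ _)) -mulgA.
  have VU := subset_trans VW WU.
  by apply: mfsec_eq => k /=; rewrite !monoE cmhomM (mres_comp _ _ VU).
pose b k := sval (cid (a_unit k)).
have ab k : (a k * b k = 1)%g := svalP (cid (a_unit k)).
(* The inverse of a monomial matrix: the permutation is inverted and the inverse entries are moved
   along with it. *)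
exists (fun s => MFSec (monomial_wedge sg^-1%g
  (fun k => mres WU (b (sg^-1%g k))) s)) => s; apply: mfsec_eq => k.
  rewrite /= monoE mulgA -cmhomM (mulgC (b _)) ab cmhom1 mul1g.
  by rewrite permKV.
by rewrite monoE /= permK mulgA -cmhomM ab cmhom1 mul1g.
Qed.
End Monomial.
End Free.
End MonoidModuleCharts.

(** * Diagonal cocycles on a monoid space *)

Section MonoidCharts.
Variables (X : monoidSpace) (n : nat) (J : Type) (U : J -> opens X).
Hypothesis cov : \bigcup_i U i = [set: X].
Implicit Types (F G : mmod X) (V W : opens X).
Local Notation free := (mfree X n).
Local Notation transitions := (forall i j, 'I_n -> mO (meet (U i) (U j))).

(* F is a sum of n line bundles, given by the cocycles [g _ _ k]. *)
Definition mcharts F (g : transitions) :=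
  exists phi : J -> forall W, F W -> free W,
  (forall i, miso_on (U i) (phi i)) /\
  forall i j W (Wij : W `<=` meet (U i) (U j)) (s : F W) k,
    phi i W s k = (mres Wij (g i j k) * phi j W s k)%g.

(** The conditions range over all W inside the overlaps concerned, which spares a choice of
    bracketing for triple overlaps. *)
Definition cocycle (g : transitions) :=
  (forall i W (Wii : W `<=` meet (U i) (U i)) k, mres Wii (g i i k) = 1%g) /\
  forall i j l W (Wij : W `<=` meet (U i) (U j)) (Wjl : W `<=` meet (U j) (U l))
    (Wil : W `<=` meet (U i) (U l)) k,
    (mres Wij (g i j k) * mres Wjl (g j l k) = mres Wil (g i l k))%g.

(** Identifying coordinates over each [U i] gives local isomorphisms. They agree on overlaps because
    both sets of coordinates change by the same [g]. *)
Lemma mcharts_iso F G g : mcharts F g -> mcharts G g -> mmod_iso F G.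
Proof.
move=> [phi [phi_iso phiE]] [phi' [phi'_iso phi'E]].
have inv i := miso_on_inv (phi'_iso i).
pose psi i := s2val (cid2 (inv i)).
have psi_iso i : miso_on (U i) (psi i) := s2valP (cid2 (inv i)).
have psiK i W (WU : W `<=` U i) : cancel (psi i W) (phi' i W).
  by have [_] := s2valP' (cid2 (inv i)) W WU.
apply: (mmod_iso_glue cov (phi := fun i W => psi i W \o phi i W)) => [i|].
  exact: miso_on_comp.
move=> i j W s Wi Wj /=; apply: (bij_inj ((phi'_iso i).2 W Wi)).
rewrite psiK //; apply: mfsec_eq => k; have Wij := meet_sub Wi Wj.
by rewrite (phi'E i j W Wij) psiK // (phiE i j W Wij).
Qed.

Lemma mcharts_locfree F g : mcharts F g ->
  forall x : X, exists U : opens X, oset U x /\ mmod_iso_on U F free.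
Proof.
move=> [phi [phi_iso _]] x; have [i _ Ux] : (\bigcup_i U i) x by rewrite cov.
by exists (U i); split=> //; apply/mmod_iso_onP; exists (phi i).
Qed.

(** Transitions are evaluated on a section whose image is the k-th basis element; its k-th
    coordinate 1 leaves the bare factors. *)
Lemma mcharts_cocycle F g : mcharts F g -> cocycle g.
Proof.
move=> [phi [phi_iso phiE]]; split=> [i W Wii k|i j l W Wij Wjl Wil k].
  have Wi := subset_trans Wii (@meetl _ _ _).
  have [h _ hK] := (phi_iso i).2 W Wi.
  have := phiE i i W Wii (h (mbasis W k)) k; rewrite hK /= eqxx mulg1.
  by move=> ->.
have Wl := subset_trans Wil (@meetr _ _ _).
have [h _ hK] := (phi_iso l).2 W Wl.
have := phiE i l W Wil (h (mbasis W k)) k.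
rewrite (phiE i j W Wij) (phiE j l W Wjl) hK /= eqxx !mulg1.
by move=> ->.
Qed.

Section Existence.
Variable g : transitions.
Hypothesis gP : cocycle g.

Lemma diag_wedge W (c : 'I_n -> mO W) (s : free W) :
  locally_wedge (fun k => c k * s k)%g.
Proof.
move=> x /(mfcoordP s)[V [VU [Vx sV]]]; exists V, VU; split=> // i k /sV.
by case=> e; [left|right]; rewrite cmhomM e mulgC mul0g.
Qed.

Definition mdiag i j W (Wij : W `<=` meet (U i) (U j)) (s : free W) : free W :=
  MFSec (diag_wedge (fun k => mres Wij (g i j k)) s).

Local Notation free_shf := (mmod_shf free).

Lemma mdiag_nat i j W V (Wij : W `<=` meet (U i) (U j))
  (Vij : V `<=` meet (U i) (U j)) (VW : V `<=` W) (s : free W) :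
  mmres VW (mdiag Wij s) = mdiag Vij (mmres VW s).
Proof. by apply: mfsec_eq => k /=; rewrite cmhomM (mres_comp _ _ Vij). Qed.

Lemma mdiag_id i W (Wii : W `<=` meet (U i) (U i)) (s : free W) :
  mdiag Wii s = s.
Proof. by apply: mfsec_eq => k /=; rewrite gP.1 mul1g. Qed.

Lemma mdiag_comp i j k W (Wij : W `<=` meet (U i) (U j))
  (Wjk : W `<=` meet (U j) (U k)) (Wik : W `<=` meet (U i) (U k))
  (s : free W) : mdiag Wij (mdiag Wjk s) = mdiag Wik s.
Proof.
by apply: mfsec_eq => l /=; rewrite mulgA (gP.2 i j k W Wij Wjk Wik).
Qed.

Local Notation tws := (@twsec X free_shf J U mdiag).

Lemma mtw_pt_subproof W i j V (Vij : V `<=` meet (U i) (U j))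
  (Vi : V `<=` meet W (U i)) (Vj : V `<=` meet W (U j)) :
  mmres Vi (mpt (free (meet W (U i)))) =
  mdiag Vij (mmres Vj (mpt (free (meet W (U j))))).
Proof. by apply: mfsec_eq => k /=; rewrite !cmhom0 mulg0. Qed.

Definition mtw_pt W : tws W :=
  @TwSec X free_shf J U mdiag W (fun i => mpt _) (@mtw_pt_subproof W).

Lemma mtw_act_subproof W (a : mO W) (s : tws W)
  i j V (Vij : V `<=` meet (U i) (U j))
  (Vi : V `<=` meet W (U i)) (Vj : V `<=` meet W (U j)) :
  mmres Vi (mact (mres (@meetl _ W (U i)) a) (s i : free _)) =
  mdiag Vij (mmres Vj (mact (mres (@meetl _ W (U j)) a) (s j : free _))).
Proof.
have VW := subset_trans Vi (@meetl _ _ _).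
rewrite !mmres_act !(mres_comp _ _ VW).
have -> : mmres Vi (s i : free _) = mdiag Vij (mmres Vj (s j : free _)).
  exact: (twP s Vij Vi Vj).
by apply: mfsec_eq => k; rewrite /= !mulgA (mulgC (mres VW a)).
Qed.

Definition mtw_act W (a : mO W) (s : tws W) : tws W :=
  @TwSec X free_shf J U mdiag W (fun i => mact _ (s i : free _))
    (mtw_act_subproof a s).

Definition mtw_set W : mset (mO W).
Proof.
apply: (@MSet _ (tws W) (mtw_pt W) (@mtw_act W)).
- move=> s; apply: twsec_eq => i; apply: etrans (@mact1 _ (free _) (s i)).
  exact: (congr1 (fun a => mact a (s i : free _)) (cmhom1 _)).
- move=> a b s; apply: twsec_eq => i.
  apply: etrans (@mactM _ (free _) _ _ (s i)).
  exact: (congr1 (fun a => mact a (s i : free _)) (cmhomM _ _ _)).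
- move=> s; apply: twsec_eq => i; apply: etrans (@mact0 _ (free _) (s i)).
  exact: (congr1 (fun a => mact a (s i : free _)) (cmhom0 _)).
- by move=> a; apply: twsec_eq => i; exact: (@mactpt _ (free _)).
Defined.

Definition mtwist : mmod X.
Proof.
apply: (@MMod X mtw_set (@twres X free_shf J U mdiag)) => [V W WV|V W WV a s|].
- by apply: twsec_eq => i; exact: mmres_pt.
- apply: twsec_eq => i; rewrite [LHS](@mmres_act _ free); congr mact.
  have WVi := subset_trans (@meetl _ W (U i)) WV.
  by rewrite !(mres_comp _ _ WVi).
exact: (@twist_sheaf X free_shf J U mdiag mdiag_nat).
Defined.

Lemma mcharts_ex : exists F, mcharts F g.
Proof.
exists mtwist.
pose phi i W (s : mtwist W) : free W := if pselect (W `<=` U i) is left WU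
  then @twto X free_shf J U mdiag i W WU s else mpt _.
have phiE i W (WU : W `<=` U i) (s : mtwist W) :
    phi i W s = @twto X free_shf J U mdiag i W WU s.
  by rewrite /phi; case: pselect => // WU'; rewrite (Prop_irrelevance WU' WU).
exists phi; split=> [i|i j W Wij s k].
  split=> W WU; last first.
    have := @twfromK X free_shf J U mdiag mdiag_nat mdiag_id mdiag_comp i W WU.
    have := @twtoK X free_shf J U mdiag mdiag_nat mdiag_comp i W WU.
    move: (twfrom _ _ _) => h h1 h2.
    by exists h => s; rewrite phiE.
  split=> [|a s|V VW s].
  - by rewrite phiE; exact: mmres_pt.
  - rewrite !phiE [LHS](@mmres_act _ free); congr mact.
    by rewrite (mres_comp _ _ (@subset_refl _ W)) mres_id.
  rewrite (phiE i V (subset_trans VW WU)) (phiE i W WU).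
  exact: (@twto_nat X free_shf).
have Wi := subset_trans Wij (@meetl _ _ _).
have Wj := subset_trans Wij (@meetr _ _ _).
rewrite (phiE i W Wi) (phiE j W Wj).
by rewrite (@twto_glue X free_shf J U mdiag i j W Wij Wi Wj).
Qed.
End Existence.

Section Normalization.
Variable i0 : J.
Hypothesis U_loc : forall i, mlocal (U i).
Hypothesis U2_loc : forall i j, mlocal (meet (U i) (U j)).
Hypothesis U3_neq0 : forall i j l,
  (1%g : mO (meet (meet (U i) (U j)) (U l))) <> gzero.

(* Reordering the basis over each U i so that its restriction to U i0 is a
   diagonal multiple of the basis there makes all transitions diagonal. *)
Lemma mvb_charts (F : mvb X n) : exists g, mcharts F g.
Proof.
have triv i : exists phi, @miso_on X (U i) F free phi.
  have [[x Ux Umin] _] := U_loc i; have [V [Vx]] := mvb_locfree F x.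
  by move=> /mmod_iso_onP[phi /(miso_onS (Umin V Vx)) h]; exists phi.
pose phi i := sval (cid (triv i)).
have phi_iso i : miso_on (U i) (phi i) := svalP (cid (triv i)).
have norm i : exists (a : 'I_n -> mO (meet (U i0) (U i)))
    (phi' : forall W, F W -> free W),
    [/\ forall k, munit (a k), miso_on (U i) phi' &
    forall W (WU : W `<=` meet (U i0) (U i)) (s : F W) k,
      phi' W s k = (mres WU (a k) * phi i0 W s k)%g].
  have [sg [a [au aE]]] := mfree_transition (U2_loc i0 i)
    (miso_onS (@meetl _ _ _) (phi_iso i0)) (miso_onS (@meetr _ _ _) (phi_iso i)).
  (* Over [U i] only the order of the basis is changed; the units [a] stay in the comparison with
     [U i0]. *)
  have one_unit (k : 'I_n) : munit (1%g : mO (U i)) by exists 1%g; rewrite mulg1.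
  have [phi' phi'_iso phi'E] := miso_on_monomial sg one_unit (phi_iso i).
  exists a, phi'; split=> // W WU s k.
  rewrite (phi'E W (subset_trans WU (@meetr _ _ _))) cmhom1 mul1g.
  exact: aE.
pose a i := sval (cid (norm i)); pose phi' i := sval (cid (svalP (cid (norm i)))).
have [a_unit phi'_iso phi'E] : [/\ forall i k, munit (a i k),
    forall i, miso_on (U i) (phi' i) &
    forall i W (WU : W `<=` meet (U i0) (U i)) (s : F W) k,
      phi' i W s k = (mres WU (a i k) * phi i0 W s k)%g].
  by split=> i; case: (svalP (cid (svalP (cid (norm i))))).
have tr i j : exists b : 'I_n -> mO (meet (U i) (U j)),
    forall W (WU : W `<=` meet (U i) (U j)) (s : F W) k,
      phi' i W s k = (mres WU (b k) * phi' j W s k)%g.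
  have [sg [b [bu bE]]] := mfree_transition (U2_loc i j)
    (miso_onS (@meetr _ _ _) (phi'_iso j)) (miso_onS (@meetl _ _ _) (phi'_iso i)).
  (* Over the triple overlap with [U i0], take the section that is the k-th basis element for
     [phi i0]. Only its k-th coordinates in [phi' i] and [phi' j] are nonzero, so [sg k] different
     from [k] would make a unit equal to 0. *)
  suff sg1 k : sg k = k by exists b => W WU s k; rewrite -bE sg1.
  pose W := meet (meet (U i) (U j)) (U i0).
  have W0 : W `<=` U i0 by exact: meetr.
  have Wij : W `<=` meet (U i) (U j) by exact: meetl.
  have W0i : W `<=` meet (U i0) (U i).
    exact: meet_sub W0 (subset_trans Wij (@meetl _ _ _)).
  have W0j : W `<=` meet (U i0) (U j).
    exact: meet_sub W0 (subset_trans Wij (@meetr _ _ _)).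
  have [h _ hK] := (phi_iso i0).2 W W0.
  have := bE W Wij (h (mbasis W k)) k.
  rewrite (phi'E i W W0i) (phi'E j W W0j) hK /= eqxx mulg1.
  case: eqP => // _; rewrite mulg0 => /esym.
  move/munit_neq0; case; first exact: U3_neq0.
  by apply: munitM; apply: munit_hom.
exists (fun i j => sval (cid (tr i j))), phi'; split=> // i j.
exact: (svalP (cid (tr i j))).
Qed.
End Normalization.
End MonoidCharts.

(** * Modules on semiring spaces *)

Section SemiringMonomial.
Variables (R : comPzSemiRingType) (n : nat) (A B : 'I_n -> 'I_n -> R).
Local Open Scope ring_scope.
Hypothesis zsf : forall a b : R, a + b = 0 -> a = 0.
Hypothesis mul_eq0 : forall a b : R, a * b = 0 -> a = 0 \/ b = 0.
Hypothesis R1 : (1 : R) <> 0.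
Hypothesis AB : forall i k, \sum_j A i j * B j k = (i == k)%:R.
Hypothesis BA : forall i k, \sum_j B i j * A j k = (i == k)%:R.

Lemma zsf_sum_eq0 (c : 'I_n -> R) : \sum_j c j = 0 -> forall j, c j = 0.
Proof. by move=> e j; move: e; rewrite (bigD1 j) //= => /zsf. Qed.

(** Some term of the i-th diagonal entry of AB is nonzero; its index is [sg i]. The off-diagonal
    entries of AB are sums equal to 0, so all their terms vanish, which kills row [sg i] of B off i.
    In the same way BA kills row i of A off [sg i]. *)
Lemma invertible_monomial : exists sg : {perm 'I_n},
  (forall i j, j != sg i -> A i j = 0) /\
  forall i, A i (sg i) * B (sg i) i = 1.
Proof.
have ex i : exists k, A i k * B k i <> 0.
  apply: contrapT => h; apply: R1; have := AB i i; rewrite eqxx => e.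
  apply: (etrans (esym e)).
  by apply: big1 => k _; apply: contrapT => hk; apply: h; exists k.
pose sg i := sval (cid (ex i)).
have sgP i : A i (sg i) * B (sg i) i <> 0 := svalP (cid (ex i)).
have B0 i j : j != i -> B (sg i) j = 0.
  move=> ji; have := AB i j; rewrite eq_sym (negbTE ji) => /zsf_sum_eq0.
  move=> /(_ (sg i)) /mul_eq0[e|//]; case: (sgP i); rewrite e; exact: mul0r.
have A0 i j : j != sg i -> A i j = 0.
  move=> ji; have := BA (sg i) j; rewrite eq_sym (negbTE ji) => /zsf_sum_eq0.
  move=> /(_ i) /mul_eq0[e|//]; case: (sgP i); rewrite e; exact: mulr0.
have sg_inj : injective sg.
  move=> i j e; have [//|ij] := eqVneq i j.
  by case: (sgP i); rewrite e B0 ?mulr0.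
exists (perm sg_inj); split=> i *; rewrite ?permE.
  by apply: A0; rewrite -(permE sg_inj).
have := AB i i; rewrite eqxx (bigD1 (sg i)) //= big1 ?addr0 // => j ji.
by rewrite A0 ?mul0r.
Qed.
End SemiringMonomial.

Section SemiringModuleCharts.
Variable Y : semiringSpace.
Implicit Types (E G H : smod Y) (U V W : opens Y).
Local Open Scope ring_scope.

Definition smod_shf E : sheaf Y := Sheaf (sm_sheaf E).

Lemma sres_id U (UU : U `<=` U) (a : sO U) : sres UU a = a.
Proof. exact: (sheaf_id (sO_sheaf Y)). Qed.

Lemma sres_comp U V W (VU : V `<=` U) (WV : W `<=` V) (WU : W `<=` U)
  (a : sO U) : sres WV (sres VU a) = sres WU a.
Proof. exact: (sheaf_comp (sO_sheaf Y)). Qed.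

Lemma smres_id E U (UU : U `<=` U) (s : E U) : smres UU s = s.
Proof. exact: (sheaf_id (sm_sheaf E)). Qed.

Lemma smres_comp E U V W (VU : V `<=` U) (WV : W `<=` V) (WU : W `<=` U)
  (s : E U) : smres WV (smres VU s) = smres WU s.
Proof. exact: (sheaf_comp (sm_sheaf E)). Qed.

Lemma nmod_morphism_sum (M N : nmodType) (f : M -> N) (I : finType)
  (c : I -> M) : nmod_morphism f -> f (\sum_i c i) = \sum_i f (c i).
Proof. by move=> [f0 fD]; exact: (big_morph f fD f0). Qed.

Definition siso_on U E G (phi : forall W, E W -> G W) :=
  smod_morph_on U phi /\ forall W, W `<=` U -> bijective (phi W).

Lemma siso_on_inv U E G phi : @siso_on U E G phi ->
  exists2 psi, @siso_on U G E psi &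
    forall W, W `<=` U -> cancel (phi W) (psi W) /\ cancel (psi W) (phi W).
Proof.
move=> [m b].
have {}b W (WU : W `<=` U) : exists h, cancel (phi W) h /\ cancel h (phi W).
  by have [h h1 h2] := b W WU; exists h.
pose psi W : G W -> E W := if pselect (W `<=` U) is left WU
  then sval (cid (b W WU)) else fun=> 0.
have psiP W : W `<=` U -> cancel (phi W) (psi W) /\ cancel (psi W) (phi W).
  move=> WU; rewrite /psi; case: pselect => // WU'.
  by case: cid => h [].
exists psi => //; split=> [W WU|W /psiP[c1 c2]]; last by exists (phi W).
have [c1 c2] := psiP W WU; have [[p1 d1] m2 m3] := m W WU.
split=> [|a s|V VW s].
- split=> [|s t]; first by rewrite -[LHS]c1 -p1 !c1.
  by apply: (can_inj c1); rewrite d1 !c2.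
- by apply: (can_inj c1); rewrite m2 !c2.
have VU := subset_trans VW WU; have [e1 e2] := psiP V VU.
by apply: (can_inj e1); rewrite -m3 c2 e2.
Qed.

Lemma smod_iso_onP U E G :
  smod_iso_on U E G <-> exists phi, @siso_on U E G phi.
Proof.
split=> [[phi [psi [m1 m2 c]]]|[phi phi_iso]].
  by exists phi; split=> // W /c[c1 c2]; exists (psi W).
have [psi psi_iso c] := siso_on_inv phi_iso.
by exists phi, psi; split=> //; [exact: phi_iso.1|exact: psi_iso.1].
Qed.

Lemma smod_morph_on_comp U E G H (phi : forall W, E W -> G W)
  (psi : forall W, G W -> H W) :
  smod_morph_on U phi -> smod_morph_on U psi ->
  smod_morph_on U (fun W => psi W \o phi W).
Proof.
move=> m1 m2 W WU.
have [[p1 d1] a1 r1] := m1 W WU; have [[p2 d2] a2 r2] := m2 W WU.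
split=> [|a s|V VW s] /=; first by split=> [|s t] /=; rewrite ?p1 ?d1.
- by rewrite a1 a2.
by rewrite r2 r1.
Qed.

Lemma siso_on_id U E : siso_on U (fun W (s : E W) => s).
Proof. by split=> // W WU; exists id. Qed.

Lemma siso_on_comp U E G H (phi : forall W, E W -> G W)
  (psi : forall W, G W -> H W) :
  siso_on U phi -> siso_on U psi -> siso_on U (fun W => psi W \o phi W).
Proof.
move=> [m1 b1] [m2 b2]; split; first exact: smod_morph_on_comp.
by move=> W WU; exact: bij_comp (b2 W WU) (b1 W WU).
Qed.

Lemma siso_onS U V E G (phi : forall W, E W -> G W) :
  V `<=` U -> siso_on U phi -> siso_on V phi.
Proof.
by move=> VU [m b]; split=> W WV; [apply: m|apply: b]; exact: subset_trans WV VU.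
Qed.

Lemma smod_iso_refl E : smod_iso E E.
Proof. by apply/smod_iso_onP; eexists; exact: siso_on_id. Qed.

Lemma smod_iso_sym E G : smod_iso E G -> smod_iso G E.
Proof.
move=> [phi [psi [m1 m2 c]]]; exists psi, phi; split=> // W WU.
by have [] := c W WU.
Qed.

Lemma smod_iso_trans E G H : smod_iso E G -> smod_iso G H -> smod_iso E H.
Proof.
move=> /smod_iso_onP[phi h1] /smod_iso_onP[psi h2]; apply/smod_iso_onP.
by eexists; exact: siso_on_comp h1 h2.
Qed.

Lemma smod_morph_glue E G (I : Type) (U : I -> opens Y)
  (phi : I -> forall W, E W -> G W) : \bigcup_i U i = [set: Y] ->
  (forall i, smod_morph_on (U i) (phi i)) ->
  (forall i j W s, W `<=` U i -> W `<=` U j -> phi i W s = phi j W s) ->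
  exists2 Phi : forall W, E W -> G W, smod_morph_on (Defs.openT Y) Phi &
    forall i W s, W `<=` U i -> Phi W s = phi i W s.
Proof.
move=> cov m agree.
have [|Phi [PN PE]] := @glue_morphism Y (smod_shf E) (smod_shf G) I U
    phi cov _ agree.
  by move=> i W V VW s WU; have [_ _] := m i W WU; exact.
exists Phi => // W _.
have sep (s t : G W) : (forall i V (VW : V `<=` W), V `<=` U i ->
    smres VW s = smres VW t) -> s = t.
  exact: (@sheaf_sep _ (smod_shf G) W _ U (cov_sub cov (W:=W))).
have PN' V (VW : V `<=` W) s : smres VW (Phi W s) = Phi V (smres VW s) by exact: PN.
split=> [|a s|V VW s]; last exact: PN'.
  split=> [|s t]; apply: sep => i V VW VU; have [[p d] _ _] := m i V VU;
      have [e0 eD] := smres_add E VW; have [g0 gD] := smres_add G VW.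
    by rewrite PN' (PE i) // e0 g0 p.
  rewrite PN' (PE i) // eD gD d.
  by rewrite -!(PE i) // -!PN'.
apply: sep => i V VW VU; have [_ a' _] := m i V VU.
by rewrite PN' (PE i) // !smres_scale a' -(PE i) // PN'.
Qed.

Section Free.
Variable n : nat.
Local Notation free := (sfree Y n).

Definition crd W (s : free W) (k : 'I_n) : sO W := (s : 'rV[sO W]_n) ord0 k.

Definition mkrow W (c : 'I_n -> sO W) : free W := (\row_k c k : 'rV[sO W]_n).

Lemma crd_mkrow W (c : 'I_n -> sO W) k : crd (mkrow c) k = c k.
Proof. exact: mxE. Qed.

Lemma crd_eq W (s t : free W) : crd s =1 crd t -> s = t.
Proof. by move=> e; apply/rowP => k; exact: e. Qed.

Lemma crdD W (s t : free W) k : crd (s + t) k = crd s k + crd t k.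
Proof. exact: mxE. Qed.

Lemma crd0 W k : crd (0 : free W) k = 0.
Proof. exact: mxE. Qed.

Lemma crdZ W (a : sO W) (s : free W) k : crd (a *: s) k = a * crd s k.
Proof. exact: mxE. Qed.

Lemma crd_sum W (I : finType) (s : I -> free W) k :
  crd (\sum_i s i) k = \sum_i crd (s i) k.
Proof. exact: summxE. Qed.

Lemma crd_res W V (VW : V `<=` W) (s : free W) k :
  crd (smres VW s) k = sres VW (crd s k).
Proof. exact: mxE. Qed.

Definition sbasis W k : free W := mkrow (fun i => (i == k)%:R).

Lemma crd_basis W i k : crd (sbasis W k) i = (i == k)%:R.
Proof. exact: crd_mkrow. Qed.

Lemma sbasis_res W V (VW : V `<=` W) k : smres VW (sbasis W k) = sbasis V k.
Proof. by apply: crd_eq => i; rewrite crd_res !crd_basis rmorph_nat. Qed.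

Lemma sfree_expand W (s : free W) : s = \sum_k crd s k *: sbasis W k.
Proof.
apply: crd_eq => i; rewrite crd_sum (bigD1 i) //= crdZ crd_basis eqxx mulr1.
rewrite big1 ?addr0 // => k ki.
by rewrite crdZ crd_basis eq_sym (negbTE ki) mulr0.
Qed.

Lemma siso_expand U E (phi : forall W, E W -> free W) (b : 'I_n -> E U) :
  siso_on U phi -> (forall k, phi U (b k) = sbasis U k) ->
  forall W (WU : W `<=` U) (s : E W),
    s = \sum_k crd (phi W s) k *: smres WU (b k).
Proof.
move=> [m bij] bE W WU s; apply: (bij_inj (bij W WU)).
have [a z _] := m W WU; have [_ _ r] := m U (@subset_refl _ _).
rewrite {1}[LHS]sfree_expand (nmod_morphism_sum _ a); apply: eq_bigr => k _.
by rewrite z -r bE sbasis_res.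
Qed.

Section Transition.
Variables (U : opens Y) (E : smod Y) (phi phi' : forall W, E W -> free W).
Arguments phi : clear implicits.
Arguments phi' : clear implicits.
Hypothesis zsf : forall a b : sO U, a + b = 0 -> a = 0.
Hypothesis mul_eq0 : forall a b : sO U, a * b = 0 -> a = 0 \/ b = 0.
Hypothesis U1 : (1 : sO U) <> 0.

(** The change-of-basis matrices over U are inverse to each other, hence monomial. Expanding
    sections in the basis [b] carries the formula to every W inside U. *)
Lemma sfree_transition : siso_on U phi -> siso_on U phi' ->
  exists (sg : {perm 'I_n}) (a : 'I_n -> sO U),
  (forall k, exists b, a k * b = 1) /\
  forall W (WU : W `<=` U) (s : E W) k,
    crd (phi' W s) (sg k) = sres WU (a k) * crd (phi W s) k.
Proof.
move: phi phi' => f f' fi f'i; have UU := @subset_refl _ (oset U).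
have basis (h : forall W, E W -> free W) : siso_on U h ->
    exists b : 'I_n -> E U, forall k, h U (b k) = sbasis U k.
  by move=> [_ /(_ U UU)[h' _ hK]]; exists (fun k => h' (sbasis U k)).
have [b bE] := basis _ fi; have [b' b'E] := basis _ f'i.
pose A k l := crd (f' U (b k)) l; pose B k l := crd (f U (b' k)) l.
have prod (g g' : forall W, E W -> free W) (e e' : 'I_n -> E U) :
    siso_on U g -> siso_on U g' -> (forall k, g U (e k) = sbasis U k) ->
    (forall k, g' U (e' k) = sbasis U k) ->
    forall i k, \sum_j crd (g' U (e i)) j * crd (g U (e' j)) k = (i == k)%:R.
  move=> gi g'i gE g'E i k; rewrite eq_sym -(@crd_basis U) -gE.
  rewrite [in RHS](siso_expand g'i g'E UU (e i)).
  have [a z _] := gi.1 U UU; rewrite (nmod_morphism_sum _ a) crd_sum.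
  by apply: eq_bigr => j _; rewrite z crdZ smres_id.
have [sg [A0 AB1]] := invertible_monomial zsf mul_eq0 U1
  (prod _ _ _ _ fi f'i bE b'E) (prod _ _ _ _ f'i fi b'E bE).
exists sg, (fun k => A k (sg k)); split=> [k|W WU s k].
  by exists (B (sg k) k); exact: AB1.
rewrite [s in LHS](siso_expand fi bE WU).
have [a z _] := f'i.1 W WU; have [_ _ r] := f'i.1 U UU.
rewrite (nmod_morphism_sum _ a) crd_sum (bigD1 k) //= big1 ?addr0 => [|j jk].
  by rewrite z crdZ -r crd_res mulrC.
rewrite z crdZ -r crd_res A0 ?rmorph0 ?mulr0 //.
by rewrite (inj_eq perm_inj) eq_sym.
Qed.
End Transition.

Lemma siso_on_monomial U (sg : {perm 'I_n}) (a : 'I_n -> sO U) E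
  (phi : forall W, E W -> free W) :
  (forall k, exists b, a k * b = 1) -> siso_on U phi ->
  exists2 phi' : forall W, E W -> free W, siso_on U phi' &
    forall W (WU : W `<=` U) (s : E W) k,
      crd (phi' W s) k = sres WU (a k) * crd (phi W s) (sg k).
Proof.
move=> a_unit phi_iso.
pose mono W (s : free W) : free W := if pselect (W `<=` U) is left WU
  then mkrow (fun k => sres WU (a k) * crd s (sg k)) else s.
have monoE W (WU : W `<=` U) (s : free W) k :
    crd (mono W s) k = sres WU (a k) * crd s (sg k).
  rewrite /mono; case: pselect => //= WU'; rewrite crd_mkrow.
  by rewrite (Prop_irrelevance WU' WU).
exists (fun W => mono W \o phi W) => [|W WU s k]; last exact: monoE.
apply: siso_on_comp => //; split=> W WU.
  split=> [|c s|V VW s].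
  - split=> [|s t]; apply: crd_eq => k; rewrite ?crdD !monoE.
      by rewrite !crd0 mulr0.
    by rewrite crdD mulrDr.
  - by apply: crd_eq => k; rewrite crdZ !monoE crdZ mulrCA.
  have VU := subset_trans VW WU.
  by apply: crd_eq => k; rewrite crd_res !monoE rmorphM (sres_comp _ _ VU) crd_res.
pose b k := sval (cid (a_unit k)).
have ab k : a k * b k = 1 := svalP (cid (a_unit k)).
exists (fun s => mkrow (fun k => sres WU (b (sg^-1%g k)) * crd s (sg^-1%g k))) => s.
  apply: crd_eq => k; rewrite crd_mkrow monoE mulrA -rmorphM (mulrC (b _)) ab.
  by rewrite rmorph1 mul1r permKV.
apply: crd_eq => k; rewrite monoE crd_mkrow permK mulrA -rmorphM ab rmorph1.
by rewrite mul1r.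
Qed.
End Free.

Section Charts.
Variables (n : nat) (J : Type) (U : J -> opens Y).
Hypothesis cov : \bigcup_i U i = [set: Y].
Local Notation free := (sfree Y n).
Local Notation transitions := (forall i j, 'I_n -> sO (meet (U i) (U j))).

Definition scharts E (g : transitions) :=
  exists phi : J -> forall W, E W -> free W,
  (forall i, siso_on (U i) (phi i)) /\
  forall i j W (Wij : W `<=` meet (U i) (U j)) (s : E W) k,
    crd (phi i W s) k = sres Wij (g i j k) * crd (phi j W s) k.

Definition scocycle (g : transitions) :=
  (forall i W (Wii : W `<=` meet (U i) (U i)) k, sres Wii (g i i k) = 1) /\
  forall i j l W (Wij : W `<=` meet (U i) (U j)) (Wjl : W `<=` meet (U j) (U l))
    (Wil : W `<=` meet (U i) (U l)) k,
    sres Wij (g i j k) * sres Wjl (g j l k) = sres Wil (g i l k).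

Lemma scharts_isol E G g : smod_iso E G -> scharts E g -> scharts G g.
Proof.
move=> /smod_iso_sym/smod_iso_onP[th th_iso] [phi [phi_iso phiE]].
exists (fun i W => phi i W \o th W); split=> [i|i j W Wij s k] /=.
  by apply: siso_on_comp; [exact: siso_onS th_iso|exact: phi_iso].
exact: phiE.
Qed.

Lemma scharts_locfree E g : scharts E g ->
  forall y : Y, exists U : opens Y, oset U y /\ smod_iso_on U E free.
Proof.
move=> [phi [phi_iso _]] y; have [i _ Uy] : (\bigcup_i U i) y by rewrite cov.
by exists (U i); split=> //; apply/smod_iso_onP; exists (phi i).
Qed.
End Charts.
End SemiringModuleCharts.

(** * Semimodules with a prescribed diagonal cocycle *)

Section SemiringTwist.
Variables (Y : semiringSpace) (n : nat) (J : Type) (U : J -> opens Y).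
Variable g : forall i j, 'I_n -> sO (meet (U i) (U j)).
Hypothesis gP : scocycle g.
Implicit Types V W : opens Y.
Local Open Scope ring_scope.
Local Notation free := (sfree Y n).
Local Notation free_shf := (smod_shf free).

Definition sdiag i j W (Wij : W `<=` meet (U i) (U j)) (s : free W) : free W :=
  mkrow (fun k => sres Wij (g i j k) * crd s k).

Lemma sdiag_nat i j W V (Wij : W `<=` meet (U i) (U j))
  (Vij : V `<=` meet (U i) (U j)) (VW : V `<=` W) (s : free W) :
  smres VW (sdiag Wij s) = sdiag Vij (smres VW s).
Proof.
apply: crd_eq => k.
by rewrite crd_res !crd_mkrow rmorphM (sres_comp _ _ Vij) crd_res.
Qed.

Lemma sdiag_id i W (Wii : W `<=` meet (U i) (U i)) (s : free W) :
  sdiag Wii s = s.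
Proof. by apply: crd_eq => k; rewrite crd_mkrow gP.1 mul1r. Qed.

Lemma sdiag_comp i j k W (Wij : W `<=` meet (U i) (U j))
  (Wjk : W `<=` meet (U j) (U k)) (Wik : W `<=` meet (U i) (U k))
  (s : free W) : sdiag Wij (sdiag Wjk s) = sdiag Wik s.
Proof.
by apply: crd_eq => l; rewrite !crd_mkrow mulrA (gP.2 i j k W Wij Wjk Wik).
Qed.

(** A named copy of [twsec], on which the semimodule structure is declared. *)
Definition stws W : Type := @twsec Y free_shf J U sdiag W.

HB.instance Definition _ W := gen_eqMixin (stws W).
HB.instance Definition _ W := gen_choiceMixin (stws W).

Lemma stws_eq W (s t : stws W) :
  (forall i k, crd (s i : free _) k = crd (t i : free _) k) -> s = t.
Proof. by move=> e; apply: twsec_eq => i; apply: crd_eq => k; exact: e. Qed.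

Lemma stwP W (s : stws W) i j V (Vij : V `<=` meet (U i) (U j))
  (Vi : V `<=` meet W (U i)) (Vj : V `<=` meet W (U j)) k :
  sres Vi (crd (s i : free _) k) =
  sres Vij (g i j k) * sres Vj (crd (s j : free _) k).
Proof.
rewrite -crd_res -[X in _ = _ * X]crd_res -[RHS](crd_mkrow (fun k => _ * crd _ k)).
by congr (crd _ k); exact: (twP s Vij Vi Vj).
Qed.

Lemma stws_subproof W (c : forall i, 'I_n -> sO (meet W (U i))) :
  (forall i j V (Vij : V `<=` meet (U i) (U j))
    (Vi : V `<=` meet W (U i)) (Vj : V `<=` meet W (U j)) k,
    sres Vi (c i k) = sres Vij (g i j k) * sres Vj (c j k)) ->
  forall i j V (Vij : V `<=` meet (U i) (U j))
    (Vi : V `<=` meet W (U i)) (Vj : V `<=` meet W (U j)),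
    smres Vi (mkrow (c i)) = sdiag Vij (smres Vj (mkrow (c j))).
Proof.
move=> h i j V Vij Vi Vj; apply: crd_eq => k.
by rewrite crd_mkrow !crd_res !crd_mkrow; exact: h.
Qed.

Definition mkstws W c h : stws W :=
  @TwSec Y free_shf J U sdiag W (fun i => mkrow (c i)) (@stws_subproof W c h).

Lemma crd_mkstws W c h i k : crd (@mkstws W c h i : free _) k = c i k.
Proof. exact: crd_mkrow. Qed.

Definition stw_zero W : stws W.
Proof.
apply: (@mkstws W (fun _ _ => 0)) => i j V Vij Vi Vj k.
by rewrite !rmorph0 mulr0.
Defined.

Definition stw_add W (s t : stws W) : stws W.
Proof.
apply: (@mkstws W (fun i k => crd (s i : free _) k + crd (t i : free _) k)).
move=> i j V Vij Vi Vj k.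
by rewrite !rmorphD !(stwP _ Vij Vi Vj) mulrDr.
Defined.

Definition stw_scale W (a : sO W) (s : stws W) : stws W.
Proof.
apply: (@mkstws W (fun i k => sres (@meetl _ W (U i)) a * crd (s i : free _) k)).
move=> i j V Vij Vi Vj k; have VW := subset_trans Vi (@meetl _ _ _).
by rewrite !rmorphM !(sres_comp _ _ VW) (stwP _ Vij Vi Vj) mulrCA.
Defined.

Lemma stw_addA W : associative (@stw_add W).
Proof. by move=> s t u; apply: stws_eq => i k; rewrite !crd_mkstws addrA. Qed.

Lemma stw_addC W : commutative (@stw_add W).
Proof. by move=> s t; apply: stws_eq => i k; rewrite !crd_mkstws addrC. Qed.

Lemma stw_add0 W : left_id (stw_zero W) (@stw_add W).
Proof. by move=> s; apply: stws_eq => i k; rewrite !crd_mkstws add0r. Qed.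

HB.instance Definition _ W := GRing.isNmodule.Build (stws W)
  (@stw_addA W) (@stw_addC W) (@stw_add0 W).

Lemma stw_scaleA W (a b : sO W) (s : stws W) :
  stw_scale a (stw_scale b s) = stw_scale (a * b) s.
Proof.
by apply: stws_eq => i k; rewrite !crd_mkstws rmorphM mulrA.
Qed.

Lemma stw_scale0 W (s : stws W) : stw_scale 0 s = 0.
Proof.
by apply: stws_eq => i k; rewrite [RHS]crd_mkstws crd_mkstws rmorph0 mul0r.
Qed.

Lemma stw_scale1 W : left_id 1 (@stw_scale W).
Proof. by move=> s; apply: stws_eq => i k; rewrite crd_mkstws rmorph1 mul1r. Qed.

Lemma stw_scaleDr W : right_distributive (@stw_scale W) +%R.
Proof.
move=> a s t; apply: stws_eq => i k.
by rewrite [RHS]crd_mkstws !crd_mkstws mulrDr.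
Qed.

Lemma stw_scaleDl W (s : stws W) : {morph (@stw_scale W)^~ s : a b / a + b}.
Proof.
move=> a b; apply: stws_eq => i k.
by rewrite [RHS]crd_mkstws !crd_mkstws rmorphD mulrDl.
Qed.

HB.instance Definition _ W := GRing.Nmodule_isLSemiModule.Build (sO W) (stws W)
  (@stw_scaleA W) (@stw_scale0 W) (@stw_scale1 W) (@stw_scaleDr W)
  (@stw_scaleDl W).

Definition stw_res W V (VW : V `<=` W) : stws W -> stws V :=
  @twres Y free_shf J U sdiag W V VW.

Lemma crd_stw_res W V (VW : V `<=` W) (s : stws W) i k :
  crd (stw_res VW s i : free _) k = sres (meetS VW) (crd (s i : free _) k).
Proof. exact: crd_res. Qed.

Definition stwist : smod Y.
Proof.
apply: (@SMod Y (fun W => stws W : lSemiModType (sO W)) stw_res)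
  => [W V VW|W V VW a s|].
- split=> [|s t]; apply: stws_eq => i k; rewrite crd_stw_res.
    by rewrite !crd_mkstws rmorph0.
  by rewrite [RHS]crd_mkstws !crd_stw_res crd_mkstws rmorphD.
- apply: stws_eq => i k; rewrite crd_stw_res !crd_mkstws crd_stw_res rmorphM.
  have VWi := subset_trans (@meetl _ V (U i)) VW.
  by rewrite !(sres_comp _ _ VWi).
exact: (@twist_sheaf Y free_shf J U sdiag sdiag_nat).
Defined.

Lemma scharts_ex : exists E, scharts E g.
Proof.
exists stwist.
pose to i W (WU : W `<=` U i) (s : stwist W) : free W :=
  @twto Y free_shf J U sdiag i W WU s.
have crd_to i W WU s k :
    crd (@to i W WU s) k =
    sres (meet_sub (@subset_refl _ (oset W)) WU) (crd (s i : free _) k).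
  exact: crd_res.
pose phi i W (s : stwist W) : free W := if pselect (W `<=` U i) is left WU
  then to i W WU s else 0.
have phiE i W (WU : W `<=` U i) (s : stwist W) : phi i W s = to i W WU s.
  by rewrite /phi; case: pselect => // WU'; rewrite (Prop_irrelevance WU' WU).
exists phi; split=> [i|i j W Wij s k].
  split=> W WU; last first.
    have := @twfromK Y free_shf J U sdiag sdiag_nat sdiag_id sdiag_comp i W WU.
    have := @twtoK Y free_shf J U sdiag sdiag_nat sdiag_comp i W WU.
    move: (twfrom _ _ _) => h h1 h2.
    by exists h => s; rewrite phiE; [exact: h1|exact: h2].
  split=> [|a s|V VW s].
  - split=> [|s t]; apply: crd_eq => k; rewrite ?crdD !(phiE i W WU) !crd_to.
      by rewrite crd_mkstws rmorph0 crd0.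
    by rewrite crd_mkstws rmorphD.
  - apply: crd_eq => k; rewrite crdZ !(phiE i W WU) !crd_to crd_mkstws rmorphM.
    by rewrite (sres_comp _ _ (@subset_refl _ W)) sres_id.
  rewrite (phiE i V (subset_trans VW WU)) (phiE i W WU).
  exact: (@twto_nat Y free_shf).
have Wi := subset_trans Wij (@meetl _ _ _).
have Wj := subset_trans Wij (@meetr _ _ _).
by rewrite (phiE i W Wi) (phiE j W Wj) !crd_to; exact: stwP.
Qed.
End SemiringTwist.

(** * Bundles on the base change *)

Section BaseChangeCharts.
Variables (K : comPzSemiRingType) (X : monoidScheme) (XK : base_change K X).
Variables (n : nat) (J : Type) (U : J -> opens X).
Hypothesis cov : \bigcup_i U i = [set: X].
Implicit Types (V : opens X) (W : opens XK).
Local Open Scope ring_scope.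
Local Notation pre := (pre XK).
Local Notation pull := (@pull K X XK _).
Local Notation transitions := (forall i j, 'I_n -> mO (meet (U i) (U j))).

Definition preU i := pre (U i).

Lemma preU_cov : \bigcup_i preU i = [set: XK].
Proof.
apply/seteqP; split=> // y _.
have [i _ Uy] : (\bigcup_i U i) (bc_proj XK y) by rewrite cov.
by exists i.
Qed.

(** The inverse image of an overlap and the overlap of the inverse images have the same points but
    are different terms; restriction along the trivial inclusion passes between them. *)
Definition pullg (g : transitions) i j k : sO (meet (preU i) (preU j)) :=
  @sres XK (pre (meet (U i) (U j))) (meet (preU i) (preU j)) (fun _ h => h)
    (pull (g i j k)).

Lemma pullg_res (g : transitions) i j k W (Wij : W `<=` meet (preU i) (preU j))
  (Wij' : W `<=` pre (meet (U i) (U j))) :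
  sres Wij (pullg g i j k) = sres Wij' (pull (g i j k)).
Proof. exact: sres_comp. Qed.

(** A general W in X_K is no inverse image, so the relation is pulled back from the triple overlap
    in X and then restricted to W. *)
Lemma scocycle_pull (g : transitions) : cocycle g -> scocycle (pullg g).
Proof.
move=> [g1 gM]; split=> [i W Wii k|i j l W Wij Wjl Wil k].
  rewrite (pullg_res _ _ Wii) -(mres_id (@subset_refl _ _) (g i i k)) g1.
  by rewrite pull1 rmorph1.
pose V := meet (meet (U i) (U j)) (U l).
have Vij : V `<=` meet (U i) (U j) by exact: meetl.
have Vjl : V `<=` meet (U j) (U l) by move=> x [[]].
have Vil : V `<=` meet (U i) (U l) by move=> x [[]].
have WV : W `<=` pre V by move=> y Wy; split; [exact: Wij|exact: (Wil y Wy).2].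
have E i' j' (VU : V `<=` meet (U i') (U j')) (Wij' : W `<=` _) :
    sres Wij' (pullg g i' j' k) = sres WV (pull (mres VU (g i' j' k))).
  rewrite (pullg_res _ _ Wij').
  have VU' : pre V `<=` pre (meet (U i') (U j')) by move=> y; exact: VU.
  rewrite -(pull_res VU VU').
  by rewrite (sres_comp _ _ (Wij' : W `<=` pre (meet (U i') (U j')))).
by rewrite (E i j Vij) (E j l Vjl) (E i l Vil) -rmorphM -pullM gM.
Qed.

Variable i0 : J.
Hypothesis U_tame : forall i, tame XK (U i).
Hypothesis U2_tame : forall i j, tame XK (meet (U i) (U j)).
Hypothesis U3_tame : forall i j l, tame XK (meet (meet (U i) (U j)) (U l)).
Hypothesis Kf : semifield K.

(** The entries of the monomial matrix are units over the inverse image of V, and [tame_unit] splits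
    each into a constant of K and a unit of O(V). *)
Lemma tame_transition (V : opens X) (E : smod XK)
    (phi phi' : forall W, E W -> sfree XK n W) :
  tame XK V -> siso_on (pre V) phi -> siso_on (pre V) phi' ->
  exists (sg : {perm 'I_n}) (c : 'I_n -> K) (m : 'I_n -> mO V),
  [/\ forall k, c k <> 0, forall k, munit (m k) &
  forall W (WV : W `<=` pre V) (s : E W) k,
    crd (phi' W s) (sg k) =
    sres WV (scal _ (c k) * pull (m k)) * crd (phi W s) k].
Proof.
move=> tV p p'; have [sg [a [au aE]]] := sfree_transition (@tame_zsf _ _ _ _ tV)
  (@tame_mul_eq0 _ _ _ _ tV) (tame1K tV) p p'.
have cm k : exists cm : K * mO V,
    [/\ cm.1 <> 0, munit cm.2 & a k = scal _ cm.1 * pull cm.2].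
  by have [b /(tame_unit tV)[c [m h]]] := au k; exists (c, m).
exists sg, (fun k => (sval (cid (cm k))).1), (fun k => (sval (cid (cm k))).2).
split=> [k|k|W WV s k]; try by case: (svalP (cid (cm k))).
by case: (svalP (cid (cm k))) => _ _ <-; exact: aE.
Qed.

Lemma sres_neq0 V (W := pre V) (a : sO W) : tame XK V ->
  (exists b, a * b = 1) -> a <> 0.
Proof. by move=> tV [b ab] a0; apply: (tame1K tV); rewrite -ab a0 mul0r. Qed.

Lemma pull_unit (V : opens X) (m : mO V) : munit m -> exists b, pull m * b = 1.
Proof. by move=> [b mb]; exists (pull b); rewrite -pullM mb pull1. Qed.

Lemma scal_unit W c : c <> 0 -> exists b, scal W c * b = 1.
Proof. by move=> /Kf.2[d cd]; exists (scal W d); rewrite -scalM cd scal1. Qed.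

Lemma sunitM W (a b : sO W) : (exists c, a * c = 1) -> (exists c, b * c = 1) ->
  exists c, a * b * c = 1.
Proof.
by move=> [c ac] [d bd]; exists (c * d); rewrite mulrACA ac bd mulr1.
Qed.

(* The constants of K, like the permutations, are absorbed into the bases by
   comparison over U i0; then they are 1 on all overlaps by uniqueness of the
   decomposition of units. *)
Lemma svb_charts (E : svb XK n) : exists g : transitions, scharts E (pullg g).
Proof.
have triv i : exists phi, @siso_on XK (preU i) E (sfree XK n) phi.
  have [y Uy Umin] := tame_ptK (U_tame i); have [V [Vy]] := svb_locfree E y.
  by move=> /smod_iso_onP[phi /(siso_onS (Umin V Vy)) h]; exists phi.
pose phi i := sval (cid (triv i)).
have phi_iso i : siso_on (preU i) (phi i) := svalP (cid (triv i)).
have norm i : exists (m : 'I_n -> mO (meet (U i0) (U i)))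
    (phi' : forall W, E W -> sfree XK n W),
    [/\ forall k, munit (m k), siso_on (preU i) phi' &
    forall W (WU : W `<=` pre (meet (U i0) (U i))) (s : E W) k,
      crd (phi' W s) k = sres WU (pull (m k)) * crd (phi i0 W s) k].
  have sub0 : pre (meet (U i0) (U i)) `<=` preU i0 by move=> y [].
  have subi : pre (meet (U i0) (U i)) `<=` preU i by move=> y [].
  have [sg [c [m [c0 mu aE]]]] := tame_transition (U2_tame i0 i)
    (siso_onS sub0 (phi_iso i0)) (siso_onS subi (phi_iso i)).
  (* Rescaling the basis over [U i] by the inverses of the constants leaves only units from X in the
     comparison with [U i0]. *)
  pose d k := sval (cid (Kf.2 (c k) (c0 k))).
  have cd k : c k * d k = 1 := svalP (cid (Kf.2 (c k) (c0 k))).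
  have d_unit k : exists b, scal (preU i) (d k) * b = 1.
    by exists (scal _ (c k)); rewrite -scalM mulrC cd scal1.
  have [phi' phi'_iso phi'E] := siso_on_monomial sg d_unit (phi_iso i).
  exists m, phi'; split=> // W WU s k.
  rewrite (phi'E W (subset_trans WU subi)) aE mulrA; congr (_ * _).
  rewrite rmorphM mulrA !scal_res -scalM (mulrC (d k)) cd scal1; exact: mul1r.
pose m i := sval (cid (norm i)); pose phi' i := sval (cid (svalP (cid (norm i)))).
have [m_unit phi'_iso phi'E] : [/\ forall i k, munit (m i k),
    forall i, siso_on (preU i) (phi' i) &
    forall i W (WU : W `<=` pre (meet (U i0) (U i))) (s : E W) k,
      crd (phi' i W s) k = sres WU (pull (m i k)) * crd (phi i0 W s) k].
  by split=> i; case: (svalP (cid (svalP (cid (norm i))))).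
have tr i j : exists b : 'I_n -> mO (meet (U i) (U j)),
    forall W (WU : W `<=` pre (meet (U i) (U j))) (s : E W) k,
      crd (phi' i W s) k = sres WU (pull (b k)) * crd (phi' j W s) k.
  have subi : pre (meet (U i) (U j)) `<=` preU i by move=> y [].
  have subj : pre (meet (U i) (U j)) `<=` preU j by move=> y [].
  have [sg [c [b [c0 bu bE]]]] := tame_transition (U2_tame i j)
    (siso_onS subj (phi'_iso j)) (siso_onS subi (phi'_iso i)).
  (* Over the triple overlap with [U i0] both bases differ from that of [phi i0] by units from X
     alone. A moved index would make a unit 0; otherwise the constant [c k] is compared with 1 in
     the unique decomposition. *)
  suff sgc k : sg k = k /\ c k = 1.
    exists b => W WU s k; have [sg1 c1] := sgc k.
    by rewrite -{1}sg1 bE c1 scal1 mul1r.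
  pose V := meet (meet (U i) (U j)) (U i0).
  have tV : tame XK V := U3_tame i j i0.
  have V0 : pre V `<=` preU i0 by move=> y [].
  have Vij : V `<=` meet (U i) (U j) by exact: meetl.
  have V0i : V `<=` meet (U i0) (U i) by move=> x [[]].
  have V0j : V `<=` meet (U i0) (U j) by move=> x [[]].
  have Vij' : pre V `<=` pre (meet (U i) (U j)) by move=> y; exact: Vij.
  have V0i' : pre V `<=` pre (meet (U i0) (U i)) by move=> y; exact: V0i.
  have V0j' : pre V `<=` pre (meet (U i0) (U j)) by move=> y; exact: V0j.
  have [h _ hK] := (phi_iso i0).2 (pre V) V0.
  have := bE (pre V) Vij' (h (sbasis (pre V) k)) k.
  rewrite (phi'E i _ V0i') (phi'E j _ V0j') hK !crd_basis eqxx mulr1.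
  rewrite rmorphM scal_res (pull_res Vij) (pull_res V0i) (pull_res V0j).
  case: eqVneq => [sgk|_] /=; last first.
    rewrite mulr0 => /esym/sres_neq0; case=> //.
    apply: sunitM; last by apply: pull_unit; exact: munit_hom.
    by apply: sunitM; [exact: scal_unit|apply: pull_unit; exact: munit_hom].
  rewrite mulr1 -mulrA -pullM -[LHS]mul1r -(scal1 (pre V)) => /esym.
  rewrite sgk => /(tame_inj tV)[] //; first exact: Kf.1.
  exact: munit_hom.
exists (fun i j => sval (cid (tr i j))), phi'; split=> // i j W Wij s k.
rewrite (pullg_res _ _ Wij); exact: (svalP (cid (tr i j))).
Qed.

Lemma cocycle_unit (g : transitions) i j k : cocycle g -> munit (g i j k).
Proof.
move=> [g1 gM]; have sub : meet (U i) (U j) `<=` meet (U j) (U i) by move=> x [].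
have subi : meet (U i) (U j) `<=` meet (U i) (U i) by move=> x [].
exists (mres sub (g j i k)).
have := gM i j i _ (@subset_refl _ _) sub subi k.
by rewrite mres_id g1.
Qed.

(* The permutations and the constants of K relating both bases over the U i do
   not depend on i, since the U i meet; what remains is a coboundary over X. *)
Lemma scharts_transfer E (F : mmod X) (g g' : transitions) :
  scharts E (pullg g) -> scharts E (pullg g') -> mcharts F g -> mcharts F g'.
Proof.
move=> [phi [phi_iso phiE]] [phi' [phi'_iso phi'E]] Fg.
have gP := mcharts_cocycle Fg; have [th [th_iso thE]] := Fg.
have tr i := tame_transition (U_tame i) (phi_iso i) (phi'_iso i).
pose sg i := sval (cid (tr i)); pose c i := sval (cid (svalP (cid (tr i)))).
pose m i := sval (cid (svalP (cid (svalP (cid (tr i)))))).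
have [c0 m_unit trE] : [/\ forall i k, c i k <> 0, forall i k, munit (m i k) &
    forall i W (WV : W `<=` preU i) (s : E W) k, crd (phi' i W s) (sg i k) =
    sres WV (scal _ (c i k) * pull (m i k)) * crd (phi i W s) k].
  by split=> i; case: (svalP (cid (svalP (cid (svalP (cid (tr i))))))).
(* For the section that is the k-th basis element of [phi j], coordinate [sg i k] in [phi' i] is
   computed in two ways: through [phi i] and [g], and through [phi' j] and [g']. It is a unit, so
   [sg j k] must be the same index, and [tame_inj] compares the factors from X. *)
have key i j k : sg i k = sg j k /\ (mres (@meetl _ _ _) (m i k) * g i j k =
    g' i j (sg i k) * mres (@meetr _ _ _) (m j k))%g.
  pose V := meet (U i) (U j); have tV : tame XK V := U2_tame i j.
  have Vi : pre V `<=` preU i by move=> y [].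
  have Vj : pre V `<=` preU j by move=> y [].
  have VV : pre V `<=` meet (preU i) (preU j) by [].
  have [h _ hK] := (phi_iso j).2 (pre V) Vj.
  have := trE i (pre V) Vi (h (sbasis (pre V) k)) k.
  rewrite (phiE i j _ VV) hK crd_basis eqxx mulr1 (phi'E i j _ VV).
  rewrite !(pullg_res _ _ VV (@subset_refl _ (oset (pre V)))) !sres_id.
  rewrite -[X in crd _ X](permKV (sg j)) (trE j (pre V) Vj) hK crd_basis.
  rewrite !rmorphM !scal_res (pull_res (@meetl _ _ _)) (pull_res (@meetr _ _ _)).
  have giu := cocycle_unit i j k gP.
  have lu : munit (mres (@meetl _ (U i) (U j)) (m i k) * g i j k)%g.
    by apply: munitM giu; exact: munit_hom.
  rewrite -[RHS]mulrA -pullM; case: eqVneq => [e|_]; last first.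
    rewrite !mulr0 => /esym/sres_neq0; case=> //; apply: sunitM.
      exact: scal_unit.
    exact: pull_unit.
  rewrite e mulr1 mulrCA -pullM => /(tame_inj tV)[] // _ <-.
  by split=> //; rewrite -{2}e permKV.
have mu' i k : munit (m i ((sg i0)^-1%g k)) by [].
(* The permutation and the units found over X_K, without the constants, change the bases of [F] on X
   itself; [key] then turns [g] into [g']. *)
have mono i := miso_on_monomial (sg i0)^-1%g (mu' i) (th_iso i).
exists (fun i => s2val (cid2 (mono i))); split=> [i|i j W Wij s k].
  exact: (s2valP (cid2 (mono i))).
have Wi := subset_trans Wij (@meetl _ _ _).
have Wj := subset_trans Wij (@meetr _ _ _).
rewrite (s2valP' (cid2 (mono i)) W Wi) (s2valP' (cid2 (mono j)) W Wj).
rewrite (thE i j W Wij) !mulgA; congr (_ * _)%g.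
set l := (sg i0)^-1%g k; have [_ /(congr1 (mres Wij))] := key i j l.
rewrite !cmhomM (mres_comp _ _ Wi) (mres_comp _ _ Wj) => ->.
by rewrite (key i i0 l).1 permKV.
Qed.
End BaseChangeCharts.

(** * Pullbacks *)

Section PullbackFunctoriality.
Variables (X : monoidSpace) (Y : semiringSpace) (pi : mmor (mulspace Y) X).
Implicit Types (F : mmod X) (E G : smod Y).
Local Notation preim V := (preopens (mmor_cont pi) V).

Lemma is_pullback_unique F E E' :
  is_pullback pi F E -> is_pullback pi F E' -> smod_iso E E'.
Proof.
move=> [u ul uP] [u' u'l u'P].
have [phi [phim phiu _]] := uP _ _ u'l; have [psi [psim psiu _]] := u'P _ _ ul.
exists phi, psi; split=> // W _; split=> s.
  have [th [_ _ thP]] := uP _ _ ul.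
  rewrite [LHS](thP (fun W => psi W \o phi W)) => [|//|V t] /=.
  - by rewrite -(thP (fun W => id)) //; exact: (siso_on_id _ _).1.
  - exact: smod_morph_on_comp.
  by rewrite phiu psiu.
have [th [_ _ thP]] := u'P _ _ u'l.
rewrite [LHS](thP (fun W => phi W \o psi W)) => [|//|V t] /=.
- by rewrite -(thP (fun W => id)) //; exact: (siso_on_id _ _).1.
- exact: smod_morph_on_comp.
by rewrite psiu phiu.
Qed.

Lemma pi_linear_comp F F' G (th : forall V, F' V -> F V)
  (v : forall V, F V -> G (preim V)) :
  mmod_morph_on (Defs.openT X) th -> is_pi_linear v ->
  is_pi_linear (fun V => v V \o th V).
Proof.
move=> m [v0 va vr]; split=> [V|V a s|U V VU VU' s] /=.
- by have [-> _ _] := m V (@subsetT _ _).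
- by have [_ -> _] := m V (@subsetT _ _); rewrite va.
by have [_ _ <-] := m U (@subsetT _ _); rewrite vr.
Qed.

Lemma is_pullback_isol F F' E :
  mmod_iso F F' -> is_pullback pi F E -> is_pullback pi F' E.
Proof.
move=> [th [th' [thm th'm thK]]] [u ul uP].
have thK' V : cancel (th' V) (th V) by have [] := thK V (@subsetT _ _).
have {}thK V : cancel (th V) (th' V) by have [] := thK V (@subsetT _ _).
exists (fun V => u V \o th' V) => [|G v vl]; first exact: pi_linear_comp.
have [phi [phim phiu phiP]] := uP G _ (pi_linear_comp thm vl).
exists phi; split=> // [V s|psi psim psiu].
  by rewrite /= phiu /= thK'.
by apply: phiP => // V s; rewrite /= -psiu /= thK.
Qed.

Lemma is_pullback_isor F E E' :
  smod_iso E E' -> is_pullback pi F E -> is_pullback pi F E'.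
Proof.
move=> [th [th' [thm th'm thK]]] [u [u0 ua ur] uP].
have thK' V : cancel (th' V) (th V) by have [] := thK V (@subsetT _ _).
have {}thK V : cancel (th V) (th' V) by have [] := thK V (@subsetT _ _).
exists (fun V => th _ \o u V) => [|G v vl].
  split=> [V|V a s|U V VU VU' s] /=;
    have [[th0 _] tha thr] := thm _ (@subsetT _ (preim V)).
  - by rewrite u0 th0.
  - by rewrite ua tha.
  by have [_ _ ->] := thm _ (@subsetT _ (preim U)); rewrite ur.
have [phi [phim phiu phiP]] := uP G _ vl.
exists (fun W => phi W \o th' W); split=> [|V s|psi psim psiu W s] /=.
- exact: smod_morph_on_comp.
- by rewrite thK phiu.
rewrite -(phiP (fun W => psi W \o th W)) /= ?thK' //.
exact: smod_morph_on_comp.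
Qed.
End PullbackFunctoriality.

(** * Matching cocycles give a pullback *)

Section PullbackCharts.
Variables (K : comPzSemiRingType) (X : monoidScheme) (XK : base_change K X).
Variables (n : nat) (J : Type) (U : J -> opens X).
Hypothesis cov : \bigcup_i U i = [set: X].
Implicit Types (V : opens X) (W : opens XK).
Local Open Scope ring_scope.
Local Notation pre := (pre XK).
Local Notation preU := (preU XK U).
Local Notation pull := (@pull K X XK _).
Variables (F : mmod X) (E : smod XK).
Variable g : forall i j, 'I_n -> mO (meet (U i) (U j)).
Variable phi : J -> forall V, F V -> mfree X n V.
Arguments phi : clear implicits.
Hypothesis phi_iso : forall i, miso_on (U i) (phi i).
Hypothesis phiE : forall i j V (Vij : V `<=` meet (U i) (U j)) (s : F V) k,
  phi i V s k = (mres Vij (g i j k) * phi j V s k)%g.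
Variable phi' : J -> forall W, E W -> sfree XK n W.
Arguments phi' : clear implicits.
Hypothesis phi'_iso : forall i, siso_on (preU i) (phi' i).
Hypothesis phi'E : forall i j W (Wij : W `<=` meet (preU i) (preU j)) (s : E W) k,
  crd (phi' i W s) k = sres Wij (pullg XK g i j k) * crd (phi' j W s) k.

(** The direct image of [E], viewed as a sheaf on X so that maps from [F] into it can be glued over
    the [U i]. *)
Lemma pushforward_sheaf :
  is_sheaf (fun U V (VU : V `<=` U) (s : E (pre U)) =>
    @smres XK E (pre U) (pre V) (fun y => VU (bc_proj XK y)) s).
Proof.
split=> [V VV s|U1 U2 U3 U21 U32 U31 s|V I V' V'V cV s sV].
- exact: smres_id.
- exact: smres_comp.
apply: (sheaf_glue (sm_sheaf E) (V := fun i => pre (V' i))).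
  by move=> y /cV[i _ Vi]; exists i.
move=> i j W Wi Wj.
(* Sections are known to agree only over inverse images of open sets of X, and any common W lies in
   the inverse image of the overlap. *)
have Wm : W `<=` pre (meet (V' i) (V' j)) 
  by move=> y Wy; split; [exact: Wi|exact: Wj].
have mi : pre (meet (V' i) (V' j)) `<=` pre (V' i) by move=> y [].
have mj : pre (meet (V' i) (V' j)) `<=` pre (V' j) by move=> y [].
rewrite -(smres_comp mi Wm) -(smres_comp mj Wm); congr smres.
rewrite (Prop_irrelevance mi (fun y => @meetl _ (V' i) (V' j) (bc_proj XK y))).
rewrite (Prop_irrelevance mj (fun y => @meetr _ (V' i) (V' j) (bc_proj XK y))).
exact: sV.
Qed.

(** Over [U i] coordinates are pulled back one by one. The local maps agree because the coordinates
    of [E] change by the pullback of the cocycle of [F]. *)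
Lemma unit_map : exists u : forall V, F V -> E (pre V), is_pi_linear u /\
  forall i V, V `<=` U i -> forall (s : F V) k,
    crd (phi' i _ (u V s)) k = pull (phi i V s k).
Proof.
have inv i := siso_on_inv (phi'_iso i).
pose psi i := s2val (cid2 (inv i)).
have psiK i V (VU : V `<=` U i) : cancel (psi i (pre V)) (phi' i (pre V)).
  have VU' : pre V `<=` preU i by move=> y; exact: VU.
  by have [_] := s2valP' (cid2 (inv i)) (pre V) VU'.
pose f i V (s : F V) := psi i (pre V) (mkrow (fun k => pull (phi i V s k))).
have fE i V (VU : V `<=` U i) s k :
    crd (phi' i _ (f i V s)) k = pull (phi i V s k).
  by rewrite psiK // crd_mkrow.
have inj i V (VU : V `<=` U i) : injective (phi' i (pre V)).
  by apply: bij_inj; apply: (phi'_iso i).2 => y; exact: VU.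
have res i V (VU : V `<=` U i) W (WV : W `<=` pre V) (s : E (pre V)) k :
    crd (phi' i W (smres WV s)) k = sres WV (crd (phi' i _ s) k).
  have [|_ _ r] := (phi'_iso i).1 (pre V); first by move=> y; exact: VU.
  by rewrite -r crd_res.
have resF i V (VU : V `<=` U i) V' (V'V : V' `<=` V) (s : F V) k :
    phi i V' (mmres V'V s) k = mres V'V (phi i V s k).
  by have [_ _ r] := (phi_iso i).1 V VU; rewrite -r.
have f_nat i V V' (V'V : V' `<=` V) (V'V' : pre V' `<=` pre V) s :
    V `<=` U i -> smres V'V' (f i V s) = f i V' (mmres V'V s).
  move=> VU; have V'U := subset_trans V'V VU; apply: (inj i V' V'U).
  by apply: crd_eq => k; rewrite res // !fE // resF // (pull_res V'V).
pose B := Sheaf pushforward_sheaf.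
have [||u [uN uE]] := @glue_morphism X (mmod_shf F) B J U f cov.
- by move=> i V V' V'V s VU; exact: f_nat.
- move=> i j V s Vi Vj; apply: (inj i V Vi); apply: crd_eq => k.
  have Vij := meet_sub Vi Vj.
  have Vij' : pre V `<=` meet (preU i) (preU j) by move=> y; exact: Vij.
  rewrite [RHS](phi'E Vij') !fE // (phiE Vij) pullM; congr (_ * _).
  have Vij'' : pre V `<=` pre (meet (U i) (U j)) by [].
  by rewrite (pullg_res _ _ Vij' Vij'') (pull_res Vij).
have uN' V V' (V'V : V' `<=` V) (V'V' : pre V' `<=` pre V) (s : F V) :
    smres V'V' (u V s) = u V' (mmres V'V s).
  by rewrite -[RHS]uN; congr (smres _ _); exact: Prop_irrelevance.
exists u; split=> [|i V VU s k]; last by rewrite (uE i) // fE.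
have sep V (s t : E (pre V)) : (forall i V' (V'V : V' `<=` V)
    (V'V' : pre V' `<=` pre V), V' `<=` U i ->
    smres V'V' s = smres V'V' t) -> s = t.
  move=> h; apply: (@sheaf_sep X B V J U (cov_sub cov (W := V))).
  by move=> i V' V'V V'U; exact: (h i V' V'V _ V'U).
split=> [V|V a s|V V' V'V V'V' s]; last exact: uN'.
- apply: sep => i V' V'V V'V' V'U; apply: (inj i V' V'U); apply: crd_eq => k.
  rewrite (uN' _ _ V'V) (smres_add E V'V').1 mmres_pt (uE i) // fE //.
  have V'U' : pre V' `<=` preU i by move=> y; exact: V'U.
  have [-> _ _] := (phi_iso i).1 V' V'U.
  have [[-> _] _ _] := (phi'_iso i).1 (pre V') V'U'.
  by rewrite crd0 -(pull0 XK V').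
apply: sep => i V' V'V V'V' V'U; apply: (inj i V' V'U); apply: crd_eq => k.
rewrite (uN' _ _ V'V) smres_scale (uN' _ _ V'V) mmres_act !(uE i) // fE //.
have V'U' : pre V' `<=` preU i by move=> y; exact: V'U.
have [_ -> _] := (phi_iso i).1 V' V'U.
have [_ -> _] := (phi'_iso i).1 (pre V') V'U'.
by rewrite crdZ fE // [LHS]pullM (pull_res V'V).
Qed.

(** Over each piece [E] is free on the images under [u] of the basis [b] of [F], so a morphism out
    of [E] is determined there by the values of [v] on [b]. *)
Lemma trivialized_pullback : is_pullback (bc_proj XK) F E.
Proof.
have [u [ul uE]] := unit_map; exists u => // G v [v0 va vr].
have UU i := @subset_refl _ (oset (U i)).
have UU' i := @subset_refl _ (oset (preU i)).
have [b bE] : exists b : forall i, 'I_n -> F (U i),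
    forall i k, phi i (U i) (b i k) = mbasis (U i) k.
  have ex i k : exists b, phi i (U i) b = mbasis (U i) k.
    by have [h _ hK] := (phi_iso i).2 (U i) (UU i); exists (h (mbasis (U i) k)).
  by exists (fun i k => sval (cid (ex i k))) => i k; exact: (svalP (cid (ex i k))).
have bE' i k : phi' i (preU i) (u (U i) (b i k)) = sbasis (preU i) k.
  apply: crd_eq => l; rewrite (uE i) // bE crd_basis /=.
  by case: eqP => _; [exact: pull1|exact: pull0].
pose th i W (s : E W) : G W := if pselect (W `<=` preU i) is left WU
  then \sum_k crd (phi' i W s) k *: smres WU (v (U i) (b i k)) else 0.
have thE i W (WU : W `<=` preU i) (s : E W) :
    th i W s = \sum_k crd (phi' i W s) k *: smres WU (v (U i) (b i k)).
  rewrite /th; case: pselect => // WU'.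
  by rewrite (Prop_irrelevance WU' WU).
have th_morph i : smod_morph_on (preU i) (th i).
  move=> W WU; have [[p0 pD] pZ pr] := (phi'_iso i).1 W WU.
  split=> [|a s|W' W'W s].
  - split=> [|s t]; rewrite !(thE i W WU).
      by rewrite big1 // => k _; rewrite p0 crd0 scale0r.
    by rewrite -big_split; apply: eq_bigr => k _; rewrite pD crdD scalerDl.
  - rewrite !(thE i W WU) scaler_sumr; apply: eq_bigr => k _.
    by rewrite pZ crdZ scalerA.
  have W'U := subset_trans W'W WU; rewrite (thE i W WU) (thE i W' W'U).
  rewrite (nmod_morphism_sum _ (smres_add G W'W)); apply: eq_bigr => k _.
  by rewrite smres_scale (smres_comp _ _ W'U) -pr crd_res.
have th_agree i j W s : W `<=` preU i -> W `<=` preU j -> th i W s = th j W s.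
  move=> Wi Wj; rewrite (thE i W Wi) (thE j W Wj); apply: eq_bigr => k _.
  pose V := meet (U i) (U j).
  have Vi : V `<=` U i by exact: meetl.
  have Vj : V `<=` U j by exact: meetr.
  have Vi' : pre V `<=` preU i by move=> y; exact: Vi.
  have Vj' : pre V `<=` preU j by move=> y; exact: Vj.
  have WV : W `<=` pre V by move=> y Wy; split; [exact: Wi|exact: Wj].
  (* Bases transform by the same factor as coordinates, with the roles of [i] and [j] exchanged;
     hence the two expansions coincide. *)
  have bb : mmres Vj (b j k) = mact (g i j k) (mmres Vi (b i k)).
    apply: (bij_inj ((phi_iso i).2 V Vi)); have [_ a _] := (phi_iso i).1 V Vi.
    have [_ _ ri] := (phi_iso i).1 (U i) (UU i).
    have [_ _ rj] := (phi_iso j).1 (U j) (UU j).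
    apply: mfsec_eq => l; rewrite (phiE (@subset_refl _ (oset V))) mres_id a.
    rewrite -ri bE -rj bE !mbasis_res /=.
    by case: eqVneq => [->|_]; rewrite ?mulg0.
  have Wij : W `<=` meet (preU i) (preU j) by exact: WV.
  rewrite (phi'E Wij) (pullg_res _ _ Wij WV).
  rewrite -(smres_comp Vi' WV) -(smres_comp Vj' WV) (vr _ _ Vi) (vr _ _ Vj) bb.
  by rewrite va smres_scale scalerA mulrC.
have [Phi Phi_morph PhiE] := smod_morph_glue (preU_cov XK cov) th_morph th_agree.
have Phi_b i k : Phi _ (u (U i) (b i k)) = v (U i) (b i k).
  rewrite (PhiE i) // (thE i _ (UU' i)) (bigD1 k) //= big1 ?addr0 => [|l lk].
    by rewrite bE' crd_basis eqxx scale1r smres_id.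
  by rewrite bE' crd_basis (negbTE lk) scale0r.
have Phi_res W W' (W'W : W' `<=` W) s :
    smres W'W (Phi W s) = Phi W' (smres W'W s).
  by have [_ _ ->] := Phi_morph W (@subsetT _ _).
exists Phi; split=> // [V s|Psi Psi_morph Psi_u W s].
  (* Near the image of [y] in X the section [s] is the base point or a multiple of one basis
     element, and the inverse image of that neighbourhood is a neighbourhood of [y]. *)
  apply: (@sheaf_sep_loc _ (smod_shf G)) => y Vy.
  have [i _ Uy] : (\bigcup_i U i) (bc_proj XK y) by rewrite cov.
  pose V1 := meet V (U i).
  have V1V : V1 `<=` V by exact: meetl.
  have V1U : V1 `<=` U i by exact: meetr.
  have V1y : oset V1 (bc_proj XK y) by split.
  have [V2 [V21 [V2y h]]] := mfree_local (phi i V1 (mmres V1V s)) V1y.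
  have V2V := subset_trans V21 V1V; have V2U := subset_trans V21 V1U.
  have V2V' : pre V2 `<=` pre V by move=> z; exact: V2V.
  have V2U' : pre V2 `<=` preU i by move=> z; exact: V2U.
  exists (pre V2), V2V'; split=> //.
  change (smres V2V' (Phi _ (u V s)) = smres V2V' (v V s)).
  have [[Phi0 _] PhiZ _] := Phi_morph (pre V2) (@subsetT _ _).
  have [u0 ua ur] := ul.
  rewrite Phi_res (ur _ _ V2V) (vr _ _ V2V).
  have [_ _ r1] := (phi_iso i).1 V1 V1U.
  have [p2 a2 _] := (phi_iso i).1 V2 V2U.
  have [_ _ r3] := (phi_iso i).1 (U i) (UU i).
  rewrite r1 (mmres_comp _ _ V2V) in h.
  have inj := bij_inj ((phi_iso i).2 V2 V2U).
  case: h => [h|[k [c h]]].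
    have -> : mmres V2V s = mpt _ by apply: inj; rewrite h p2.
    by rewrite u0 v0 Phi0.
  have -> : mmres V2V s = mact c (mmres V2U (b i k)).
    by apply: inj; rewrite h a2 -r3 bE mbasis_res.
  rewrite ua va PhiZ; congr (_ *: _).
  by rewrite -(vr _ _ V2U V2U') -(ur _ _ V2U V2U') -Phi_res Phi_b.
apply: (@sheaf_sep _ (smod_shf G) W J preU (cov_sub (preU_cov XK cov) (W := W))).
move=> i W' W'W W'U; change (smres W'W (Psi W s) = smres W'W (Phi W s)).
have [_ _ ->] := Psi_morph W (@subsetT _ _); rewrite Phi_res.
rewrite (siso_expand (phi'_iso i) (bE' i) W'U (smres W'W s)).
have [Psi_add Psi_scale _] := Psi_morph W' (@subsetT _ _).
have [Phi_add Phi_scale _] := Phi_morph W' (@subsetT _ _).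
rewrite (nmod_morphism_sum _ Psi_add) (nmod_morphism_sum _ Phi_add).
apply: eq_bigr => k _; rewrite Psi_scale Phi_scale; congr (_ *: _).
have [_ _ rPsi] := Psi_morph (preU i) (@subsetT _ _).
by rewrite -rPsi -Phi_res Psi_u Phi_b.
Qed.
End PullbackCharts.

Lemma charts_pullback (K : comPzSemiRingType) (X : monoidScheme)
  (XK : base_change K X) (n : nat) (J : Type) (U : J -> opens X)
  (F : mmod X) (E : smod XK) (g : forall i j, 'I_n -> mO (meet (U i) (U j))) :
  \bigcup_i U i = [set: X] -> mcharts F g -> scharts E (pullg XK g) ->
  is_pullback (bc_proj XK) F E.
Proof.
move=> cov [phi [phi_iso phiE]] [phi' [phi'_iso phi'E]].
exact: (trivialized_pullback cov phi_iso phiE phi'_iso phi'E).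
Qed.

(** * Isomorphism classes *)

Section IsoClassesTheory.
Variables (T : Type) (R : T -> T -> Prop).
Hypothesis R_refl : forall x, R x x.
Hypothesis R_sym : forall x y, R x y -> R y x.
Hypothesis R_trans : forall x y z, R x y -> R y z -> R x z.

Lemma iso_class_eq x y : iso_class R x = iso_class R y <-> R x y.
Proof.
split=> [/(congr1 sval)/= e|xy]; first by rewrite e; exact: R_refl.
apply: eq_exist; apply/funext => z; apply/propext; split=> h.
  exact: R_trans (R_sym xy) h.
exact: R_trans xy h.
Qed.

Lemma iso_class_surj (C : iso_classes R) : exists x, C = iso_class R x.
Proof. by case: C => P [x e]; exists x; exact: eq_exist. Qed.
End IsoClassesTheory.

(** * The bijection on isomorphism classes *)

Section BaseChangeBundles.
Variables (K : comPzSemiRingType) (X : monoidScheme) (XK : base_change K X).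
Variables (n : nat) (J : Type) (U : J -> opens X) (i0 : J).
Hypothesis Kf : semifield K.
Hypothesis cov : \bigcup_i U i = [set: X].
Hypothesis U_tame : forall i, tame XK (U i).
Hypothesis U2_tame : forall i j, tame XK (meet (U i) (U j)).
Hypothesis U3_tame : forall i j l, tame XK (meet (meet (U i) (U j)) (U l)).
Implicit Types (F : mvb X n) (E : svb XK n) (V : opens X).
Local Notation transitions := (forall i j, 'I_n -> mO (meet (U i) (U j))).

Lemma tame_mlocal V : tame XK V -> mlocal V.
Proof. by move=> tV; split; [exact: tame_pt tV|exact: tame1 tV]. Qed.

Lemma pull_inj V (m m' : mO V) : tame XK V -> munit m' ->
  pull XK m = pull XK m' -> m = m'.
Proof.
move=> tV um' e; have [//|_ //] := @tame_inj _ _ _ _ tV 1%R 1%R m m' Kf.1 um' _.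
by rewrite e.
Qed.

(** The relations hold after pullback because [E] exists, and [pull_inj] descends them when one side
    is a unit. Hence the order: g_ii = 1, then invertibility of the g_ij, then the triple relation
    over the tame overlap, restricted to W at the end. *)
Lemma scharts_cocycle E (g : transitions) : scharts E (pullg XK g) -> cocycle g.
Proof.
move=> [phi [phi_iso phiE]].
have section i V (VU : V `<=` U i) k : exists2 s : E (pre XK V),
    crd (phi i _ s) k = 1%R & forall j (Vj : V `<=` meet (U j) (U i)),
    crd (phi j _ s) k = pull XK (mres Vj (g j i k)).
  have VU' : pre XK V `<=` preU XK U i by move=> y; exact: VU.
  have [h _ hK] := (phi_iso i).2 _ VU'; exists (h (sbasis _ k)) => [|j Vj].
    by rewrite hK crd_basis eqxx.
  have Vj' : pre XK V `<=` pre XK (meet (U j) (U i)) by move=> y; exact: Vj.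
  have Vj'' : pre XK V `<=` meet (preU XK U j) (preU XK U i) by exact: Vj'.
  by rewrite (phiE j i _ Vj'') hK crd_basis eqxx mulr1 (pullg_res _ _ Vj'' Vj')
    (pull_res Vj).
have rel i j l V (Vij : V `<=` meet (U i) (U j)) (Vjl : V `<=` meet (U j) (U l))
    (Vil : V `<=` meet (U i) (U l)) k :
    pull XK (mres Vij (g i j k) * mres Vjl (g j l k))%g =
    pull XK (mres Vil (g i l k)).
  have [s _ sP] := section l V (subset_trans Vil (@meetr _ _ _)) k.
  rewrite pullM -(sP j Vjl) -(sP i Vil).
  have Vij' : pre XK V `<=` pre XK (meet (U i) (U j)) by move=> y; exact: Vij.
  have Vij'' : pre XK V `<=` meet (preU XK U i) (preU XK U j) by exact: Vij'.
  by rewrite (phiE i j _ Vij'') (pullg_res _ _ Vij'' Vij') (pull_res Vij).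
have one_unit V : munit (1%g : mO V) by exists 1%g; rewrite mulg1.
have g1 i k : g i i k = 1%g.
  apply: (pull_inj (U2_tame i i)) => //.
  have [s s1 sP] := section i (meet (U i) (U i)) (@meetl _ _ _) k.
  by have := sP i (@subset_refl _ _); rewrite mres_id s1 pull1.
have gu i j k : munit (g i j k).
  have sub : meet (U i) (U j) `<=` meet (U j) (U i) by move=> x [].
  have subi : meet (U i) (U j) `<=` meet (U i) (U i) by move=> x [].
  exists (mres sub (g j i k)); apply: (pull_inj (U2_tame i j)) => //.
  have := rel i j i _ (@subset_refl _ _) sub subi k.
  by rewrite mres_id g1 cmhom1.
split=> [i W Wii k|i j l W Wij Wjl Wil k]; first by rewrite g1 cmhom1.
pose V := meet (meet (U i) (U j)) (U l).
have Vij : V `<=` meet (U i) (U j) by exact: meetl.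
have Vjl : V `<=` meet (U j) (U l) by move=> x [[]].
have Vil : V `<=` meet (U i) (U l) by move=> x [[]].
have WV : W `<=` V by move=> x Wx; split; [exact: Wij|exact: (Wil x Wx).2].
rewrite -(mres_comp Vij WV) -(mres_comp Vjl WV) -(mres_comp Vil WV) -cmhomM.
congr (mres _ _); apply: (pull_inj (U3_tame i j l)); last exact: rel.
exact: munit_hom.
Qed.

Lemma mvb_pullback F : exists E, is_pullback (bc_proj XK) F E.
Proof.
have [g Fg] := mvb_charts i0 (fun i => tame_mlocal (U_tame i))
  (fun i j => tame_mlocal (U2_tame i j)) (fun i j l => tame1 (U3_tame i j l)) F.
have [E Eg] := scharts_ex (scocycle_pull XK (mcharts_cocycle Fg)).
exists (SVB (scharts_locfree (preU_cov XK cov) Eg)).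
exact: (charts_pullback cov Fg Eg).
Qed.

Lemma svb_pullback E : exists F, is_pullback (bc_proj XK) F E.
Proof.
have [g Eg] := svb_charts i0 U_tame U2_tame U3_tame Kf E.
have [F Fg] := mcharts_ex (scharts_cocycle Eg).
exists (MVB (mcharts_locfree cov Fg)).
exact: (charts_pullback cov Fg Eg).
Qed.

(** The twist by [pullg XK g] is also a pullback of [F], so it is isomorphic to [E] and lends it its
    charts. *)
Lemma pullback_charts F E (g : transitions) : mcharts F g ->
  is_pullback (bc_proj XK) F E -> scharts E (pullg XK g).
Proof.
move=> Fg FE.
have [E' E'g] := scharts_ex (scocycle_pull XK (mcharts_cocycle Fg)).
apply: scharts_isol (E'g); apply: is_pullback_unique FE.
exact: (charts_pullback cov Fg E'g).
Qed.

Lemma pullback_inj F F' E : is_pullback (bc_proj XK) F E ->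
  is_pullback (bc_proj XK) F' E -> mmod_iso F F'.
Proof.
have charts (G : mvb X n) := mvb_charts i0 (fun i => tame_mlocal (U_tame i))
  (fun i j => tame_mlocal (U2_tame i j)) (fun i j l => tame1 (U3_tame i j l)) G.
have [g Fg] := charts F; have [g' F'g'] := charts F'.
move=> /(pullback_charts Fg) Eg /(pullback_charts F'g') Eg'.
exact: (mcharts_iso cov (scharts_transfer i0 U_tame U2_tame Kf Eg Eg' Fg) F'g').
Qed.

Lemma pullback_classes : exists Phi : mVect X n -> sVect XK n,
  bijective Phi /\
  forall F E,
    Phi (mvb_class F) = svb_class E <-> is_pullback (bc_proj XK) F E.
Proof.
have mE := iso_class_eq (R := fun F G : mvb X n => mmod_iso F G)
  (fun F => mmod_iso_refl F) (fun F G => @mmod_iso_sym _ F G)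
  (fun F G H => @mmod_iso_trans _ F G H).
have sE := iso_class_eq (R := fun E G : svb XK n => smod_iso E G)
  (fun E => smod_iso_refl E) (fun E G => @smod_iso_sym _ E G)
  (fun E G H => @smod_iso_trans _ E G H).
have ex (C : mVect X n) : exists E : svb XK n,
    exists2 F : mvb X n, C = mvb_class F & is_pullback (bc_proj XK) F E.
  have [F CF] := iso_class_surj C; have [E FE] := mvb_pullback F.
  by exists E, F.
(* A representative and a pullback of it are chosen; [PhiP] shows that the class is independent of
   both choices. *)
pose Phi C := svb_class (sval (cid (ex C))).
have PhiP F E : Phi (mvb_class F) = svb_class E <-> is_pullback (bc_proj XK) F E.
  rewrite /Phi; case: cid => E' /= [F' /mE FF' FE'].
  have FE'' : is_pullback (bc_proj XK) F E'.
    exact: is_pullback_isol (mmod_iso_sym FF') FE'.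
  split=> [/sE EE'|FE]; first exact: is_pullback_isor EE' FE''.
  by apply/sE; exact: is_pullback_unique FE'' FE.
exists Phi; split=> //; apply: inj_surj_bijective => [C C'|D].
  have [F ->] := iso_class_surj C; have [F' ->] := iso_class_surj C'.
  have [E FE] := mvb_pullback F.
  have /PhiP -> := FE => /esym/PhiP F'E.
  by apply/mE; exact: pullback_inj FE F'E.
have [E ->] := iso_class_surj D; have [F FE] := svb_pullback E.
by exists (mvb_class F); apply/PhiP.
Qed.
End BaseChangeBundles.

(** * Irreducible schemes *)

Lemma irreducible_openI (X : topologicalType) (A B : set X) : irreducible X ->
  open A -> open B -> A !=set0 -> B !=set0 -> A `&` B !=set0.
Proof.
move=> [_ irr] oA oB [a Aa] [b Bb]; apply: contrapT => AB0.
have AB : ~` A `|` ~` B = setT.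
  apply/seteqP; split=> // x _; apply: contrapT => /not_orP[/contrapT Ax].
  by move=> /contrapT Bx; apply: AB0; exists x.
have [e|e] := irr _ _ (open_closedC oA) (open_closedC oB) AB.
  by have : (~` A) a by rewrite e.
by have : (~` B) b by rewrite e.
Qed.

Theorem theoremB (K : comPzSemiRingType) (X : monoidScheme)
  (XK : base_change K X) (I : Type) (U : I -> opens X) (n : nat) :
  semifield K -> idempotent_semiring K ->
  irreducible X ->
  \bigcup_i U i = [set: X] ->
  (forall D : set I, finite_set D -> D !=set0 ->
    is_spec_cancellative (\bigcap_(i in D) U i)) ->
  exists Phi : mVect X n -> sVect XK n,
    bijective Phi /\
    forall (F : mvb X n) (E : svb XK n),
      Phi (mvb_class F) = svb_class E <-> is_pullback (bc_proj XK) F E.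
Proof.
move=> Kf Kid irr cov spec.
(* Empty members, which are spectra of the zero monoid, are discarded, since [tame] fails for them.
   The remaining double and triple overlaps are nonempty by irreducibility. *)
pose J := {i : I | oset (U i) !=set0}; pose V (j : J) := U (sval j).
have V0 j : oset (V j) !=set0 := svalP j.
have covV : \bigcup_j V j = [set: X].
  apply/seteqP; split=> // x _; have [i _ Ux] : (\bigcup_i U i) x by rewrite cov.
  by exists (exist _ i (ex_intro _ x Ux)).
have [[x _] _] := irr.
have [j0 _ _] : (\bigcup_j V j) x by rewrite covV.
have V20 i j : oset (meet (V i) (V j)) !=set0.
  by apply: irreducible_openI => //; exact: opensP.
have V30 i j l : oset (meet (meet (V i) (V j)) (V l)) !=set0.
  by apply: irreducible_openI => //; exact: opensP.
(* Overlaps are indexed by sets D of indices, so coinciding indices need no separate case. *)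
have tameP (W : opens X) (D : set I) : finite_set D -> D !=set0 ->
    oset W = \bigcap_(i in D) U i -> oset W !=set0 -> tame XK W.
  move=> fD D0 e W0; apply: spec_cancellative_tame => //.
  by rewrite e; exact: spec.
have V1 i : tame XK (V i).
  apply: (@tameP _ [set sval i]) => //; first by exists (sval i).
  by rewrite bigcap_set1.
have V2 i j : tame XK (meet (V i) (V j)).
  apply: (@tameP _ ([set sval i] `|` [set sval j])) => //.
  - by exists (sval i); left.
  by rewrite bigcap_setU !bigcap_set1.
have V3 i j l : tame XK (meet (meet (V i) (V j)) (V l)).
  apply: (@tameP _ ([set sval i] `|` [set sval j] `|` [set sval l])) => //.
  - by exists (sval i); left; left.
  by rewrite !bigcap_setU !bigcap_set1.
exact: (pullback_classes n j0 Kf covV V1 V2 V3).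
Qed.
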